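(* Let $0<\xi<1$ be a rational number. The $\mathbb Q$-graded vertex operator superalgebra $(L_{\widehat{\mathfrak g}}(\tfrac12,0),\omega_\xi)$ is not rational. Moreover, the category $\mathcal C_{\frac12}$ is not semisimple (i.e. not every object of $\mathcal C_{\frac12}$ is a direct sum of irreducible objects).
   Context: $\mathfrak g=sl(2|1)$ is the complex Lie superalgebra of $3\times 3$ matrices with $\mathrm{str}(x)=x_{11}+x_{22}-x_{33}=0$, with basis (matrix units $E_{ij}$) $h_1=E_{11}+E_{33}$, $h_2=-E_{22}-E_{33}$, $e_{12}=E_{12}$, $f_{12}=E_{21}$ (even) and $e_1=E_{13}$, $e_2=E_{32}$, $f_1=E_{31}$, $f_2=-E_{23}$ (odd); $h_+=h_1+h_2$; $\mathfrak n_+=\mathrm{span}\{e_1,e_2,e_{12}\}$; $(x,y)=\mathrm{str}(xy)$. $\tilde{\mathfrak g}=\mathfrak g\otimes\mathbb C[t,t^{-1}]\oplus\mathbb C k$, $k$ central, $a(n)=a\otimes t^n$, $[a(m),b(n)]=[a,b](m+n)+m\delta_{m+n,0}(a,b)k$; $N_+=\mathfrak n_+\oplus\mathfrak g\otimes t\mathbb C[t]$, $P=\mathfrak g\otimes\mathbb C[t]\oplus\mathbb C k$. For $\kappa\ne-1$, $V_{\widehat{\mathfrak g}}(\kappa,0)=U(\tilde{\mathfrak g})\otimes_{U(P)}\mathbb C$ ($\mathfrak g\otimes\mathbb C[t]$ acts by $0$ and $k$ by $\kappa$ on $\mathbb C$) is the universal affine vertex operator superalgebra, with vacuum $\mathbf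 1=1\otimes 1$, $Y(a(-1)\mathbf 1,z)=\sum_n a(n)z^{-n-1}$ and Sugawara Virasoro element $\omega=\frac1{2(\kappa+1)}\big(h_1(-1)h_2(-1)+h_2(-1)h_1(-1)+e_{12}(-1)f_{12}(-1)+f_{12}(-1)e_{12}(-1)-e_1(-1)f_1(-1)+f_1(-1)e_1(-1)-e_2(-1)f_2(-1)+f_2(-1)e_2(-1)\big)\mathbf 1$, $Y(\omega,z)=\sum_nL(n)z^{-n-2}$. $L_{\widehat{\mathfrak g}}(\kappa,0)$ is its simple quotient. For rational $0<\xi<1$ put $\omega_\xi=\omega+\frac{\xi}{2}L(-1)h_+(-1)\mathbf 1$. Its modes $L'(n)$ ($Y(\omega_\xi,z)=\sum_nL'(n)z^{-n-2}$) are $L'(n)=L(n)-\frac{\xi}{2}(n+1)h_+(n)$, and $(L_{\widehat{\mathfrak g}}(\kappa,0),\omega_\xi)$ is a $\mathbb Q$-graded vertex operator superalgebra: it is the direct sum of finite-dimensional $L'(0)$-eigenspaces with rational eigenvalues bounded below; $\mathrm{wt}\,v$ denotes the $L'(0)$-eigenvalue of $v$. A weak $V$-module is a vector superspace $M$ with a linear map $Y_M:V\to(\mathrm{End}\,M)[[z,z^{-1}]]$, $Y_M(a,z)=\sum_n a_nz^{-n-1}$, such that $a_nu=0$ for $n$ large, $Y_M(\mathbf 1,z)=\mathrm{Id}_M$, and the (super) Jacobi identity holds. It is a $\mathbb Q_+$-graded weak module if $M=\bigoplus_{n\in\mathbb Q_+}M(n)$ ($\mathbb Q_+$ = nonnegative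 rationals) with $a_mM(n)\subseteq M(\mathrm{wt}\,a+n-m-1)$ for homogeneous $a\in V$, $m\in\mathbb Z$, $n\in\mathbb Q_+$. A $\mathbb Q$-graded vertex operator superalgebra $V$ is rational if every $\mathbb Q_+$-graded weak $V$-module is a direct sum of irreducible $\mathbb Q_+$-graded weak $V$-modules. $\mathcal C_\kappa$ is the full subcategory of the weak $L_{\widehat{\mathfrak g}}(\kappa,0)$-modules $M$ such that every $a\in N_+$ acts locally nilpotently on $M$. *)

(* Defs.v *)
From HB Require Import structures.
From mathcomp Require Import all_boot all_order all_algebra.
From mathcomp Require Import boolp classical_sets reals complex.
From mathcomp Require Import monalg.
From mathcomp Require Import ring.

Set Implicit Arguments.
Unset Strict Implicit.
Unset Printing Implicit Defensive.

Import Order.TTheory GRing.Theory Num.Theory.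
Local Open Scope classical_set_scope.
Local Open Scope ring_scope.
Local Open Scope quotient_scope.

(** * Subspaces, direct sums and quotients *)

Section LinearAlgebra.
Variables (C : nzRingType) (M : lmodType C).

Definition subspace (N : set M) : Prop :=
  N 0 /\ forall (c : C) (u v : M), N u -> N v -> N (c *: u + v).

Definition span (S : set M) : set M :=
  [set v | forall N : set M, subspace N -> S `<=` N -> N v].

(* [M] is the internal direct sum of the subspaces [N i]. *)
Definition direct_sum (I : choiceType) (N : I -> set M) : Prop :=
  [/\ forall i, subspace (N i),
      forall v, exists (s : seq I) (f : I -> M),
        [/\ uniq s, forall i, N i (f i) & v = \sum_(i <- s) f i]
    & forall (s : seq I) (f : I -> M), uniq s -> (forall i, N i (f i)) ->
        \sum_(i <- s) f i = 0 -> forall i, i \in s -> f i = 0].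

(* [N] contains the homogeneous components of its elements. *)
Definition homogeneous_subset (I : choiceType) (gr : I -> set M) (N : set M) :=
  forall (s : seq I) (f : I -> M), uniq s -> (forall i, gr i (f i)) ->
    N (\sum_(i <- s) f i) -> forall i, i \in s -> N (f i).

Lemma span_subspace (S : set M) : subspace (span S).
Proof.
split=> [N [N0 _] _ //|c u v Su Sv N sN SN].
by case: (sN) => _; apply; [exact: Su | exact: Sv].
Qed.

Lemma sub_span (S : set M) : S `<=` span S.
Proof. by move=> v Sv N _; apply. Qed.

Variable S : set M.

Definition span_pred : {pred M} := fun v => `[< span S v >].

Lemma span_predP (v : M) : reflect (span S v) (v \in span_pred).
Proof. exact: asboolP. Qed.

Fact span_zmod_closed : zmod_closed span_pred.
Proof.
have [S0 SP] := span_subspace S; split=> [|u v /span_predP Su /span_predP Sv].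
  exact/span_predP.
by apply/span_predP; rewrite addrC -scaleN1r; apply: SP.
Qed.
HB.instance Definition _ := GRing.isZmodClosed.Build M span_pred span_zmod_closed.

Local Notation Q := (Quotient.quot span_pred).

Definition lquot : Type := Q.
HB.instance Definition _ := GRing.Zmodule.copy lquot Q.

Definition lquot_pi (u : M) : lquot := \pi_Q u.
Definition lquot_repr (q : lquot) : M := repr (q : Q).

Lemma lquot_piP (u v : M) : lquot_pi u = lquot_pi v <-> span S (u - v).
Proof.
split=> [/(@eqquotP _ _ Q)|uv]; first by move/span_predP.
by apply/(@eqquotP _ _ Q)/span_predP.
Qed.

Lemma lquot_reprK (q : lquot) : lquot_pi (lquot_repr q) = q.
Proof. exact: (@reprK _ Q). Qed.

Lemma lquot_pi_ind (P : lquot -> Prop) :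
  (forall u, P (lquot_pi u)) -> forall q, P q.
Proof. by move=> IH q; rewrite -(lquot_reprK q). Qed.

Lemma lquot_piD (u v : M) : lquot_pi (u + v) = lquot_pi u + lquot_pi v.
Proof. exact: (raddfD (\pi_Q)). Qed.

Definition lquot_scale (c : C) (q : lquot) : lquot := lquot_pi (c *: lquot_repr q).

Lemma lquot_scale_pi (c : C) (u : M) :
  lquot_scale c (lquot_pi u) = lquot_pi (c *: u).
Proof.
have [S0 SP] := span_subspace S.
apply/lquot_piP; rewrite -scalerBr -[X in span S X]addr0; apply: SP => //.
by apply/lquot_piP; rewrite lquot_reprK.
Qed.

Fact lquot_scaleA (a b : C) (q : lquot) :
  lquot_scale a (lquot_scale b q) = lquot_scale (a * b) q.
Proof.
by elim/lquot_pi_ind: q => u; rewrite !lquot_scale_pi scalerA.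
Qed.
Fact lquot_scale1 : left_id 1 lquot_scale.
Proof. by elim/lquot_pi_ind=> u; rewrite lquot_scale_pi scale1r. Qed.
Fact lquot_scaleDr : right_distributive lquot_scale +%R.
Proof.
move=> c; elim/lquot_pi_ind=> u; elim/lquot_pi_ind=> v.
by rewrite -lquot_piD !lquot_scale_pi scalerDr lquot_piD.
Qed.
Fact lquot_scaleDl (q : lquot) : {morph lquot_scale^~ q : a b / a + b}.
Proof.
by move=> a b; elim/lquot_pi_ind: q => u;
  rewrite !lquot_scale_pi scalerDl lquot_piD.
Qed.
HB.instance Definition _ := GRing.Zmodule_isLmodule.Build C lquot
  lquot_scaleA lquot_scale1 lquot_scaleDr lquot_scaleDl.

Fact lquot_pi_linear : linear lquot_pi.
Proof. by move=> c u v; rewrite lquot_piD -lquot_scale_pi. Qed.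
HB.instance Definition _ :=
  GRing.isLinear.Build C M lquot *:%R lquot_pi lquot_pi_linear.

End LinearAlgebra.

(** * The Lie superalgebra sl(2|1) *)

Section Sl21.
Variable C : fieldType.

Definition str (x : 'M[C]_3) : C := x 0 0 + x 1 1 - x 2 2.

Definition odd_index (i : 'I_3) : bool := i == 2.

Definition spart (p : bool) (x : 'M[C]_3) : 'M[C]_3 :=
  \matrix_(i, j) (if odd_index i (+) odd_index j == p then x i j else 0).

Definition sl_pred : {pred 'M[C]_3} := [pred x | str x == 0].

Fact sl_submod_closed : submod_closed sl_pred.
Proof.
split=> [|c x y]; rewrite !inE.
  by rewrite /str !mxE addr0 subr0 eqxx.
have -> : str (c *: x + y) = c * str x + str y by rewrite /str !mxE; ring.
by move=> /eqP-> /eqP->; rewrite mulr0 addr0.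
Qed.
HB.instance Definition _ :=
  GRing.isSubmodClosed.Build C 'M[C]_3 sl_pred sl_submod_closed.

Record sl21 : predArgType := Sl21 { slmx :> 'M[C]_3; _ : slmx \in sl_pred }.
HB.instance Definition _ := [isSub for slmx].
HB.instance Definition _ := [Choice of sl21 by <:].
HB.instance Definition _ := [SubChoice_isSubLmodule of sl21 by <:].

Definition sl_hom (p : bool) (x : sl21) : Prop := spart p x = x.

Definition sbr_mx (x y : 'M[C]_3) : 'M[C]_3 :=
  \sum_(p : bool) \sum_(q : bool)
    (spart p x *m spart q y - (-1) ^+ (p && q) *: (spart q y *m spart p x)).

Lemma str_mulC (p q : bool) (x y : 'M[C]_3) :
  str (spart p x *m spart q y) =
  (-1) ^+ (p && q) * str (spart q y *m spart p x).
Proof.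
have l1 : lift ord0 (ord0 : 'I_2) = 1 :> 'I_3 by apply: val_inj.
have l2 : lift ord0 (lift ord0 (ord0 : 'I_1)) = 2 :> 'I_3 by apply: val_inj.
have o0 : odd_index 0 = false by [].
have o1 : odd_index 1 = false by [].
have o2 : odd_index 2 = true by [].
rewrite /str !mxE !big_ord_recl !big_ord0 !mxE l1 l2.
rewrite -[ord0]/(0 : 'I_3) !o0 !o1 !o2.
by case: p; case: q => /=; ring.
Qed.

Lemma strB (c : C) (x y : 'M[C]_3) : str (x - c *: y) = str x - c * str y.
Proof. by rewrite /str !mxE; ring. Qed.

Fact sbr_subproof (x y : 'M[C]_3) : sbr_mx x y \in sl_pred.
Proof.
apply: rpred_sum => p _; apply: rpred_sum => q _.
by rewrite inE strB str_mulC subrr.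
Qed.

Definition sbr (x y : sl21) : sl21 := Sl21 (sbr_subproof x y).

Definition sform (x y : sl21) : C := str ((x : 'M[C]_3) *m (y : 'M[C]_3)).

Local Notation E i j := (delta_mx i j : 'M[C]_3).

Ltac str0 := by rewrite inE /str !mxE /=; apply/eqP; ring.

Fact h1_subproof : E 0 0 + E 2 2 \in sl_pred. Proof. str0. Qed.
Fact h2_subproof : - E 1 1 - E 2 2 \in sl_pred. Proof. str0. Qed.
Fact e12_subproof : E 0 1 \in sl_pred. Proof. str0. Qed.
Fact f12_subproof : E 1 0 \in sl_pred. Proof. str0. Qed.
Fact e1_subproof : E 0 2 \in sl_pred. Proof. str0. Qed.
Fact e2_subproof : E 2 1 \in sl_pred. Proof. str0. Qed.
Fact f1_subproof : E 2 0 \in sl_pred. Proof. str0. Qed.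
Fact f2_subproof : - E 1 2 \in sl_pred. Proof. str0. Qed.

Definition h1 := Sl21 h1_subproof.
Definition h2 := Sl21 h2_subproof.
Definition e12 := Sl21 e12_subproof.
Definition f12 := Sl21 f12_subproof.
Definition e1 := Sl21 e1_subproof.
Definition e2 := Sl21 e2_subproof.
Definition f1 := Sl21 f1_subproof.
Definition f2 := Sl21 f2_subproof.
Definition hplus := h1 + h2.

Definition nplus : set sl21 :=
  [set x | exists a b c : C, x = a *: e1 + b *: e2 + c *: e12].

End Sl21.

(** * Free algebras *)

Section FreeAlgebra.
Variables (C : fieldType) (K : choiceType).

Definition fmalg : Type := {malg C[{fmonom K}]}.
HB.instance Definition _ := GRing.Lalgebra.on fmalg.

Fact fmalg_scaleAr (c : C) (u v : fmalg) : c *: (u * v) = u * (c *: v).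
Proof.
have cU (w : fmalg) : w * c%:MP = c *: w.
  rewrite malgM_def malgZ_def fgmulgU.
  by apply/eq_bigr=> /= k _; rewrite mulm1 mulrC.
by rewrite -[c *: v]mul_malgC mulrA cU scalerAl.
Qed.
HB.instance Definition _ := GRing.Lalgebra_isAlgebra.Build C fmalg fmalg_scaleAr.

Definition fmalg_gen (k : K) : fmalg := << fmu k >>%R.

Lemma fmalg_ind (P : set fmalg) :
  subspace P -> P 1 -> (forall k u, P u -> P (fmalg_gen k * u)) -> forall u, P u.
Proof.
move=> [P0 PD] P1 PM u; rewrite [u]monalgE.
elim/big_ind: _ => // [a b Pa Pb|w _]; first by rewrite -[a]scale1r; apply: PD.
have -> : << u@_w *g w >> = u@_w *: << w >> + 0 :> fmalg.
  by rewrite addr0; apply/malgP=> k; rewrite mcoeffZ !mcoeffU mulrnAr mulr1.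
apply: PD => //; case: w => s; elim: s => [|l s IH].
  by rewrite -fmE.
have -> : << FMonom (l :: s) >> = fmalg_gen l * << FMonom s >> :> fmalg.
  rewrite malgM_def fgmulUU mulr1; congr << _ >>; apply/eqP.
  by rewrite -val_eqE /= fmM fmU.
exact: PM.
Qed.

Record algebra_with_gens := AlgebraWithGens {
  awg_alg : algType C;
  awg_gen : K -> awg_alg
}.

(* Locked because the operations of [malg] unfold badly in unification. *)
Fact free_alg_key : unit. Proof. exact: tt. Qed.
Definition free_algebra : algebra_with_gens :=
  locked_with free_alg_key (AlgebraWithGens fmalg_gen).
Definition free_alg : algType C := awg_alg free_algebra.
Definition free_gen : K -> free_alg := awg_gen free_algebra.

Lemma free_alg_ind (P : set free_alg) :
  subspace P -> P 1 -> (forall k u, P u -> P (free_gen k * u)) -> forall u, P u.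
Proof.
move: P; rewrite /free_gen /free_alg /free_algebra.
by case: free_alg_key; apply: fmalg_ind.
Qed.

End FreeAlgebra.

(** * The module V(kappa, 0) *)

Section UniversalAffine.
Variables (C : fieldType) (kappa : C).

(* [Some (x, n)] stands for x(n) = x (x) t^n, and [None] for k. *)
Definition letter : choiceType := option (sl21 C * int).
Local Notation T := (free_alg C letter).

Definition genx (x : sl21 C) (n : int) : T := free_gen C (Some (x, n) : letter).
Definition genk : T := free_gen C (None : letter).

(* The defining relations of the universal enveloping algebra. *)
Variant U_relation : set T :=
| U_linear c x y n :
    U_relation (genx (c *: x + y) n - (c *: genx x n + genx y n))
| U_bracket p q x y m n : sl_hom p x -> sl_hom q y ->
    U_relation (genx x m * genx y n - (-1) ^+ (p && q) *: (genx y n * genx x m)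
      - (genx (sbr x y) (m + n) +
         (if m + n == 0 then m%:~R * sform x y else 0) *: genk))
| U_central x n : U_relation (genk * genx x n - genx x n * genk).

(* U (x)_{U(P)} C is U modulo the left ideal generated by the a - eps(a) for
   a in P, where P acts on C through the character eps. *)
Variant V_relation : set T :=
| V_ideal u r v : U_relation r -> V_relation (u * r * v)
| V_nonneg u x n : (0 <= n)%R -> V_relation (u * genx x n)
| V_level u : V_relation (u * (genk - kappa *: 1)).

Definition Vaff : Type := lquot V_relation.
HB.instance Definition _ := GRing.Lmodule.on Vaff.

Definition Vproj (u : T) : Vaff := lquot_pi V_relation u.
Fact Vproj_linear : linear Vproj.
Proof. exact: lquot_pi_linear. Qed.
HB.instance Definition _ :=
  GRing.isLinear.Build C T Vaff *:%R Vproj Vproj_linear.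

Definition Vvac : Vaff := Vproj 1.
Definition Vmode (x : sl21 C) (n : int) (v : Vaff) : Vaff :=
  Vproj (genx x n * lquot_repr v).

Lemma VprojP (u v : T) : Vproj u = Vproj v <-> span V_relation (u - v).
Proof. exact: lquot_piP. Qed.

Lemma Vproj_ind (P : Vaff -> Prop) : (forall u, P (Vproj u)) -> forall v, P v.
Proof. exact: lquot_pi_ind. Qed.

Lemma Vproj_eq0 (u : T) : V_relation u -> Vproj u = 0.
Proof.
move=> Vu; rewrite -(linear0 Vproj); apply/VprojP; rewrite subr0.
exact: sub_span.
Qed.

Lemma Vproj_mull (w u v : T) : Vproj u = Vproj v -> Vproj (w * u) = Vproj (w * v).
Proof.
move=> /VprojP uv; apply/VprojP; rewrite -mulrBr; set d := u - v in uv *.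
have [S0 SP] := span_subspace V_relation.
move: uv => /(_ [set d | span V_relation (w * d)]); apply.
  split=> [|c a b Sa Sb] /=; first by rewrite mulr0.
  by rewrite mulrDr -scalerAr; apply: SP.
move=> _ [a r b rel|a x n n0|a] /=; rewrite 2?mulrA; apply: sub_span.
- exact: V_ideal.
- exact: V_nonneg.
- exact: V_level.
Qed.

Lemma Vmode_proj x n u : Vmode x n (Vproj u) = Vproj (genx x n * u).
Proof. by apply: Vproj_mull; apply: lquot_reprK. Qed.

Fact Vmode_is_linear x n : linear (Vmode x n).
Proof.
move=> c; elim/Vproj_ind=> u; elim/Vproj_ind=> v.
by rewrite -linearP !Vmode_proj mulrDr -scalerAr linearP.
Qed.
HB.instance Definition _ x n :=
  GRing.isLinear.Build C Vaff Vaff *:%R (Vmode x n) (Vmode_is_linear x n).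

Lemma Vproj_level u : Vproj (genk * u) = kappa *: Vproj u.
Proof.
rewrite -linearZ; move: u; apply: free_alg_ind => [||[[x n]|] u /= IH].
- split=> [|c u v /= Pu Pv]; first by rewrite scaler0 mulr0.
  rewrite mulrDr -scalerAr linearP /= Pu Pv -linearP /=.
  by rewrite scalerDr !scalerA mulrC.
- rewrite /= mulr1; apply/VprojP; apply: sub_span.
  by rewrite -[_ - _]mul1r; apply: V_level.
- rewrite -/(genx x n) scalerAr -(Vproj_mull _ IH).
  apply/eqP; rewrite -subr_eq0 -linearB /= !mulrA -mulrBl -[_ - _]mul1r.
  by apply/eqP/Vproj_eq0/V_ideal/U_central.
by rewrite -/genk (Vproj_mull _ IH) scalerAr.
Qed.

Lemma Vmode_vac x n : (0 <= n)%R -> Vmode x n Vvac = 0.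
Proof.
move=> n0; rewrite Vmode_proj; apply: Vproj_eq0.
by rewrite mulr1 -[genx _ _]mul1r; apply: V_nonneg.
Qed.

Lemma Vmode_linear c x y n v :
  Vmode (c *: x + y) n v = c *: Vmode x n v + Vmode y n v.
Proof.
elim/Vproj_ind: v => u; rewrite !Vmode_proj -linearP; apply/eqP.
rewrite -subr_eq0 -linearB /= scalerAl -mulrDl -mulrBl -[_ - _]mul1r.
by apply/eqP/Vproj_eq0/V_ideal/U_linear.
Qed.

Lemma Vmode_bracket p q x y m n v : sl_hom p x -> sl_hom q y ->
  Vmode x m (Vmode y n v) - (-1) ^+ (p && q) *: Vmode y n (Vmode x m v) =
  Vmode (sbr x y) (m + n) v +
    (if m + n == 0 then m%:~R * sform x y else 0) *: (kappa *: v).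
Proof.
move=> px qy; elim/Vproj_ind: v => u.
rewrite -Vproj_level !Vmode_proj; apply/eqP; rewrite -subr_eq0.
rewrite -!linearZ -linearB -linearD -linearB /= !mulrA !scalerAl -!mulrBl -mulrDl.
rewrite -mulrBl -[X in Vproj (X * u)]mul1r.
apply/eqP/Vproj_eq0/V_ideal; rewrite -scalerAl.
exact: U_bracket px qy.
Qed.

Inductive Vmonomial : bool -> set Vaff :=
| Vmonomial_vac : Vmonomial false Vvac
| Vmonomial_act p q x n v : sl_hom p x -> Vmonomial q v ->
    Vmonomial (p (+) q) (Vmode x n v).

Definition Vpar (p : bool) : set Vaff := span (Vmonomial p).

End UniversalAffine.

(** * Vertex superalgebras and their weak modules *)

Section Vertex.
Variable C : fieldType.

Definition binz (m : int) (i : nat) : C :=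
  (\prod_(j < i) (m%:~R - j%:R)) / i`!%:R.

(* [Y a n b] is a_n b; a superspace is given by its homogeneous subspaces, the
   parity being a boolean (true for odd). *)
Section RawModule.
Variables (V : lmodType C) (parV : bool -> set V) (one : V)
          (Y : V -> int -> V -> V).
Variables (M : lmodType C) (parM : bool -> set M) (YM : V -> int -> M -> M).

(* The coefficient of z0^(-l-1) z1^(-m-1) z2^(-n-1) in the Jacobi identity.
   Both sums have finitely many nonzero terms. *)
Definition jacobi_identity : Prop :=
  forall (p q : bool) (a b : V) (u : M) (l m n : int), parV p a -> parV q b ->
  exists K0 : nat, forall K : nat, (K0 <= K)%N ->
    \sum_(i < K) binz m i *: YM (Y a (l + i%:Z) b) (m + n - i%:Z) u =
    \sum_(i < K) ((-1) ^+ i * binz l i) *: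
      (YM a (m + l - i%:Z) (YM b (n + i%:Z) u)
       - ((-1) ^+ absz l * (-1) ^+ (p && q)) *:
           YM b (n + l - i%:Z) (YM a (m + i%:Z) u)).

Record is_weak_module : Prop := IsWeakModule {
  wm_superspace : direct_sum parM;
  wm_linear_l : forall n u, linear (fun a => YM a n u);
  wm_linear_r : forall a n, linear (YM a n);
  wm_parity : forall p q a n u,
    parV p a -> parM q u -> parM (p (+) q) (YM a n u);
  wm_truncated : forall a u, exists N : int, forall n, N <= n -> YM a n u = 0;
  wm_vacuum : forall n u, YM one n u = if n == -1 then u else 0;
  wm_jacobi : jacobi_identity
}.

End RawModule.

Record vertex_superalgebra := VertexSuperalgebra {
  vsa_space :> lmodType C;
  vsa_par : bool -> set vsa_space;
  vsa_one : vsa_space;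
  vsa_Y : vsa_space -> int -> vsa_space -> vsa_space;
  vsa_adjoint : is_weak_module vsa_par vsa_one vsa_Y vsa_par vsa_Y;
  vsa_one_even : vsa_par false vsa_one;
  vsa_creation : forall a,
    vsa_Y a (-1) vsa_one = a /\ forall n, 0 <= n -> vsa_Y a n vsa_one = 0
}.

Record weak_module (V : vertex_superalgebra) := WeakModule {
  wm_space :> lmodType C;
  wm_par : bool -> set wm_space;
  wm_Y : V -> int -> wm_space -> wm_space;
  wm_axioms : is_weak_module (@vsa_par V) (vsa_one V) (@vsa_Y V) wm_par wm_Y
}.

Section Theory.
Variable V : vertex_superalgebra.

Definition ideal (I : set V) : Prop :=
  [/\ subspace I, homogeneous_subset (@vsa_par V) I
    & forall a n b, I b -> I (vsa_Y a n b) /\ I (vsa_Y b n a)].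

Definition simple_vsa : Prop :=
  (exists v : V, v <> 0) /\
  forall I : set V, ideal I -> (forall v, I v -> v = 0) \/ (forall v, I v).

Definition weak_submodule (M : weak_module V) (N : set M) : Prop :=
  [/\ subspace N, homogeneous_subset (@wm_par V M) N
    & forall a n u, N u -> N (wm_Y a n u)].

Definition irreducible_among (M : lmodType C) (sub : set M -> Prop)
    (N : set M) : Prop :=
  [/\ sub N, exists2 v, N v & v <> 0
    & forall N', sub N' -> N' `<=` N -> (forall v, N' v -> v = 0) \/ N `<=` N'].

(* [M] is a direct sum of irreducible subobjects, the subobjects of [M] being
   the subspaces which satisfy [sub]. *)
Definition completely_reducible (M : lmodType C) (sub : set M -> Prop) : Prop :=
  exists (I : choiceType) (N : I -> set M),
    direct_sum N /\ forall i, irreducible_among sub (N i).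

(* [omega] plays the role of the conformal vector: weights are eigenvalues of
   its mode omega_1. *)
Definition has_weight (omega : V) (w : rat) (a : V) : Prop :=
  vsa_Y omega 1 a = ratr w *: a.

(* M(n) is [gr n]; the grading is by nonnegative rationals since [gr n] vanishes
   for n < 0. *)
Definition Qplus_grading (omega : V) (M : weak_module V) (gr : rat -> set M)
    : Prop :=
  [/\ direct_sum gr,
      forall n, n < 0 -> gr n `<=` [set 0],
      forall n, homogeneous_subset (@wm_par V M) (gr n)
    & forall w a m n u, has_weight omega w a -> gr n u ->
        gr (w + n - m%:~R - 1) (wm_Y a m u)].

Definition graded_submodule (M : weak_module V) (gr : rat -> set M)
    (N : set M) : Prop :=
  weak_submodule N /\ homogeneous_subset gr N.

Definition rational_vosa (omega : V) : Prop :=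
  forall (M : weak_module V) (gr : rat -> set M), Qplus_grading omega gr ->
    completely_reducible (graded_submodule gr).

End Theory.

Record simple_quotient (V : vertex_superalgebra) := SimpleQuotient {
  sq_vsa :> vertex_superalgebra;
  sq_proj : {linear V -> sq_vsa};
  sq_surj : forall w, exists v, sq_proj v = w;
  sq_par : forall p v, vsa_par p v -> vsa_par p (sq_proj v);
  sq_one : sq_proj (vsa_one V) = vsa_one sq_vsa;
  sq_Y : forall a n b, sq_proj (vsa_Y a n b) = vsa_Y (sq_proj a) n (sq_proj b);
  sq_simple : simple_vsa sq_vsa
}.

End Vertex.

(** * Affine vertex operator superalgebras of sl(2|1) *)

Section Affine.
Variables (C : fieldType) (kappa : C).

(* The vertex superalgebra structure on V(kappa, 0), which is unique. *)
Record affine_vsa := AffineVsa {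
  av_Y : Vaff kappa -> int -> Vaff kappa -> Vaff kappa;
  av_adjoint :
    is_weak_module (@Vpar C kappa) (Vvac kappa) av_Y (@Vpar C kappa) av_Y;
  av_creation : forall a, av_Y a (-1) (Vvac kappa) = a /\
    forall n, 0 <= n -> av_Y a n (Vvac kappa) = 0;
  av_gen : forall x n v, av_Y (Vmode x (-1) (Vvac kappa)) n v = Vmode x n v
}.

Lemma Vpar_vac : Vpar false (Vvac kappa).
Proof. by apply: sub_span; apply: Vmonomial_vac. Qed.

Definition vsa_of_affine (V : affine_vsa) : vertex_superalgebra C :=
  VertexSuperalgebra (av_adjoint V) Vpar_vac (av_creation V).
Coercion vsa_of_affine : affine_vsa >-> vertex_superalgebra.

Definition sugawara : Vaff kappa :=
  let b x y := Vmode x (-1) (Vmode y (-1) (Vvac kappa)) in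
  let h1 := h1 C in let h2 := h2 C in let e12 := e12 C in let f12 := f12 C in
  let e1 := e1 C in let f1 := f1 C in let e2 := e2 C in let f2 := f2 C in
  (2 * (kappa + 1))^-1 *:
    (b h1 h2 + b h2 h1 + b e12 f12 + b f12 e12
     - b e1 f1 + b f1 e1 - b e2 f2 + b f2 e2).

(* L(-1) is the mode omega_0. *)
Definition omega_xi (V : affine_vsa) (xi : rat) : V :=
  sugawara + ratr (xi / 2) *:
    av_Y V sugawara 0 (Vmode (hplus C) (-1) (Vvac kappa)).

Section Category.
Variables (V : affine_vsa) (L : simple_quotient V).

Definition current_mode (M : weak_module L) (x : sl21 C) (n : int) : M -> M :=
  wm_Y (sq_proj L (Vmode x (-1) (Vvac kappa))) n.

(* The action of the element \sum_(n < N) y n (x) t^n of N_+. *)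
Definition Nplus_act (M : weak_module L) (N : nat) (y : nat -> sl21 C) (u : M)
    : M :=
  \sum_(n < N) current_mode (y n) n%:Z u.

Definition in_category (M : weak_module L) : Prop :=
  forall (N : nat) (y : nat -> sl21 C), nplus (y 0%N) ->
  forall u : M, exists k : nat, iter k (Nplus_act N y) u = 0.

Definition semisimple_category : Prop :=
  forall M : weak_module L, in_category M ->
    completely_reducible (@weak_submodule C L M).

End Category.
End Affine.

(* Main.v *)
Require Import Defs.
From HB Require Import structures.
From mathcomp Require Import all_boot all_order all_algebra.
From mathcomp Require Import boolp classical_sets functions reals complex.
From mathcomp Require Import ring lra zify.
Import Defs Order.TTheory GRing.Theory Num.Theory.

Set Implicit Arguments.
Unset Strict Implicit.
Unset Printing Implicit Defensive.

Local Open Scope classical_set_scope.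
Local Open Scope ring_scope.

(** The vertex algebra L has infinitely many pairwise inequivalent irreducible
    modules, all of which can be graded from 0 on; an infinite product of them,
    graded degree by degree, is not a direct sum of irreducible modules.

    The modules are the spectral flows of L along u = diag (1, 1, 2): on the space L,
    a vector a acts by the field Y (Delta (s u, z) a, z), where s is a natural number
    and Delta is Li's operator.  That this is a weak module rests on the conjugation
    formula [li_mode] for Li's operator, which with the Vandermonde identity gives
    [twisted_jacobi].

    On the s-th flow the degree is L(0) + s u(0) - (xi / 2) h_+(0) up to a constant.
    It is bounded below, because only finitely many modes x(-n) with n > 0 lower it;
    these are odd, and by [repeated_odd_letter] each is needed at most once in a
    monomial ([flow_degree_bound]).  So the flows can be shifted to start in degree 0, and the
    sequences (v_s) with v_s in the s-th flow, whose degrees lie in a finite set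
    independent of s, form a graded weak module.  Deformation by 0 < xi < 1 makes all
    elements of N_+ lower the degree, so that graded modules lie in the category C
    ([graded_in_category]) and one module refutes both statements.

    Suppose that this product is a direct sum of irreducible submodules.  A sequence
    (v_s) with all v_s nonzero lies in a finite sum of them, so that one of them, N, has
    nonzero projections to the flows s and t for some s <> t.  These projections
    are injective on N, and the first is onto since the simplicity of L makes every
    flow irreducible.  Hence the vacuum of the flow s corresponds to a nonzero vector w
    of the flow t.  On the vacuum, the zero mode of u and the operator L(0) of the flow
    s are - 2 kappa s and - kappa s^2, because (u, u) = - 2.  Comparing with the flow t,
    u(0) w = 2 kappa (t - s) w and L(0) w = - kappa (t - s)^2 w in L.  As kappa > 0, this is
    a negative eigenvalue of L(0) on L: a contradiction ([irreducible_support]). *)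

(** * Subspaces and direct sums *)

Section Subspaces.
Variables (C : nzRingType) (M : lmodType C).
Implicit Types (N S P : set M).

Lemma subspace0 N : subspace N -> N 0.
Proof. by case. Qed.

Lemma subspaceP N c u v : subspace N -> N u -> N v -> N (c *: u + v).
Proof. by case=> _; apply. Qed.

Lemma subspaceD N u v : subspace N -> N u -> N v -> N (u + v).
Proof. by move=> sN Nu Nv; rewrite -[u]scale1r; apply: subspaceP. Qed.

Lemma subspaceZ N c u : subspace N -> N u -> N (c *: u).
Proof.
by move=> sN Nu; rewrite -[_ *: _]addr0; apply: subspaceP => //; apply: subspace0.
Qed.

Lemma subspaceB N u v : subspace N -> N u -> N v -> N (u - v).
Proof.
by move=> sN Nu Nv; rewrite addrC -scaleN1r; apply: subspaceP.
Qed.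

Lemma subspace_sum (I : eqType) (s : seq I) N (F : I -> M) :
  subspace N -> (forall i, i \in s -> N (F i)) -> N (\sum_(i <- s) F i).
Proof.
move=> sN NF; rewrite big_seq; elim/big_ind: _ => //; first exact: subspace0.
by move=> *; apply: subspaceD.
Qed.

Lemma subspace_sum_ord n N (F : 'I_n -> M) :
  subspace N -> (forall i, N (F i)) -> N (\sum_i F i).
Proof. by move=> sN NF; apply: subspace_sum. Qed.

Lemma span_ind S P : subspace P -> S `<=` P -> span S `<=` P.
Proof. by move=> sP SP v; apply. Qed.

Lemma span_sub S S' : S `<=` S' -> span S `<=` span S'.
Proof.
move=> SS'; apply: span_ind; first exact: span_subspace.
by move=> v /SS' Sv; exact: (sub_span Sv).
Qed.

End Subspaces.

Lemma preimage_subspace (C : nzRingType) (M M' : lmodType C)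
    (f : {linear M -> M'}) (N : set M') :
  subspace N -> subspace [set v | N (f v)].
Proof.
move=> sN; split=> [|c u v /= Nu Nv]; first by rewrite /= linear0; apply: subspace0.
by rewrite /= linearP; apply: subspaceP.
Qed.

Lemma sum_ord_stable (M : nmodType) (F : nat -> M) (K K' : nat) :
  (K <= K')%N -> (forall i, (K <= i)%N -> F i = 0) ->
  \sum_(i < K') F i = \sum_(i < K) F i.
Proof.
move=> KK' F0; rewrite -!(big_mkord xpredT) (big_cat_nat (leq0n K)) //=.
rewrite [X in _ + X]big_nat_cond [X in _ + X]big1 ?addr0 // => i /andP[/andP[Ki _] _].
exact: F0.
Qed.

(** The vanishing of the terms outside the triangle lets a double sum be summed
    along its antidiagonals. *)
Lemma sum_antidiagonal (M : nmodType) (F : nat -> nat -> M) (K : nat) :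
  (forall i j, (K <= i + j)%N -> F i j = 0) ->
  \sum_(i < K) \sum_(j < K) F i j = \sum_(r < K) \sum_(i < r.+1) F i (r - i)%N.
Proof.
move=> F0; pose G i r : M := if (i <= r)%N then F i (r - i)%N else 0.
have inner (r : 'I_K) : \sum_(i < r.+1) F i (r - i)%N = \sum_(i < K) G i r.
  rewrite (@sum_ord_stable _ (G^~ r) r.+1) //; last first.
    by move=> i; rewrite /G ltnNge => /negbTE->.
  by apply: eq_bigr => i _; rewrite /G -ltnS ltn_ord.
rewrite (eq_bigr _ (fun r _ => inner r)) [RHS]exchange_big /=; apply: eq_bigr => i _.
have KE : K = (i + (K - i))%N by rewrite subnKC // ltnW.
transitivity (\sum_(0 <= j < K) F i j); first by rewrite big_mkord.
transitivity (\sum_(0 <= r < K) G i r); last by rewrite big_mkord.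
rewrite [RHS](@big_cat_nat _ _ _ i 0 K) //=; last by rewrite ltnW.
rewrite [X in X + _]big_nat_cond [X in X + _]big1 ?add0r; last first.
  by move=> r /andP[/andP[_ ri] _]; rewrite /G leqNgt ri.
rewrite -{2}[val i]add0n big_addn.
rewrite (@big_cat_nat _ _ _ (K - i) 0 K) //= ?leq_subr //.
rewrite [X in _ + X]big_nat_cond [X in _ + X]big1 ?addr0; last first.
  by move=> r /andP[/andP[Kr _] _]; rewrite F0 // -leq_subLR.
by apply: eq_bigr => r _; rewrite /G leq_addl addnK.
Qed.

(** If the operator [D t] separates [i] from [j], then applying [D t - ev j t] to a
    linear relation removes its term [j] and multiplies its term [i] by a nonzero
    scalar. *)
Lemma eigen_independent (C : fieldType) (M : lmodType C) (I : eqType) (T : Type)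
    (D : T -> {linear M -> M}) (ev : I -> T -> C) :
  (forall i j, i != j -> exists t, ev i t != ev j t) ->
  forall (s : seq I) f, uniq s -> (forall i t, D t (f i) = ev i t *: f i) ->
    \sum_(i <- s) f i = 0 -> forall i, i \in s -> f i = 0.
Proof.
move=> sep.
have main i0 s f : i0 \notin s -> (forall i t, D t (f i) = ev i t *: f i) ->
    f i0 + \sum_(i <- s) f i = 0 -> f i0 = 0.
  elim: s f => [|j s IH] f; first by rewrite big_nil addr0.
  rewrite inE negb_or => /andP[ij si] fD; rewrite big_cons => eq0.
  have [t tP] := sep _ _ ij.
  pose f' i := (ev i t - ev j t) *: f i.
  have f'0 : f' i0 + \sum_(i <- s) f' i = 0.
    have /(congr1 (fun x => D t x - ev j t *: x)) := eq0.
    rewrite linear0 scaler0 subr0 !linearD /= linear_sum /= !fD => eq1.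
    rewrite -[RHS]eq1 (eq_bigr _ (fun i _ => fD i t)) /f'.
    rewrite (eq_bigr _ (fun i _ => scalerBl _ _ _)) sumrB -scaler_sumr.
    rewrite ?scalerDr ?opprD scalerBl.
    set A := \sum_(i <- _) _; set B := _ *: \sum_(i <- _) _.
    set a := _ *: f i0; set a' := _ *: f i0; set b := _ *: f j.
    rewrite -!addrA; congr (_ + _).
    by rewrite [- b - B]addrC [b + _]addrC -!addrA addNr addr0 [RHS]addrCA.
  have /eqP : (ev i0 t - ev j t) *: f i0 = 0.
    by apply: IH f'0 => // i t'; rewrite linearZ /= fD !scalerA mulrC.
  by rewrite scaler_eq0 subr_eq0 (negbTE tP) /= => /eqP.
move=> s f us fD s0 i si.
apply: (main i (rem i s) f) => //; first by rewrite mem_rem_uniq // inE eqxx.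
by rewrite -[RHS]s0 [RHS](big_rem i si).
Qed.

Lemma sum_support (J : choiceType) (s s' : seq J) (M' : zmodType) (g : J -> M') :
  uniq s -> uniq s' -> {subset s <= s'} -> (forall i, i \notin s -> g i = 0) ->
  \sum_(i <- s') g i = \sum_(i <- s) g i.
Proof.
move=> us us' ss' g0; rewrite (bigID (mem s)) /= [X in _ + X]big1 // addr0.
rewrite -big_filter; apply: perm_big; apply: uniq_perm => //.
  exact: filter_uniq.
by move=> i; rewrite mem_filter; case si: (i \in s) => //=; rewrite ss'.
Qed.

Section Decompositions.
Variables (C : nzRingType) (M : lmodType C) (I : choiceType) (N : I -> set M).
Hypothesis sN : forall i, subspace (N i).

Definition decomposition (v : M) (g : I -> M) : Prop :=
  (forall i, N i (g i)) /\
  exists s, [/\ uniq s, forall i, i \notin s -> g i = 0 & v = \sum_(i <- s) g i].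

Lemma decompositionP c u v g g' : decomposition u g -> decomposition v g' ->
  decomposition (c *: u + v) (fun i => c *: g i + g' i).
Proof.
move=> [Ng [s [us g0 ->]]] [Ng' [s' [us' g'0 ->]]].
split=> [i|]; first exact: subspaceP.
exists (undup (s ++ s')); split=> [|i|]; first exact: undup_uniq.
  by rewrite mem_undup mem_cat negb_or => /andP[/g0-> /g'0->]; rewrite scaler0 addr0.
rewrite big_split /= -scaler_sumr; congr (_ *: _ + _); apply/esym/sum_support => //;
  rewrite ?undup_uniq // => i si; by rewrite mem_undup mem_cat si ?orbT.
Qed.

Lemma direct_sum_intro :
  (forall v, span [set u | exists i, N i u] v) ->
  (forall (s : seq I) (f : I -> M), uniq s -> (forall i, N i (f i)) ->
    \sum_(i <- s) f i = 0 -> forall i, i \in s -> f i = 0) -> direct_sum N.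
Proof.
move=> spN indep; split=> // v.
suff [g [Ng [s [us _ ->]]]] : exists g, decomposition v g by exists s, g.
apply: (span_ind (P := [set v | exists g, decomposition v g])) (spN v).
  split=> [|c u w /= [g dg] [g' dg']]; last first.
    by exists (fun i => c *: g i + g' i); apply: decompositionP.
  exists (fun=> 0); split=> [i|]; first exact: subspace0.
  by exists [::]; split=> //; rewrite big_nil.
move=> u [i Nu] /=; exists (fun j => if j == i then u else 0).
split=> [j|]; first by case: eqP => [->|_] //; apply: subspace0.
exists [:: i]; split=> // [k|]; first by rewrite inE => /negbTE->.
by rewrite big_seq1 eqxx.
Qed.

End Decompositions.

Section Components.
Variables (C : fieldType) (M : lmodType C) (I : choiceType) (N : I -> set M).
Hypothesis dN : direct_sum N.

Let sN i : subspace (N i). Proof. by case: dN. Qed.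

Local Notation decomposition := (decomposition N).
Local Notation decompositionP := (decompositionP sN).

Lemma decomposition_exists v : exists g, decomposition v g.
Proof.
have [_ /(_ v)[s [f [us Nf ->]]] _] := dN.
exists (fun i => if i \in s then f i else 0); split=> [i|].
  by case: ifP => // _; apply: subspace0.
exists s; split=> // [i /negbTE-> //|].
by rewrite !big_seq; apply: eq_bigr => i ->.
Qed.

Lemma decomposition_uniq v g g' :
  decomposition v g -> decomposition v g' -> g = g'.
Proof.
move=> dg dg'; have [] := decompositionP (-1) dg' dg.
rewrite scaleN1r addNr => Nd [s [us d0 /esym s0]].
apply/funext => i; case si: (i \in s); last first.
  by move: (d0 i); rewrite si => /(_ isT); rewrite scaleN1r addrC => /subr0_eq.
have [_ _ /(_ s _ us Nd s0 i si)] := dN.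
by rewrite scaleN1r addrC => /subr0_eq.
Qed.

Definition component v : I -> M := projT1 (cid (decomposition_exists v)).

Lemma component_decomposition v : decomposition v (component v).
Proof. exact: projT2 (cid (decomposition_exists v)). Qed.

Lemma componentN v i : N i (component v i).
Proof. by case: (component_decomposition v). Qed.

Definition csupport v : seq I :=
  projT1 (cid (proj2 (component_decomposition v))).

Lemma csupport_uniq v : uniq (csupport v).
Proof. by case: (projT2 (cid (proj2 (component_decomposition v)))). Qed.

Lemma csupport_out v i : i \notin csupport v -> component v i = 0.
Proof. by case: (projT2 (cid (proj2 (component_decomposition v)))) => _ + _; apply. Qed.

Lemma csupport_sum v : v = \sum_(i <- csupport v) component v i.
Proof. by case: (projT2 (cid (proj2 (component_decomposition v)))). Qed.

Lemma component_eq v g : decomposition v g -> component v = g.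
Proof. exact/decomposition_uniq/component_decomposition. Qed.

Lemma componentP c u v i :
  component (c *: u + v) i = c *: component u i + component v i.
Proof.
rewrite (component_eq (decompositionP c (component_decomposition u)
  (component_decomposition v))) //.
Qed.

Lemma component_homogeneous i v j :
  N i v -> component v j = if j == i then v else 0.
Proof.
move=> Nv; rewrite (component_eq (g := fun j => if j == i then v else 0)) //.
split=> [k|]; first by case: eqP => [->|_] //; apply: subspace0.
exists [:: i]; split=> // [k|]; first by rewrite inE => /negbTE->.
by rewrite big_seq1 eqxx.
Qed.

Lemma component0 i : component 0 i = 0.
Proof.
rewrite (component_eq (g := fun=> 0)) //; split=> [k|]; first exact: subspace0.
by exists [::]; split=> //; rewrite big_nil.
Qed.

(** Spanning sets of monomials whose degrees are restricted bound the degrees of all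
    vectors by this lemma. *)
Lemma component_support (A : set I) v i : span [set u | exists2 j, A j & N j u] v ->
  ~ A i -> component v i = 0.
Proof.
move=> Av nAi; move: v Av; apply: span_ind => [|u [j Aj Nu]].
  split=> [|c u v /= ui vi]; first exact: component0.
  by rewrite componentP ui vi scaler0 addr0.
rewrite /= (component_homogeneous i Nu); case: eqP => // ij.
by case: nAi; rewrite ij.
Qed.

Lemma support_vanish (A : set I) : (forall v, span [set u | exists2 j, A j & N j u] v) ->
  forall i v, N i v -> ~ A i -> v = 0.
Proof.
move=> spA i v Nv nAi; rewrite -(component_support (spA v) nAi).
by rewrite (component_homogeneous i Nv) eqxx.
Qed.

Lemma homogeneous_ind (P : set M) :
  subspace P -> (forall i v, N i v -> P v) -> forall v, P v.
Proof.
move=> sP PN v; rewrite [v]csupport_sum; apply: subspace_sum => // i _.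
exact/PN/componentN.
Qed.

Definition linear_glue (M' : lmodType C) (f : I -> M -> M') (v : M) : M' :=
  \sum_(i <- csupport v) f i (component v i).

Section Glue.
Variables (M' : lmodType C) (f : I -> M -> M').
Hypothesis lf : forall i, linear (f i).

Let f0 i : f i 0 = 0.
Proof.
apply: (addrI (f i 0)); rewrite addr0.
by have := lf i 1 0 0; rewrite !scale1r addr0.
Qed.

Lemma linear_glueE v s : uniq s -> (forall i, i \notin s -> component v i = 0) ->
  linear_glue f v = \sum_(i <- s) f i (component v i).
Proof.
move=> us s0; pose s' := undup (s ++ csupport v).
have s'E t : uniq t -> {subset t <= s'} -> (forall i, i \notin t -> component v i = 0) ->
    \sum_(i <- s') f i (component v i) = \sum_(i <- t) f i (component v i).
  move=> ut ts' t0; rewrite (sum_support (s := t)) ?undup_uniq // => i it.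
  by rewrite t0.
rewrite -(s'E s) // => [|i si]; last by rewrite mem_undup mem_cat si.
rewrite (s'E (csupport v)) ?csupport_uniq // => i; last exact: csupport_out.
by move=> si; rewrite mem_undup mem_cat si orbT.
Qed.

Lemma linear_glue_homogeneous i v : N i v -> linear_glue f v = f i v.
Proof.
move=> Nv; rewrite (linear_glueE (s := [:: i])) // => [|j].
  by rewrite big_seq1 (component_homogeneous i Nv) eqxx.
by rewrite inE (component_homogeneous j Nv) => /negbTE->.
Qed.

Lemma linear_glue_linear : linear (linear_glue f).
Proof.
move=> c u v; pose s := undup (csupport u ++ csupport v).
have us : uniq s by apply: undup_uniq.
have s0 i : i \notin s -> component u i = 0 /\ component v i = 0.
  by rewrite mem_undup mem_cat negb_or => /andP[/csupport_out-> /csupport_out->].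
rewrite !(linear_glueE us) => [|i /s0[]//|i /s0[]//|i /s0[u0 v0]]; last first.
  by rewrite componentP u0 v0 scaler0 addr0.
rewrite scaler_sumr -big_split /=; apply: eq_bigr => i _.
by rewrite componentP lf.
Qed.

End Glue.
End Components.

(** * Binomial coefficients with an integer upper argument *)

Section Binomials.
Variable C : numFieldType.
Implicit Types (m : int) (i : nat).

Lemma binz0 m : binz C m 0 = 1.
Proof. by rewrite /binz big_ord0 fact0 divr1. Qed.

Lemma binzS m i : i.+1%:R * binz C m i.+1 = (m%:~R - i%:R) * binz C m i.
Proof.
have i0 : (i.+1%:R : C) != 0 by rewrite pnatr_eq0.
by rewrite /binz big_ord_recr /= factS natrM invfM mulrCA (mulVKf i0) mulrAC mulrC.
Qed.

Lemma binzSl m i : i.+1%:R * binz C m i.+1 = m%:~R * binz C (m - 1) i.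
Proof.
rewrite /binz big_ord_recl factS natrM subr0.
have -> : \prod_(j < i) (m%:~R - (lift ord0 j)%:R) =
          \prod_(j < i) ((m - 1)%:~R - j%:R) :> C.
  by apply: eq_bigr => j _; rewrite lift0 -natr1 intrB; ring.
have i0 : (i.+1%:R : C) != 0 by rewrite pnatr_eq0.
by rewrite invfM mulrCA (mulVKf i0) mulrA.
Qed.

Lemma binz_pascal m i : binz C (m + 1) i.+1 = binz C m i.+1 + binz C m i.
Proof.
have i0 : (i.+1%:R : C) != 0 by rewrite pnatr_eq0.
apply: (mulfI i0); rewrite mulrDr binzSl binzS addrK intrD -natr1 /=; ring.
Qed.

Lemma binz_nat (n i : nat) : binz C n%:Z i = 'C(n, i)%:R.
Proof.
elim: n i => [|n IH] [|i]; rewrite ?binz0 ?bin0 //.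
  by rewrite /binz big_ord_recl subr0 mul0r mul0r bin0n.
by rewrite -addn1 PoszD binz_pascal !IH addn1 binS natrD.
Qed.

(** Extending the lower argument by zero keeps ranges of summation uniform. *)
Definition bz m (j : int) : C := if j is Posz i then binz C m i else 0.

Lemma bz_neg m (j : int) : j < 0 -> bz m j = 0.
Proof. by case: j. Qed.

Lemma bz_pascal m (j : int) : bz (m + 1) j = bz m j + bz m (j - 1).
Proof.
case: j => [[|i]|i]; last by rewrite !bz_neg ?addr0 //; lia.
  by rewrite [bz m (_ - 1)]bz_neg ?addr0 //= !binz0.
by rewrite (_ : i.+1%:Z - 1 = i%:Z) /= ?binz_pascal //; lia.
Qed.

Lemma bz0 (j : int) : bz 0 j = (j == 0)%:R.
Proof. by case: j => // -[|i] /=; rewrite (binz_nat 0) ?bin0 ?bin0n. Qed.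

Lemma bz_diag m (j : int) : j%:~R * bz m j = m%:~R * bz (m - 1) (j - 1).
Proof.
case: j => [[|i]|i]; last by rewrite !bz_neg ?mulr0 //; lia.
  by rewrite mul0r [bz _ (_ - 1)]bz_neg ?mulr0.
rewrite (_ : i.+1%:Z - 1 = i%:Z) /=; last by lia.
exact: binzSl.
Qed.

(** Identities between sums of binomial coefficients are polynomial in the upper
    argument; comparing the Pascal recursions of the two sides proves them for
    negative upper arguments as well. *)
Lemma pascal_unique (F G : int -> int -> C) (K : int) :
  (forall m j, j < K -> F (m + 1) j = F m j + F m (j - 1)) ->
  (forall m j, j < K -> G (m + 1) j = G m j + G m (j - 1)) ->
  (forall j, j < K -> F 0 j = G 0 j) ->
  (forall m j, j < 0 -> F m j = G m j) ->
  forall m j, j < K -> F m j = G m j.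
Proof.
move=> FP GP F0 Fn m j; case: j => [i|i _]; last exact: Fn.
elim: i m => [|i IH] m iK.
- have dn k : F (k + 1) 0%Z - G (k + 1) 0%Z = F k 0%Z - G k 0%Z.
    rewrite FP // GP // (Fn k (0%Z - 1)) //; ring.
  apply/eqP; rewrite -subr_eq0; apply/eqP.
  elim/int_rect: m => [|n IHn|n IHn]; first by rewrite F0 // subrr.
    by rewrite -addn1 PoszD dn.
  rewrite -dn (_ : - n.+1%:Z + 1 = - n%:Z) //; lia.
- have iK' : i%:Z < K by lia.
  have dn k : F (k + 1) i.+1%:Z - G (k + 1) i.+1%:Z = F k i.+1%:Z - G k i.+1%:Z.
    rewrite FP // GP // (_ : i.+1%:Z - 1 = i%:Z) ?(IH k) //; [ring | lia].
  apply/eqP; rewrite -subr_eq0; apply/eqP.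
  elim/int_rect: m => [|n IHn|n IHn]; first by rewrite F0 // subrr.
    by rewrite -addn1 PoszD dn.
  rewrite -dn (_ : - n.+1%:Z + 1 = - n%:Z) //; lia.
Qed.

Lemma vandermonde m m' (t : int) (K : nat) : t < K%:Z ->
  \sum_(i < K) binz C m i * bz m' (t - i%:Z) = bz (m + m') t.
Proof.
move=> tK.
apply: (@pascal_unique (fun m' t => \sum_(i < K) binz C m i * bz m' (t - i%:Z))
          (fun m' t => bz (m + m') t) K _ _ _ _ m' t tK).
- move=> k j _; rewrite -big_split /=; apply: eq_bigr => i _.
  by rewrite bz_pascal mulrDr addrAC.
- by move=> k j _; rewrite addrA bz_pascal.
- move=> j jK; rewrite addr0; case: j jK => [j jK|j _].
    have jK' : (j < K)%N by lia.
    rewrite (bigD1 (Ordinal jK')) //= bz0 subrr eqxx mulr1 big1 ?addr0 // => i ij.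
    rewrite bz0 subr_eq0 [_ == _](_ : _ = false) ?mulr0 //.
    apply/negbTE; apply: contra ij => /eqP[] ij; apply/eqP/val_inj.
    by rewrite /= ij.
  by rewrite bz_neg // big1 // => i _; rewrite bz_neg ?mulr0 //; lia.
- move=> k j jn; rewrite bz_neg // big1 // => i _.
  by rewrite bz_neg ?mulr0 //; lia.
Qed.

Lemma binz_negS (m t : nat) : binz C (- m.+1%:Z) t = (-1) ^+ t * 'C(m + t, t)%:R.
Proof.
elim: t m => [|t IHt] m; first by rewrite binz0 bin0 mulr1.
elim: m => [|m IHm].
  have := binz_pascal (- 1%:Z) t; rewrite addNr (binz_nat 0) bin0n IHt.
  rewrite !add0n !binn !mulr1 exprS mulN1r => /eqP.
  by rewrite eq_sym addrC addr_eq0 => /eqP ->; rewrite opprK.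
have := binz_pascal (- m.+2%:Z) t.
rewrite (_ : - m.+2%:Z + 1 = - m.+1%:Z); last by lia.
rewrite IHm IHt => /esym/(canRL (addrK _)) ->.
rewrite (addSn m t.+1) binS addnS natrD exprS addSn; ring.
Qed.

Lemma binz_negation (k i : nat) :
  (-1) ^+ k * binz C k%:Z i = (-1) ^+ i * bz (- i.+1%:Z) (k%:Z - i%:Z).
Proof.
have [ki|ik] := ltnP k i.
  rewrite binz_nat bin_small // mulr0 bz_neg ?mulr0 //; lia.
rewrite -(subnKC ik) PoszD addrAC subrr add0r /= binz_negS -PoszD binz_nat exprD.
by rewrite -mulrA -[in RHS]bin_sub ?leq_addl // addnK.
Qed.

(** The coefficients (-1)^k 'C(k, i) are those of (- x)^i (1 + x)^-(i + 1), and
    multiplication by the power of 1 + x lowers the upper argument. *)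
Lemma alternating_vandermonde (i : nat) (A R : int) (K : nat) : R < K%:Z ->
  \sum_(k < K) (-1) ^+ k * binz C k%:Z i * bz A (R - k%:Z) =
  (-1) ^+ i * bz (A - i.+1%:Z) (R - i%:Z).
Proof.
move=> RK; under eq_bigr => k _ do rewrite binz_negation -mulrA.
rewrite -mulr_sumr; congr (_ * _).
rewrite addrC -(@vandermonde _ _ _ K); last by lia.
have [Ki|iK] := leqP K i.
  rewrite [LHS]big1 ?[RHS]big1 // => k _.
    by rewrite [X in _ * X]bz_neg ?mulr0 //; lia.
  by rewrite bz_neg ?mul0r //; have := ltn_ord k; lia.
pose F j := bz (- i.+1%:Z) j%:Z * bz A (R - i%:Z - j%:Z).
rewrite [RHS](_ : _ = \sum_(j < (K - i)) F j); last first.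
  apply: (@sum_ord_stable _ F); first exact: leq_subr.
  by move=> j ij; rewrite /F [X in _ * X]bz_neg ?mulr0 //; lia.
rewrite -(big_mkord xpredT
  (fun k => bz (- i.+1%:Z) (k%:Z - i%:Z) * bz A (R - k%:Z))).
rewrite (@big_cat_nat _ _ _ i) //=; last by rewrite ltnW.
rewrite big_nat_cond big1 ?add0r; last first.
  by move=> k /andP[/andP[_ ki] _]; rewrite bz_neg ?mul0r //; lia.
rewrite -[X in \sum_(X <= _ < _) _]add0n big_addn big_mkord.
apply: eq_bigr => j _; rewrite /F.
by congr (bz _ _ * bz _ _); lia.
Qed.

End Binomials.

(** * Modes on vertex superalgebras and their modules *)

Section Modes.
Variables (C : numFieldType) (V : vertex_superalgebra C) (M : weak_module V).
Implicit Types (a b : V) (u : M) (m n l : int).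

HB.instance Definition _ a n := GRing.isLinear.Build C M M *:%R (wm_Y (w := M) a n)
  (wm_linear_r (wm_axioms M) a n).

Definition wm_Yl n u a : M := wm_Y a n u.
HB.instance Definition _ n u := GRing.isLinear.Build C V M *:%R (wm_Yl n u)
  (wm_linear_l (wm_axioms M) n u).

Lemma wm_YlP c a b n u : wm_Y (c *: a + b) n u = c *: wm_Y a n u + wm_Y b n u.
Proof. exact: (wm_linear_l (wm_axioms M) n u). Qed.

Lemma wm_YlD a b n u : wm_Y (a + b) n u = wm_Y a n u + wm_Y b n u.
Proof. exact: (linearD (wm_Yl n u)). Qed.

Lemma wm_Yl0 n u : wm_Y (0 : V) n u = 0.
Proof. exact: (linear0 (wm_Yl n u)). Qed.

Lemma wm_YlZ c a n u : wm_Y (c *: a) n u = c *: wm_Y a n u.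
Proof. by rewrite -[c *: a]addr0 wm_YlP wm_Yl0 addr0. Qed.

Lemma wm_Yl_sum I (s : seq I) (F : I -> V) n u :
  wm_Y (\sum_(i <- s) F i) n u = \sum_(i <- s) wm_Y (F i) n u.
Proof. exact: (linear_sum (wm_Yl n u)). Qed.

End Modes.

Section AdjointModes.
Variables (C : numFieldType) (V : vertex_superalgebra C).
Implicit Types (a b : V) (n : int).

Definition adjoint : weak_module V := WeakModule (vsa_adjoint V).

HB.instance Definition _ a n := GRing.isLinear.Build C V V *:%R (vsa_Y a n)
  (wm_linear_r (vsa_adjoint V) a n).

Lemma vsa_YlP c a b n (u : V) : vsa_Y (c *: a + b) n u = c *: vsa_Y a n u + vsa_Y b n u.
Proof. exact: (@wm_YlP C V adjoint). Qed.

Lemma vsa_YlD a b n (u : V) : vsa_Y (a + b) n u = vsa_Y a n u + vsa_Y b n u.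
Proof. exact: (@wm_YlD C V adjoint). Qed.

Lemma vsa_YlZ c a n (u : V) : vsa_Y (c *: a) n u = c *: vsa_Y a n u.
Proof. exact: (@wm_YlZ C V adjoint). Qed.

Lemma vsa_Yl0 n (u : V) : vsa_Y (0 : V) n u = 0.
Proof. exact: (@wm_Yl0 C V adjoint). Qed.

Lemma vsa_Yl_sum I (s : seq I) (F : I -> V) n (u : V) :
  vsa_Y (\sum_(i <- s) F i) n u = \sum_(i <- s) vsa_Y (F i) n u.
Proof. exact: (@wm_Yl_sum C V adjoint). Qed.

Lemma parity_ind (P : set V) :
  subspace P -> (forall p a, vsa_par p a -> P a) -> forall a, P a.
Proof. exact: (homogeneous_ind (wm_superspace (vsa_adjoint V))). Qed.

End AdjointModes.

Section Identities.
Variables (C : numFieldType) (V : vertex_superalgebra C) (M : weak_module V).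
Implicit Types (a b : V) (u : M) (m n l : int).

Lemma jacobi_at p q a b u l m n (K : nat) : vsa_par p a -> vsa_par q b ->
  (forall i : nat, (K <= i)%N -> vsa_Y a (l + i%:Z) b = 0) ->
  (forall i : nat, (K <= i)%N -> wm_Y b (n + i%:Z) u = 0) ->
  (forall i : nat, (K <= i)%N -> wm_Y a (m + i%:Z) u = 0) ->
  \sum_(i < K) binz C m i *: wm_Y (vsa_Y a (l + i%:Z) b) (m + n - i%:Z) u =
  \sum_(i < K) ((-1) ^+ i * binz C l i) *:
    (wm_Y a (m + l - i%:Z) (wm_Y b (n + i%:Z) u)
     - ((-1) ^+ absz l * (-1) ^+ (p && q)) *:
         wm_Y b (n + l - i%:Z) (wm_Y a (m + i%:Z) u)).
Proof.
move=> pa qb ab bu au.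
have [K0 /(_ (maxn K K0) (leq_maxr _ _))] := wm_jacobi (wm_axioms M) u l m n pa qb.
pose F (i : nat) := binz C m i *: wm_Y (vsa_Y a (l + i%:Z) b) (m + n - i%:Z) u.
pose G (i : nat) := ((-1) ^+ i * binz C l i) *:
    (wm_Y a (m + l - i%:Z) (wm_Y b (n + i%:Z) u)
     - ((-1) ^+ absz l * (-1) ^+ (p && q)) *:
         wm_Y b (n + l - i%:Z) (wm_Y a (m + i%:Z) u)).
rewrite (@sum_ord_stable _ F K) ?leq_maxl //; last first.
  by move=> i Ki; rewrite /F ab // wm_Yl0 scaler0.
rewrite (@sum_ord_stable _ G K) ?leq_maxl // => i Ki.
by rewrite /G bu // au // !(linear0, subr0, scaler0).
Qed.

Lemma commutator p q a b u m n (K : nat) : vsa_par p a -> vsa_par q b ->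
  p && q = false -> (forall i : nat, (K <= i)%N -> binz C m i *: vsa_Y a i%:Z b = 0) ->
  wm_Y a m (wm_Y b n u) = wm_Y b n (wm_Y a m u) +
    \sum_(i < K) binz C m i *: wm_Y (vsa_Y a i%:Z b) (m + n - i%:Z) u.
Proof.
move=> pa qb pq ab.
have [K0 /(_ (maxn K.+1 K0) (leq_maxr _ _))] := wm_jacobi (wm_axioms M) u 0 m n pa qb.
pose F (i : nat) := binz C m i *: wm_Y (vsa_Y a (0 + i%:Z) b) (m + n - i%:Z) u.
pose G (i : nat) := ((-1) ^+ i * binz C 0 i) *:
    (wm_Y a (m + 0 - i%:Z) (wm_Y b (n + i%:Z) u)
     - ((-1) ^+ absz 0 * (-1) ^+ (p && q)) *:
         wm_Y b (n + 0 - i%:Z) (wm_Y a (m + i%:Z) u)).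
rewrite (@sum_ord_stable _ F K) //; last first.
- by move=> i Ki; rewrite /F -wm_YlZ add0r ab // wm_Yl0.
- by rewrite leq_max leqW.
rewrite (@sum_ord_stable _ G 1) //; last first.
- by move=> [//|i] _; rewrite /G (binz_nat _ 0) bin0n mulr0 scale0r.
- by rewrite leq_max.
rewrite big_ord1 /G binz0 !mulr1 scale1r pq mulr1 scale1r ?subr0 ?addr0.
move=> FE; rewrite (eq_bigr (fun i : 'I_K => F i)) => [|i _]; last by rewrite /F add0r.
by rewrite FE addrC subrK.
Qed.

Lemma commutator_even a b u (k : nat) n : vsa_par false a ->
  wm_Y a k%:Z (wm_Y b n u) = wm_Y b n (wm_Y a k%:Z u) +
    \sum_(i < k.+1) binz C k%:Z i *: wm_Y (vsa_Y a i%:Z b) (k%:Z + n - i%:Z) u.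
Proof.
move=> ea; move: b; apply: parity_ind => [|q b qb]; last first.
  apply: (@commutator false q) => // i ki.
  by rewrite binz_nat bin_small // scale0r.
split=> [|c b b' /= Hb Hb'].
  by rewrite /= !wm_Yl0 linear0 big1 ?addr0 // => i _; rewrite linear0 wm_Yl0 scaler0.
rewrite !wm_YlP linearP /= Hb Hb' scalerDr addrACA; congr (_ + _).
rewrite scaler_sumr -big_split; apply: eq_bigr => i _ /=.
by rewrite linearP wm_YlP scalerDr !scalerA mulrC.
Qed.

(** The vacuum is the identity field, so the mode of the derivative c_(-2) 1 is
    the derivative of the field of c. *)
Lemma translation c n u :
  wm_Y (vsa_Y c (-2) (vsa_one V)) n u = - n%:~R *: wm_Y c (n - 1) u.
Proof.
move: c; apply: parity_ind => [|p c pc].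
  split=> [|d a b /= Ha Hb]; first by rewrite /= vsa_Yl0 !wm_Yl0 scaler0.
  by rewrite vsa_YlP !wm_YlP Ha Hb scalerDr !scalerA mulrC.
have [N0 cN] := wm_truncated (wm_axioms M) c u.
have v1 := vsa_one_even V.
have vac k w : wm_Y (vsa_one V) k w = if k == -1 then w else 0 :> M.
  exact: (wm_vacuum (wm_axioms M)).
have [K KP] : exists K, K.+1 = (absz N0 + absz n + 2)%N.
  by exists (absz N0 + absz n + 1)%N; lia.
have := @jacobi_at p false c (vsa_one V) u (-2) 0 n K.+1 pc v1.
rewrite [X in X = _]big_ord_recl binz0 scale1r subr0 add0r addr0 big1 ?addr0; last first.
  by move=> i _; rewrite lift0 (binz_nat _ 0) bin0n scale0r.
move=> ->; first last.
- by move=> i Ki; apply: cN; lia.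
- by move=> i Ki; rewrite vac ifN //; lia.
- by move=> i Ki; case: (vsa_creation c) => _ -> //; lia.
rewrite andbF mulr1 sqrrN expr1n.
have coef (i : nat) : (-1) ^+ i * binz C (-2) i = i.+1%:R.
  by rewrite (binz_negS _ 1) mulrA -exprMn mulrNN mulr1 expr1n mul1r add1n binSn.
(* A term survives only when the mode of the vacuum in it is -1. *)
rewrite (eq_bigr (fun i : 'I_K.+1 => i.+1%:R *: ((if n + i%:Z == - 1%:Z then
    wm_Y c (-2 - i%:Z) u else 0) - (if n - 2 - i%:Z == - 1%:Z then
    wm_Y c i%:Z u else 0)))); last first.
  move=> i _; rewrite coef !vac scale1r !add0r; congr (_ *: (_ - _)).
  by case: ifP => _; rewrite ?linear0.
have [n0|n0|->] := ltrgt0P n.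
- have iK : (absz n - 1 < K.+1)%N by lia.
  rewrite (bigD1 (Ordinal iK)) //= big1 ?addr0 => [|i /eqP ni].
    rewrite ifN ?ifT ?sub0r ?scalerN ?scaleNr; [|lia|lia].
    have -> : (absz n - 1).+1 = absz n by lia.
    by congr (- (_ *: wm_Y c _ u)); [rewrite -[n in RHS]gtz0_abs | lia].
  rewrite !ifN ?subrr ?scaler0 //; [|lia].
  by apply/eqP => ni'; apply: ni; apply: val_inj => /=; lia.
- have iK : (absz n - 1 < K.+1)%N by lia.
  rewrite (bigD1 (Ordinal iK)) //= big1 ?addr0 => [|i /eqP ni].
    rewrite ifT ?ifN ?subr0 ?scaleNr; [|lia|lia].
    have -> : (absz n - 1).+1 = absz n by lia.
    rewrite -scaleNr; congr (_ *: wm_Y c _ u); last by lia.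
    by rewrite -mulrNz -ltz0_abs.
  rewrite !ifN ?subrr ?scaler0 //; first by lia.
  by apply/eqP => ni'; apply: ni; apply: val_inj => /=; lia.
- rewrite oppr0 scale0r big1 // => i _; rewrite !ifN ?subrr ?scaler0 //; lia.
Qed.

End Identities.

Section LeftIdeals.
Variables (C : numFieldType) (V : vertex_superalgebra C).

Lemma vsa_translation (c : V) n (u : V) :
  vsa_Y (vsa_Y c (-2) (vsa_one V)) n u = - n%:~R *: vsa_Y c (n - 1) u.
Proof. exact: (@translation C V (adjoint V)). Qed.

Lemma vsa_commutator_even (a b u : V) (k : nat) n : vsa_par false a ->
  vsa_Y a k%:Z (vsa_Y b n u) = vsa_Y b n (vsa_Y a k%:Z u) +
    \sum_(i < k.+1) binz C k%:Z i *: vsa_Y (vsa_Y a i%:Z b) (k%:Z + n - i%:Z) u.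
Proof. exact: (@commutator_even C V (adjoint V)). Qed.

Lemma vsa_commutator p q (a b u : V) m n (K : nat) : vsa_par p a -> vsa_par q b ->
  p && q = false -> (forall i : nat, (K <= i)%N -> binz C m i *: vsa_Y a i%:Z b = 0) ->
  vsa_Y a m (vsa_Y b n u) = vsa_Y b n (vsa_Y a m u) +
    \sum_(i < K) binz C m i *: vsa_Y (vsa_Y a i%:Z b) (m + n - i%:Z) u.
Proof. exact: (@commutator C V (adjoint V)). Qed.

(** On the vacuum only the first two terms of the Jacobi identity survive. *)
Lemma translation_mode p (a b : V) n : vsa_par p a ->
  vsa_Y (vsa_Y a n b) (-2) (vsa_one V) =
  vsa_Y a n (vsa_Y b (-2) (vsa_one V)) - n%:~R *: vsa_Y a (n - 1) b.
Proof.
move=> pa; move: b; apply: parity_ind => [|q b qb].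
  split=> [|c u v /= Hu Hv]; first by rewrite /= !(linear0, vsa_Yl0, subr0).
  by rewrite !(linearP, vsa_YlP) /= Hu Hv scalerBr !scalerN addrACA.
have cr c i : 0 <= i -> vsa_Y c i (vsa_one V) = 0.
  by case: (vsa_creation c) => _; apply.
have [N0 aN] := wm_truncated (vsa_adjoint V) a b.
have [K KP] : exists K, K.+2 = (absz N0 + absz n + 2)%N.
  by exists (absz N0 + absz n)%N; lia.
have := @jacobi_at _ _ (adjoint V) p q a b (vsa_one V) n 0 (-2) K.+2 pa qb.
rewrite /= [X in _ -> _ -> _ -> X = _]big_ord_recl [X in _ + X]big1 => [|i _]; last first.
  by rewrite lift0 (binz_nat _ 0) bin0n scale0r.
rewrite -[nat_of_ord ord0]/0%N binz0 scale1r !addr0 ?add0r ?subr0 => ->; first last.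
- by move=> i Ki; apply: cr; lia.
- by move=> i Ki; apply: cr; lia.
- by move=> i Ki; apply: aN; lia.
rewrite 2!big_ord_recl big1 => [|i _]; last first.
  by rewrite !lift0 !cr ?linear0 ?addr0 ?scaler0 //; lia.
rewrite lift0 -[nat_of_ord ord0]/0%N !(cr a) ?linear0 ?scaler0 ?addr0 ?subr0 //.
rewrite binz0 mulr1 scale1r -[nat_of_ord ord0]/0%N; congr (_ + _).
case: (vsa_creation b) => bE _; rewrite (_ : -2 + 1%:Z = -1) // bE.
rewrite expr1 mulN1r scaleNr; congr (- (_ *: _)).
by have := binzS C n 0; rewrite binz0 mul1r mulr1 subr0.
Qed.

(** By skew symmetry b_n a is a combination of the vectors c_(-1-i) 1 with
    c = a_(n+i) b, which are divided powers of T c = c_(-2) 1 applied to c. *)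
Lemma left_ideal_ideal (I : set V) :
  subspace I -> homogeneous_subset (@vsa_par C V) I ->
  (forall a n b, I b -> I (vsa_Y a n b)) ->
  (forall c, I c -> I (vsa_Y c (-2) (vsa_one V))) -> ideal I.
Proof.
move=> sI hI lI tI; split=> // a n b Ib; split; first exact: lI.
have T_I (i : nat) c : I c -> I (vsa_Y c (- 1 - i%:Z) (vsa_one V)).
  elim: i c => [|i IH] c Ic; first by rewrite subr0; case: (vsa_creation c) => ->.
  have := IH _ (tI c Ic); rewrite vsa_translation => Ii.
  have := subspaceZ (i.+1%:R)^-1 sI Ii.
  rewrite scalerA -mulrNz opprB opprK (_ : i%:Z + 1 = i.+1%:Z); last by lia.
  rewrite mulVf ?scale1r ?pnatr_eq0 //=.
  by rewrite (_ : - 1 - i%:Z - 1 = - 1 - i.+1%:Z); last by lia.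
move: a; apply: parity_ind => [|q a qa].
  split=> [|c a a' /= Ia Ia']; first by rewrite /= linear0; apply: subspace0.
  by rewrite linearP; apply: subspaceP.
have dpar := wm_superspace (vsa_adjoint V).
have Ip p : I (component dpar b p).
  case pb: (p \in csupport dpar b); last first.
    by rewrite csupport_out ?pb //; apply: subspace0.
  apply: (hI _ _ (csupport_uniq dpar b) (componentN dpar b)) => //.
  by rewrite -csupport_sum.
rewrite [b](csupport_sum dpar) vsa_Yl_sum; apply: subspace_sum => // p _.
have := componentN dpar b p; have := Ip p.
move: (component _ b p) => {Ip Ib}b Ib pb.
(* The Jacobi identity on the vacuum with m = -1 and n = 0. *)
have [N0 aN] := wm_truncated (vsa_adjoint V) a b.
have [K KP] : exists K, K.+1 = (absz N0 + absz n + 2)%N.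
  by exists (absz N0 + absz n + 1)%N; lia.
have := @jacobi_at _ _ (adjoint V) q p a b (vsa_one V) n (-1) 0 K.+1 qa pb.
have cr c i : 0 <= i -> vsa_Y c i (vsa_one V) = 0.
  by case: (vsa_creation c) => _; apply.
move=> E; rewrite /= in E.
have {}E : vsa_Y b n a = - ((-1) ^+ absz n * (-1) ^+ (q && p)) *:
  \sum_(i < K.+1) binz C (-1) i *: vsa_Y (vsa_Y a (n + i%:Z) b) (-1 + 0 - i%:Z) (vsa_one V).
  rewrite E; first last.
  - by move=> i Ki; apply: cr; lia.
  - by move=> i Ki; apply: cr; lia.
  - by move=> i Ki; apply: aN; lia.
  rewrite big_ord_recl big1 => [|i _]; last first.
    by rewrite lift0 !cr ?linear0 ?addr0 ?scaler0 //; lia.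
  rewrite -[nat_of_ord ord0]/0%N binz0 mulr1 scale1r !addr0 (cr b) // linear0 sub0r ?subr0 ?add0r.
  case: (vsa_creation a) => -> _; rewrite scalerN scaleNr opprK scalerA.
  by rewrite mulrACA -!expr2 !sqrr_sign mulr1 scale1r.
rewrite E; apply: subspaceZ => //; apply: subspace_sum_ord => // i.
by apply: subspaceZ => //; rewrite addr0; apply: T_I; apply: lI.
Qed.

End LeftIdeals.

(** * Li's operator *)

Section Triangles.
Variable M : nmodType.
Implicit Type F : nat -> nat -> M.

Lemma sum_triangle F (K : nat) :
  \sum_(i < K) \sum_(j < K - i) F i j = \sum_(r < K) \sum_(i < r.+1) F i (r - i)%N.
Proof.
pose F' i j := if (i + j < K)%N then F i j else 0.
have -> : \sum_(i < K) \sum_(j < K - i) F i j = \sum_(i < K) \sum_(j < K) F' i j.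
  apply: eq_bigr => i _; rewrite (@sum_ord_stable _ (F' i) (K - i)) ?leq_subr //.
    by apply: eq_bigr => j _; rewrite /F' -ltn_subRL ltn_ord.
  by move=> j ij; rewrite /F' ltnNge -leq_subLR ij.
rewrite sum_antidiagonal => [|i j ij]; last by rewrite /F' ltnNge ij.
apply: eq_bigr => r _; apply: eq_bigr => i _.
by rewrite /F' subnKC ?ltn_ord // -ltnS.
Qed.

Lemma sum_triangleC F (K : nat) :
  \sum_(i < K) \sum_(j < K - i) F i j = \sum_(j < K) \sum_(i < K - j) F i j.
Proof.
rewrite sum_triangle (sum_triangle (fun j i => F i j)).
apply: eq_bigr => r _; rewrite [RHS](reindex_inj rev_ord_inj) /=.
apply: eq_bigr => i _; rewrite subSS; congr F.
by rewrite subKn // -ltnS.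
Qed.

End Triangles.

Lemma eventually_ord (P : nat -> nat -> Prop) (n : nat) :
  (forall j, (j < n)%N -> exists K0, forall K, (K0 <= K)%N -> P j K) ->
  exists K0, forall K, (K0 <= K)%N -> forall j, (j < n)%N -> P j K.
Proof.
elim: n => [_|n IH H]; first by exists 0%N.
have [K1 P1] := IH (fun j jn => H j (ltnW jn)).
have [K2 P2] := H n (ltnSn n).
exists (maxn K1 K2) => K; rewrite geq_max => /andP[K1K K2K] j.
by rewrite ltnS leq_eqVlt => /orP[/eqP->|]; [exact: P2 | exact: P1].
Qed.

Section Li.
Variables (C : numFieldType) (V : vertex_superalgebra C) (h : V).
Implicit Types (a b : V) (p : int) (r k : nat).

(** The entry k is [li (r - k) v]: the recursion uses all previous values. *)
Fixpoint li_list r v : seq V :=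
  if r is r'.+1 then
    let s := li_list r' v in
    (r%:R^-1 *: \sum_(k < r) (-1) ^+ k *: vsa_Y h k.+1%:Z (nth 0 s k)) :: s
  else [:: v].

(** The coefficient of z^-r in exp (- \sum_(k > 0) h(k) (-z)^-k / k), computed
    from the logarithmic derivative of this exponential. *)
Definition li r v : V := head 0 (li_list r v).

Lemma nth_li_list r k v : (k <= r)%N -> nth 0 (li_list r v) k = li (r - k) v.
Proof.
elim: r k => [|r IH] [|k] //; rewrite ?subn0 //= ltnS subSS; exact: IH.
Qed.

Lemma li0 v : li 0 v = v.
Proof. by []. Qed.

Lemma liS r v : r.+1%:R *: li r.+1 v =
  \sum_(k < r.+1) (-1) ^+ k *: vsa_Y h k.+1%:Z (li (r - k) v).
Proof.
rewrite /li /= scalerA mulfV ?pnatr_eq0 // scale1r.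
by apply: eq_bigr => k _; rewrite nth_li_list // -ltnS.
Qed.

Lemma li_unique (f : nat -> V) :
  (forall r, r.+1%:R *: f r.+1 =
    \sum_(k < r.+1) (-1) ^+ k *: vsa_Y h k.+1%:Z (f (r - k)%N)) ->
  forall r, f r = li r (f 0%N).
Proof.
move=> fS; elim/ltn_ind => -[//|r] IH.
apply: (scalerI (a := r.+1%:R)); first by rewrite pnatr_eq0.
rewrite fS liS; apply: eq_bigr => k _; rewrite IH // ltnS; exact: leq_subr.
Qed.

Lemma li_linear r : linear (li r).
Proof.
move=> c u v.
rewrite (@li_unique (fun r => c *: li r u + li r v)) // => {}r.
rewrite scalerDr scalerA mulrC -scalerA !liS scaler_sumr -big_split /=.
by apply: eq_bigr => k _; rewrite linearP scalerDr !scalerA mulrC.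
Qed.
HB.instance Definition _ r := GRing.isLinear.Build C V V *:%R (li r) (li_linear r).

(** The index [d] counts how far the degree has been lowered. *)
Lemma li_stable (N : nat -> set V) :
  (forall d, subspace (N d)) ->
  (forall d k v, N d v -> N (d + k.+1)%N (vsa_Y h k.+1%:Z v)) ->
  forall r d v, N d v -> N (d + r)%N (li r v).
Proof.
move=> sN hN; elim/ltn_ind => -[_ d v|r IH d v Nv]; first by rewrite addn0.
have r0 : (r.+1%:R : C) != 0 by rewrite pnatr_eq0.
rewrite -[li _ _]scale1r -(mulVf r0) -scalerA liS.
apply: subspaceZ => //; apply: subspace_sum_ord => // k; apply: subspaceZ => //.
rewrite (_ : d + r.+1 = (d + (r - k)) + k.+1)%N; last first.
  by have := ltn_ord k; lia.
by apply/hN/IH => //; rewrite ltnS leq_subr.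
Qed.

Lemma li_stable_const (N : set V) : subspace N ->
  (forall k v, N v -> N (vsa_Y h k.+1%:Z v)) -> forall r v, N v -> N (li r v).
Proof. by move=> sN hN r v; apply: (@li_stable (fun=> N)) => // d k w; apply: hN. Qed.

Hypothesis h_even : vsa_par false h.

Lemma li_parity (q : bool) r v : vsa_par q v -> vsa_par q (li r v).
Proof.
apply: li_stable_const => [|k w pw].
  by case: (wm_superspace (vsa_adjoint V)).
by have := wm_parity (vsa_adjoint V) k.+1%:Z h_even pw; rewrite addFb.
Qed.

Hypothesis h0_comm : forall (k : nat) v,
  vsa_Y h 0 (vsa_Y h k.+1%:Z v) = vsa_Y h k.+1%:Z (vsa_Y h 0 v).

Lemma li_h0 (al : C) r v : vsa_Y h 0 v = al *: v -> vsa_Y h 0 (li r v) = al *: li r v.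
Proof.
apply: (li_stable_const (N := [set v | vsa_Y h 0 v = al *: v])) => [|k w /= wE].
  split=> [|c u w /= uE wE]; first by rewrite /= linear0 scaler0.
  by rewrite linearP /= uE wE scalerDr !scalerA mulrC.
by rewrite h0_comm wE linearZ.
Qed.

Section Conjugation.
Variables (a : V) (al : int).
Hypothesis h0a : vsa_Y h 0 a = al%:~R *: a.

(** The coefficients of the conjugate of the field of [a] by Li's operator. *)
Definition li_conj p r b : V :=
  \sum_(j < r.+1) bz C (al - j%:Z) (r%:Z - j%:Z) *:
    vsa_Y (li j a) (p + r%:Z - j%:Z) b.

Lemma li_conj0 p b : li_conj p 0 b = vsa_Y a p b.
Proof. by rewrite /li_conj big_ord1 /= binz0 scale1r addr0 subr0. Qed.

Lemma li_conj_coef (j r : nat) : (j <= r)%N ->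
  r%:R * bz C (al - j%:Z) (r%:Z - j%:Z) =
  al%:~R * bz C (al - j%:Z - 1) (r%:Z - j%:Z - 1) +
  j%:R * bz C (al - j%:Z - 1) (r%:Z - j%:Z).
Proof.
move=> jr; have D := bz_diag C (al - j%:Z) (r%:Z - j%:Z).
have := bz_pascal C (al - j%:Z - 1) (r%:Z - j%:Z); rewrite subrK => P.
have rE : (r%:R : C) = (r%:Z - j%:Z)%:~R + j%:R by rewrite intrB subrK.
rewrite rE mulrDl D P intrB -!pmulrn; ring.
Qed.

(** With z^-1 = w, this says that the conjugate field G satisfies
    w dG / dw = [H, G], where H is the logarithmic derivative of Li's operator. *)
Lemma li_conjS p r b : r.+1%:R *: li_conj p r.+1 b =
  \sum_(k < r.+1) (-1) ^+ k *: (vsa_Y h k.+1%:Z (li_conj p (r - k) b)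
                                - li_conj p (r - k) (vsa_Y h k.+1%:Z b)).
Proof.
set R := r.+1.
pose c (j : nat) := (al - j%:Z).
pose X (i j : nat) := vsa_Y (vsa_Y h i%:Z (li j a)) (p + R%:Z - j%:Z - i%:Z) b.
have step (k : nat) : (k < R)%N ->
    vsa_Y h k.+1%:Z (li_conj p (r - k) b) - li_conj p (r - k) (vsa_Y h k.+1%:Z b) =
    \sum_(j < R.+1) \sum_(i < R.+1)
      (bz C (c j) (R%:Z - k.+1%:Z - j%:Z) * binz C k.+1%:Z i) *: X i j.
  move=> kR.
  pose F (b : V) (j : nat) : V := bz C (c j) (R%:Z - k.+1%:Z - j%:Z) *:
    vsa_Y (li j a) (p + R%:Z - k.+1%:Z - j%:Z) b.
  have GE b' : li_conj p (r - k) b' = \sum_(j < R.+1) F b' j.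
    rewrite (@sum_ord_stable _ (F b') (r - k).+1).
    - apply: eq_bigr => j _; rewrite /F.
      by congr (bz _ _ _ *: vsa_Y _ _ _); rewrite /R; lia.
    - by rewrite /R; lia.
    - by move=> j rj; rewrite /F bz_neg ?scale0r // /R; lia.
  rewrite !GE linear_sum -sumrB; apply: eq_bigr => j _.
  rewrite /F linearZ /= -scalerBr vsa_commutator_even // [X in _ *: X = _]addrC addKr.
  pose B (i : nat) := binz C k.+1%:Z i *: X i j.
  rewrite scaler_sumr.
  rewrite (eq_bigr (fun i : 'I_R.+1 => bz C (c j) (R%:Z - k.+1%:Z - j%:Z) *: B i)); last first.
    by move=> i _; rewrite scalerA.
  rewrite -!scaler_sumr; congr (_ *: _).
  rewrite (@sum_ord_stable _ B k.+2) //; last first.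
    by move=> i ki; rewrite /B binz_nat bin_small // scale0r.
  apply: eq_bigr => i _; rewrite /B /X; congr (_ *: vsa_Y _ _ _); lia.
rewrite (eq_bigr (fun k : 'I_R => \sum_(j < R.+1) \sum_(i < R.+1)
  ((-1) ^+ k * (bz C (c j) (R%:Z - k.+1%:Z - j%:Z) * binz C k.+1%:Z i)) *: X i j)); last first.
  move=> k _; rewrite step // scaler_sumr; apply: eq_bigr => j _.
  by rewrite scaler_sumr; apply: eq_bigr => i _; rewrite scalerA.
rewrite exchange_big /=.
have coef (i j : nat) :
    \sum_(k < R) (-1) ^+ k * (bz C (c j) (R%:Z - k.+1%:Z - j%:Z) * binz C k.+1%:Z i) =
    if i is i'.+1 then (-1) ^+ i' * bz C (c j - i%:Z - 1) (R%:Z - j%:Z - i%:Z)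
    else bz C (c j - 1) (R%:Z - j%:Z - 1).
  (* The term k = 0 of the alternating sum over k is missing here. *)
  have := @alternating_vandermonde C i (c j) (R%:Z - j%:Z) R.+1.
  rewrite big_ord_recl /= expr0 mul1r subr0 => /(_ ltac:(lia)) AV.
  have -> : \sum_(k < R) (-1) ^+ k * (bz C (c j) (R%:Z - k.+1%:Z - j%:Z) * binz C k.+1%:Z i)
     = binz C 0 i * bz C (c j) (R%:Z - j%:Z)
       - (-1) ^+ i * bz C (c j - i.+1%:Z) (R%:Z - j%:Z - i%:Z).
    rewrite -AV opprD addrA subrr add0r -sumrN; apply: eq_bigr => k _.
    rewrite /bump /= add1n exprS mulN1r !mulNr opprK -mulrA [bz _ _ _ * _]mulrC.
    by congr (_ * (_ * bz _ _ _)); lia.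
  rewrite (binz_nat _ 0) bin0n; case: i {AV} => [|i] /=.
    have := bz_pascal C (c j - 1) (R%:Z - j%:Z); rewrite subrK => ->.
    by rewrite !mul1r subr0 addrAC subrr add0r.
  rewrite mul0r add0r exprS mulN1r mulNr opprK; congr (_ * bz _ _ _); lia.
rewrite (eq_bigr (fun j : 'I_R.+1 => bz C (c j - 1) (R%:Z - j%:Z - 1) *: X 0%N j +
  \sum_(i < R) ((-1) ^+ i * bz C (c j - i.+1%:Z - 1) (R%:Z - j%:Z - i.+1%:Z)) *: X i.+1 j));
  last first.
  move=> j _; rewrite exchange_big /= big_ord_recl; congr (_ + _).
    by rewrite -scaler_suml coef.
  by apply: eq_bigr => i _; rewrite -scaler_suml coef lift0.
rewrite big_split /=.
pose Y (j : nat) := vsa_Y (li j a) (p + R%:Z - j%:Z) b.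
rewrite (eq_bigr (fun j : 'I_R.+1 => (al%:~R * bz C (c j - 1) (R%:Z - j%:Z - 1)) *: Y j));
  last first.
  move=> j _; rewrite /X (li_h0 _ h0a) vsa_YlZ scalerA mulrC subr0 //.
pose F (i j : nat) := ((-1) ^+ i * bz C (c j - i.+1%:Z - 1) (R%:Z - j%:Z - i.+1%:Z)) *: X i.+1 j.
have -> : \sum_(j < R.+1) \sum_(i < R) F i j = \sum_(i < R) \sum_(j < R) F i j.
  rewrite exchange_big; apply: eq_bigr => i _; apply: (@sum_ord_stable _ (F i)) => //.
  by move=> j Rj; rewrite /F bz_neg ?mulr0 ?scale0r //; lia.
rewrite sum_antidiagonal; last first.
  by move=> i j Rij; rewrite /F bz_neg ?mulr0 ?scale0r //; lia.
rewrite (eq_bigr (fun J : 'I_R => (J.+1%:R * bz C (c J.+1 - 1) (R%:Z - J.+1%:Z)) *: Y J.+1));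
  last first.
  move=> J _; rewrite mulrC -scalerA /Y -vsa_YlZ liS vsa_Yl_sum scaler_sumr.
  apply: eq_bigr => i _; rewrite vsa_YlZ scalerA mulrC /F /X.
  have iJ : (i <= J)%N by rewrite -ltnS.
  by congr (_ * bz _ _ _ *: vsa_Y _ _ _); rewrite /c; lia.
rewrite -[\sum_(J < R) _]add0r.
have -> : 0 + \sum_(J < R) (J.+1%:R * bz C (c J.+1 - 1) (R%:Z - J.+1%:Z)) *: Y J.+1 =
  \sum_(J < R.+1) (J%:R * bz C (c J - 1) (R%:Z - J%:Z)) *: Y J.
  by rewrite [RHS]big_ord_recl mul0r scale0r; congr (_ + _); apply: eq_bigr => J _;
    rewrite lift0.
rewrite -big_split /= /li_conj scaler_sumr; apply: eq_bigr => j _.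
by rewrite -scalerDl -li_conj_coef ?scalerA // -ltnS.
Qed.

Lemma li_conj_linear p r : linear (li_conj p r).
Proof.
move=> x u v; rewrite /li_conj scaler_sumr -big_split; apply: eq_bigr => j _ /=.
by rewrite linearP scalerDr !scalerA mulrC.
Qed.
HB.instance Definition _ p r :=
  GRing.isLinear.Build C V V *:%R (li_conj p r) (li_conj_linear p r).

(** Both sides satisfy the first order equation which defines Li's operator, and
    they agree for r = 0. *)
Lemma li_mode p r b :
  li r (vsa_Y a p b) = \sum_(i < r.+1) li_conj p i (li (r - i) b).
Proof.
pose f r := \sum_(i < r.+1) li_conj p i (li (r - i) b).
have f0 : f 0%N = vsa_Y a p b by rewrite /f big_ord1 li_conj0.
rewrite -f0 -li_unique // => {}r.
pose P (k i : nat) := (-1) ^+ k *: (vsa_Y h k.+1%:Z (li_conj p i (li (r - k - i) b))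
  - li_conj p i (vsa_Y h k.+1%:Z (li (r - k - i) b))).
pose Q (k i : nat) := (-1) ^+ k *: li_conj p i (vsa_Y h k.+1%:Z (li (r - k - i) b)).
transitivity (\sum_(k < r.+1) \sum_(i < r.+1 - k) (P k i + Q k i)); last first.
  apply: eq_bigr => k _; rewrite /f linear_sum scaler_sumr subSn; last by rewrite -ltnS.
  by apply: eq_bigr => i _; rewrite /P /Q -scalerDr subrK.
rewrite (eq_bigr (fun k : 'I_r.+1 => \sum_(i < r.+1 - k) P k i + \sum_(i < r.+1 - k) Q k i));
  last by move=> k _; rewrite big_split.
rewrite big_split /= [X in _ = X + _]sum_triangle [X in _ = _ + X]sum_triangleC.
rewrite /f scaler_sumr (eq_bigr (fun i : 'I_r.+2 =>
    (i%:R *: li_conj p i (li (r.+1 - i) b)) +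
    li_conj p i ((r.+1 - i)%N%:R *: li (r.+1 - i) b))); last first.
  move=> i _; rewrite linearZ /= -scalerDl -natrD subnKC // -ltnS //.
rewrite big_split /= big_ord_recl scale0r add0r; congr (_ + _).
  apply: eq_bigr => i _; rewrite lift0 li_conjS subSS; apply: eq_bigr => k _.
  rewrite /P (_ : r - k - (i - k) = r - i)%N //.
  have := ltn_ord k; have := ltn_ord i; lia.
rewrite big_ord_recr /= subnn scale0r linear0 addr0; apply: eq_bigr => i _.
have ir : (i <= r)%N by rewrite -ltnS.
rewrite subSn // liS linear_sum; apply: eq_bigr => k _.
rewrite /Q linearZ /= (_ : r - k - i = r - i - k)%N //; lia.
Qed.

End Conjugation.
End Li.

(** * The Jacobi identity for twisted modes *)

Section TwistedJacobi.
Variables (C : numFieldType) (V : vertex_superalgebra C) (h : V) (M : weak_module V).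
Implicit Types (a b : V) (u : M) (m n l al be : int) (J : nat).

(** The modes of Y (Delta(h, z) a, z) for [a] of [h]-charge [al]; the sum over j is
    finite, and any [J] beyond its last nonzero term gives the same value. *)
Definition twisted_mode al J a n u : M :=
  \sum_(j < J) wm_Y (li h j a) (n + al - j%:Z) u.

Lemma twisted_mode_stable al J J' a n u : (J <= J')%N ->
  (forall j, (J <= j)%N -> li h j a = 0) ->
  twisted_mode al J' a n u = twisted_mode al J a n u.
Proof.
move=> JJ' a0.
apply: (@sum_ord_stable _ (fun j : nat => wm_Y (li h j a) (n + al - j%:Z) u)) => // j Jj.
by rewrite a0 // wm_Yl0.
Qed.

Hypothesis h_even : vsa_par false h.
Hypothesis h0_comm : forall (k : nat) v,
  vsa_Y h 0 (vsa_Y h k.+1%:Z v) = vsa_Y h k.+1%:Z (vsa_Y h 0 v).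

Variables (p q : bool) (a b : V) (al be l : int) (J J' : nat).
Hypotheses (pa : vsa_par p a) (qb : vsa_par q b).
Hypothesis h0a : vsa_Y h 0 a = al%:~R *: a.
Hypotheses (a0 : forall j, (J <= j)%N -> li h j a = 0)
  (b0 : forall j, (J <= j)%N -> li h j b = 0)
  (ab0 : forall i j : nat, (J' <= j)%N -> li h j (vsa_Y a (l + i%:Z) b) = 0).

Lemma products_bounded : exists T : nat, forall (j k t : nat), (T <= t)%N ->
  vsa_Y (li h j a) (l + t%:Z) (li h k b) = 0.
Proof.
have trunc j k : exists T : nat, forall t : nat, (T <= t)%N ->
    vsa_Y (li h j a) (l + t%:Z) (li h k b) = 0.
  have [N0 cN] := wm_truncated (vsa_adjoint V) (li h j a) (li h k b).
  by exists (absz N0 + absz l)%N => t Tt; apply: cN; lia.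
have [T TP] := @eventually_ord (fun j t => forall k, (k < J)%N ->
  vsa_Y (li h j a) (l + t%:Z) (li h k b) = 0) J
  (fun j _ => @eventually_ord (fun k t => vsa_Y (li h j a) (l + t%:Z) (li h k b) = 0)
     J (fun k _ => trunc j k)).
exists T => j k t Tt; have [Jj|jJ] := leqP J j; first by rewrite a0 // vsa_Yl0.
by have [Jk|kJ] := leqP J k; [rewrite b0 // linear0 | apply: TP].
Qed.

Lemma twisted_jacobi m n u : exists K0 : nat, forall K : nat, (K0 <= K)%N ->
  \sum_(i < K) binz C m i *:
     twisted_mode (al + be) J' (vsa_Y a (l + i%:Z) b) (m + n - i%:Z) u =
  \sum_(i < K) ((-1) ^+ i * binz C l i) *:
    (twisted_mode al J a (m + l - i%:Z) (twisted_mode be J b (n + i%:Z) u)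
     - ((-1) ^+ absz l * (-1) ^+ (p && q)) *:
       twisted_mode be J b (n + l - i%:Z) (twisted_mode al J a (m + i%:Z) u)).
Proof.
have [T TP] := products_bounded.
(* Each of the three summation indices is below L in a nonzero term, so their sum is
   below Q. *)
pose L := maxn J (maxn J' T); pose Q := (3 * L)%N.
have JL : (J <= L)%N by rewrite leq_maxl.
have JL' : (J' <= L)%N by rewrite !leq_max leqnn orbT.
have TL : (T <= L)%N by rewrite !leq_max leqnn !orbT.
have LQ : (L <= Q)%N by rewrite /Q; lia.
pose m' (j : nat) := m + al - j%:Z; pose n' (k : nat) := n + be - k%:Z.
have [K0 KP] := @eventually_ord (fun j K => forall k, (k < Q)%N ->
  \sum_(i < K) binz C (m' j) i *:
     wm_Y (vsa_Y (li h j a) (l + i%:Z) (li h k b)) (m' j + n' k - i%:Z) u =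
  \sum_(i < K) ((-1) ^+ i * binz C l i) *:
    (wm_Y (li h j a) (m' j + l - i%:Z) (wm_Y (li h k b) (n' k + i%:Z) u)
     - ((-1) ^+ absz l * (-1) ^+ (p && q)) *:
       wm_Y (li h k b) (n' k + l - i%:Z) (wm_Y (li h j a) (m' j + i%:Z) u))) Q
  (fun j _ => @eventually_ord (fun k K =>
    \sum_(i < K) binz C (m' j) i *:
       wm_Y (vsa_Y (li h j a) (l + i%:Z) (li h k b)) (m' j + n' k - i%:Z) u =
    \sum_(i < K) ((-1) ^+ i * binz C l i) *:
      (wm_Y (li h j a) (m' j + l - i%:Z) (wm_Y (li h k b) (n' k + i%:Z) u)
       - ((-1) ^+ absz l * (-1) ^+ (p && q)) *:
         wm_Y (li h k b) (n' k + l - i%:Z) (wm_Y (li h j a) (m' j + i%:Z) u))) Q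
    (fun k _ => wm_jacobi (wm_axioms M) u l (m' j) (n' k)
       (li_parity h_even j pa) (li_parity h_even k qb))).
exists (maxn K0 Q) => K; rewrite geq_max => /andP[K0K QK].
pose Z (j k t : nat) :=
  wm_Y (vsa_Y (li h j a) (l + t%:Z) (li h k b)) (m' j + n' k - t%:Z) u.
have Zj j k t : (L <= j)%N -> Z j k t = 0.
  by move=> Lj; rewrite /Z a0 ?vsa_Yl0 ?wm_Yl0 //; exact: leq_trans Lj.
have Zk j k t : (L <= k)%N -> Z j k t = 0.
  by move=> Lk; rewrite /Z b0 ?linear0 ?wm_Yl0 //; exact: leq_trans Lk.
have Zt j k t : (L <= t)%N -> Z j k t = 0.
  by move=> Lt; rewrite /Z TP ?wm_Yl0 //; exact: leq_trans Lt.
transitivity (\sum_(k < Q) \sum_(j < Q) \sum_(t < Q) binz C (m' j) t *: Z j k t).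
  have expand (i : nat) :
      twisted_mode (al + be) J' (vsa_Y a (l + i%:Z) b) (m + n - i%:Z) u =
      \sum_(k < Q) \sum_(j < Q) \sum_(t < Q) binz C (al - j%:Z) t *: Z j k (i + t)%N.
    rewrite -(@twisted_mode_stable _ _ Q); first last.
    - by move=> j; apply: ab0.
    - exact: leq_trans LQ.
    pose F (s k : nat) := wm_Y (li_conj h a al (l + i%:Z) s (li h k b))
      (m + n - i%:Z + (al + be) - (s + k)%:Z) u.
    have FZ s k : F s k =
        \sum_(j < s.+1) binz C (al - j%:Z) (s - j) *: Z j k (i + (s - j))%N.
      rewrite /F /li_conj wm_Yl_sum; apply: eq_bigr => j _; rewrite wm_YlZ.
      have js : (j <= s)%N by rewrite -ltnS.
      rewrite subzn //=; congr (_ *: _); rewrite /Z.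
      by congr (wm_Y (vsa_Y _ _ _) _ _); rewrite /m' /n'; lia.
    transitivity (\sum_(r < Q) \sum_(s < r.+1) F s (r - s)%N).
      apply: eq_bigr => r _; rewrite (li_mode h_even h0_comm h0a) wm_Yl_sum.
      by apply: eq_bigr => s _; rewrite /F subnKC // -ltnS.
    rewrite -sum_antidiagonal => [|s k Qsk].
      rewrite exchange_big; apply: eq_bigr => k _.
      rewrite (eq_bigr _ (fun (s : 'I_Q) _ => FZ s k)).
      rewrite -(@sum_antidiagonal _ (fun j t : nat => binz C (al - j%:Z) t *: Z j k (i + t)%N))
        // => j t Qjt.
      have [Lj|jL] := leqP L j; first by rewrite Zj ?scaler0.
      by rewrite Zt ?scaler0 //; rewrite /Q in Qjt; lia.
    rewrite FZ big1 // => j _.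
    have [Lk|kL] := leqP L k; first by rewrite Zk ?scaler0.
    have [Lj|jL] := leqP L j; first by rewrite Zj ?scaler0.
    by rewrite Zt ?scaler0 //; rewrite /Q in Qsk; lia.
  rewrite (eq_bigr _ (fun (i : 'I_K) _ => congr1 ( *:%R (binz C m i)) (expand i))).
  rewrite (eq_bigr (fun i : 'I_K => \sum_(k < Q) \sum_(j < Q) \sum_(t < Q)
    (binz C m i * binz C (al - j%:Z) t) *: Z j k (i + t)%N)); last first.
    move=> i _; rewrite scaler_sumr; apply: eq_bigr => k _.
    rewrite scaler_sumr; apply: eq_bigr => j _; rewrite scaler_sumr.
    by apply: eq_bigr => t _; rewrite scalerA.
  rewrite exchange_big; apply: eq_bigr => k _.
  rewrite exchange_big; apply: eq_bigr => j _ /=.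
  pose F (i t : nat) := (binz C m i * binz C (al - j%:Z) t) *: Z j k (i + t)%N.
  rewrite (@sum_ord_stable _ (fun i => \sum_(t < Q) F i t) Q) //; last first.
    by move=> i Qi; rewrite big1 // => t _; rewrite /F Zt ?scaler0 //; lia.
  rewrite sum_antidiagonal => [|i t Qit]; last by rewrite /F Zt ?scaler0 //; lia.
  apply: eq_bigr => t _.
  have := @vandermonde C m (al - j%:Z) t%:Z t.+1 (ltac:(lia)).
  rewrite /= (_ : m + (al - j%:Z) = m' j); last by rewrite /m' addrA.
  move=> <-; rewrite scaler_suml; apply: eq_bigr => i _.
  have it : (i <= t)%N by rewrite -ltnS.
  by rewrite /F subnKC // subzn.
rewrite (eq_bigr (fun i : 'I_K => \sum_(k < Q) \sum_(j < Q) ((-1) ^+ i * binz C l i) *: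
    (wm_Y (li h j a) (m' j + l - i%:Z) (wm_Y (li h k b) (n' k + i%:Z) u)
     - ((-1) ^+ absz l * (-1) ^+ (p && q)) *:
       wm_Y (li h k b) (n' k + l - i%:Z) (wm_Y (li h j a) (m' j + i%:Z) u)))).
  rewrite [RHS]exchange_big; apply: eq_bigr => k _ /=.
  rewrite [RHS]exchange_big; apply: eq_bigr => j _ /=.
  rewrite -KP //.
  apply/esym/(@sum_ord_stable _ (fun t => binz C (m' j) t *: Z j k t)) => // t Qt.
  by rewrite Zt ?scaler0 //; lia.
move=> i _; rewrite -!(@twisted_mode_stable _ J Q) ?(leq_trans JL) //.
rewrite /twisted_mode.
under eq_bigr do rewrite linear_sum.
under [in X in _ - X]eq_bigr do rewrite linear_sum.
rewrite exchange_big scaler_sumr -sumrB scaler_sumr; apply: eq_bigr => k _ /=.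
rewrite scaler_sumr -sumrB scaler_sumr; apply: eq_bigr => j _.
by congr (_ *: (wm_Y _ _ (wm_Y _ _ _) - _ *: wm_Y _ _ (wm_Y _ _ _))); rewrite /m' /n'; lia.
Qed.

End TwistedJacobi.

(** * Structure constants of sl(2|1) *)

(** The basis h1, h2, e12, f12, e1, e2, f1, f2 is numbered from 0 to 7; all tables
   below are computed from the integer matrices. *)
Definition basis_entry (g i j : nat) : int :=
  let unit k l : int := ((i == k) && (j == l))%:Z in
  match g with
  | 0%N => unit 0%N 0%N + unit 2%N 2%N
  | 1%N => - unit 1%N 1%N - unit 2%N 2%N
  | 2%N => unit 0%N 1%N
  | 3%N => unit 1%N 0%N
  | 4%N => unit 0%N 2%N
  | 5%N => unit 2%N 1%N
  | 6%N => unit 2%N 0%N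
  | _ => - unit 1%N 2%N
  end.

Definition basis_odd (g : nat) : bool := (3 < g)%N.

Definition coordinate (T : zmodType) (k : nat) (x : nat -> nat -> T) : T :=
  match k with
  | 0%N => x 0%N 0%N
  | 1%N => - x 1%N 1%N
  | 2%N => x 0%N 1%N
  | 3%N => x 1%N 0%N
  | 4%N => x 0%N 2%N
  | 5%N => x 2%N 1%N
  | 6%N => x 2%N 0%N
  | _ => - x 1%N 2%N
  end.

Definition product_entry (x y : nat -> nat -> int) (i j : nat) : int :=
  x i 0%N * y 0%N j + x i 1%N * y 1%N j + x i 2%N * y 2%N j.

Definition bracket_entry (g g' i j : nat) : int :=
  product_entry (basis_entry g) (basis_entry g') i j
  - (-1) ^+ (basis_odd g && basis_odd g') *
    product_entry (basis_entry g') (basis_entry g) i j.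

Definition bracket_coef (g g' k : nat) : int := coordinate k (bracket_entry g g').

Definition form_coef (g g' : nat) : int :=
  let x := product_entry (basis_entry g) (basis_entry g') in
  x 0%N 0%N + x 1%N 1%N - x 2%N 2%N.

Definition sum8 (F : nat -> int) : int := foldr (fun k s => F k + s) 0 (iota 0 8).

Lemma sum8E (F : nat -> int) : \sum_(k < 8) F k = sum8 F.
Proof. by rewrite -(big_mkord xpredT) unlock. Qed.

Definition all8 (P : nat -> bool) : bool := all P (iota 0 8).

Lemma all8P P g : all8 P -> (g < 8)%N -> P g.
Proof. by move=> /allP H g8; apply: H; rewrite mem_iota. Qed.

Lemma bracket_coefP g g' (i j : nat) : (g < 8)%N -> (g' < 8)%N -> (i < 3)%N -> (j < 3)%N ->
  bracket_entry g g' i j = \sum_(k < 8) bracket_coef g g' k * basis_entry k i j.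
Proof.
rewrite (sum8E (fun k => bracket_coef g g' k * basis_entry k i j)) => g8 g'8 i3 j3.
have : all8 (fun g => all8 (fun g' => all (fun i => all (fun j =>
  bracket_entry g g' i j == sum8 (fun k => bracket_coef g g' k * basis_entry k i j))
  (iota 0 3)) (iota 0 3))) by vm_compute.
move=> /all8P-/(_ g g8)/all8P-/(_ g' g'8)/allP-/(_ i)+.
by rewrite mem_iota => /(_ i3)/allP-/(_ j)+; rewrite mem_iota => /(_ j3)/eqP.
Qed.

Section Basis.
Variable C : fieldType.

Definition basis (g : nat) : sl21 C :=
  nth 0 [:: h1 C; h2 C; e12 C; f12 C; e1 C; e2 C; f1 C; f2 C] g.

Lemma sl21P (x y : sl21 C) : (forall i j, (x : 'M_3) i j = (y : 'M_3) i j) -> x = y.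
Proof. by move=> xy; apply/val_inj/matrixP. Qed.

Lemma basisE g (i j : 'I_3) : (g < 8)%N ->
  (basis g : 'M_3) i j = (basis_entry g i j)%:~R.
Proof.
case: i => [[|[|[|i]]] hi] //; case: j => [[|[|[|j]]] hj] //;
case: g => [|[|[|[|[|[|[|[|g]]]]]]]] //= _; rewrite !mxE /=;
by rewrite ?(subr0, sub0r, addr0, add0r, subrr, oppr0).
Qed.

Lemma basis_hom g : (g < 8)%N -> sl_hom (basis_odd g) (basis g).
Proof.
move=> g8; apply/matrixP => i j; rewrite mxE; case: ifP => // pij.
rewrite basisE //; move: pij.
by case: i => [[|[|[|i]]] hi] //; case: j => [[|[|[|j]]] hj] //;
case: g g8 => [|[|[|[|[|[|[|[|g]]]]]]]].
Qed.

Lemma sbr_hom p q (x y : sl21 C) (i j : 'I_3) : sl_hom p x -> sl_hom q y ->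
  (sbr x y : 'M_3) i j = ((x : 'M_3) *m (y : 'M_3)) i j
    - (-1) ^+ (p && q) * ((y : 'M_3) *m (x : 'M_3)) i j.
Proof.
have other p' (z : sl21 C) : sl_hom p' z -> spart (~~ p') z = 0.
  move=> <-; apply/matrixP => k l; rewrite !mxE.
  by case: (odd_index k) (odd_index l) p' => [] [] [].
have both p' q' (z w : sl21 C) : sl_hom p' z -> sl_hom q' w -> forall p q,
    (spart p z *m spart q w - (-1) ^+ (p && q) *: (spart q w *m spart p z)) =
    if (p == p') && (q == q') then
      (z : 'M_3) *m (w : 'M_3) - (-1) ^+ (p' && q') *: ((w : 'M_3) *m (z : 'M_3)) else 0.
  move=> hz hw p1 q1; have [->|np] := eqVneq p1 p'; have [->|nq] := eqVneq q1 q'.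
  - by rewrite hz hw.
  - have -> : q1 = ~~ q' by case: (q1) (q') nq => [] [].
    by rewrite (other _ _ hw) mulmx0 mul0mx scaler0 subr0.
  - have -> : p1 = ~~ p' by case: (p1) (p') np => [] [].
    by rewrite (other _ _ hz) mulmx0 mul0mx scaler0 subr0.
  - have -> : q1 = ~~ q' by case: (q1) (q') nq => [] [].
    by rewrite (other _ _ hw) mulmx0 mul0mx scaler0 subr0.
move=> hx hy; rewrite /= /sbr_mx !big_bool /= !(both _ _ _ _ hx hy).
by case: p q {hx hy} => [] [] /=; rewrite ?addr0 ?add0r !mxE.
Qed.

Lemma basis_mulE g g' (i j : 'I_3) : (g < 8)%N -> (g' < 8)%N ->
  ((basis g : 'M_3) *m (basis g' : 'M_3)) i j =
  (product_entry (basis_entry g) (basis_entry g') i j)%:~R.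
Proof.
move=> g8 g'8; rewrite mxE !big_ord_recl big_ord0 addr0 !basisE // /product_entry.
by rewrite !intrD !intrM addrA.
Qed.

Lemma slsum_entry (I : Type) (s : seq I) (F : I -> sl21 C) (i j : 'I_3) :
  (\sum_(k <- s) F k : sl21 C) i j = \sum_(k <- s) (F k : 'M_3) i j.
Proof.
elim: s => [|k s IH]; first by rewrite !big_nil mxE.
by rewrite !big_cons mxE IH.
Qed.

Lemma sbr_basis g g' : (g < 8)%N -> (g' < 8)%N ->
  sbr (basis g) (basis g') = \sum_(k < 8) (bracket_coef g g' k)%:~R *: basis k.
Proof.
move=> g8 g'8; apply: sl21P => i j.
rewrite (sbr_hom _ _ (basis_hom g8) (basis_hom g'8)) !basis_mulE // slsum_entry.
transitivity ((bracket_entry g g' i j)%:~R : C).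
  by rewrite /bracket_entry intrB intrM rmorphXn /= mulrN1z.
rewrite bracket_coefP // rmorph_sum; apply: eq_bigr => k _.
by rewrite mxE basisE // -intrM.
Qed.

Lemma sform_basis g g' : (g < 8)%N -> (g' < 8)%N ->
  sform (basis g) (basis g') = (form_coef g g')%:~R.
Proof.
by move=> g8 g'8; rewrite /sform /str !basis_mulE // /form_coef intrB intrD.
Qed.

Definition sl_coordinate (k : nat) (x : sl21 C) : C :=
  coordinate k (fun i j => (x : 'M_3) (inord i) (inord j)).

Lemma basis_expand (x : sl21 C) : x = \sum_(k < 8) sl_coordinate k x *: basis k.
Proof.
have str0 : x 0 0 + x 1 1 = x 2 2.
  by have := valP x; rewrite inE /str subr_eq0 => /eqP.
have o0 : inord 0 = 0 :> 'I_3 by apply: val_inj; rewrite /= inordK.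
have o1 : inord 1 = 1 :> 'I_3 by apply: val_inj; rewrite /= inordK.
have o2 : inord 2 = 2 :> 'I_3 by apply: val_inj; rewrite /= inordK.
apply: sl21P => i j; rewrite slsum_entry.
under eq_bigr => k _ do rewrite mxE basisE //.
rewrite !big_ord_recl big_ord0 /sl_coordinate /= o0 o1 o2.
have i3 : [|| i == 0, i == 1 | i == 2] by case: i => [[|[|[|]]]].
have j3 : [|| j == 0, j == 1 | j == 2] by case: j => [[|[|[|]]]].
by case/or3P: i3 => /eqP->; case/or3P: j3 => /eqP->; rewrite /= -?str0; ring.
Qed.

End Basis.

(** * Currents and the Sugawara vector *)

Section Currents.
Variables (C : numFieldType) (kappa : C) (V : affine_vsa kappa) (L : simple_quotient V).

Definition current (x : sl21 C) : L := sq_proj L (Vmode x (-1) (Vvac kappa)).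

Notation X g := (vsa_Y (current (basis C g))).
Notation one := (vsa_one L).

Lemma current_proj x n (v : Vaff kappa) :
  vsa_Y (current x) n (sq_proj L v) = sq_proj L (Vmode x n v).
Proof. by rewrite -sq_Y /= av_gen. Qed.

Lemma sq_proj_ind (P : L -> Prop) : (forall v, P (sq_proj L v)) -> forall w, P w.
Proof. by move=> H w; have [v <-] := sq_surj w. Qed.

Lemma current_linear : linear current.
Proof. by move=> c x y; rewrite /current Vmode_linear linearP. Qed.
HB.instance Definition _ := GRing.isLinear.Build C (sl21 C) L *:%R current current_linear.

Lemma current_parity p x : sl_hom p x -> vsa_par p (current x).
Proof.
move=> px; apply: sq_par; apply: sub_span; rewrite -[p]addbF.
by apply: Vmonomial_act => //; apply: Vmonomial_vac.
Qed.

Lemma basis_current_parity g : (g < 8)%N ->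
  vsa_par (basis_odd g) (current (basis C g)).
Proof. by move=> g8; apply/current_parity/basis_hom. Qed.

Lemma current_bracket g g' m n v : (g < 8)%N -> (g' < 8)%N ->
  X g m (X g' n v) = (-1) ^+ (basis_odd g && basis_odd g') *: X g' n (X g m v)
    + \sum_(k < 8) (bracket_coef g g' k)%:~R *: X k (m + n) v
    + (if m + n == 0 then m%:~R * (form_coef g g')%:~R else 0) *: (kappa *: v).
Proof.
move=> g8 g'8; elim/sq_proj_ind: v => v; rewrite !current_proj.
under eq_bigr do rewrite current_proj.
have := Vmode_bracket m n v (basis_hom C g8) (basis_hom C g'8).
rewrite sform_basis // => /(canRL (subrK _)) ->.
rewrite !linearD /= addrC addrA; congr (_ + _ + _); [by rewrite linearZ | |];
  last by rewrite !scalerA linearZ.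
rewrite sbr_basis //.
pose f x := sq_proj L (Vmode x (m + n) v).
have lf : linear f by move=> c x y; rewrite /f Vmode_linear linearP.
pose fl : {linear sl21 C -> L} := HB.pack f (GRing.isLinear.Build C _ _ _ f lf).
rewrite -[LHS]/(fl _) linear_sum; apply: eq_bigr => k _.
by rewrite linearZ.
Qed.

Lemma current_vacuum x n : 0 <= n -> vsa_Y (current x) n one = 0.
Proof. by case: (vsa_creation (current x)) => _; apply. Qed.

Lemma current_create x : vsa_Y (current x) (-1) one = current x.
Proof. by case: (vsa_creation (current x)). Qed.

Lemma current_ind (P : set L) : subspace P -> P one ->
  (forall g n v, (g < 8)%N -> P v -> P (X g n v)) -> forall v, P v.
Proof.
move=> sP P1 PX; elim/sq_proj_ind; elim/Vproj_ind.
apply: (free_alg_ind (P := [set u | P (sq_proj L (Vproj kappa u))])).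
- split=> [|c u v /= Pu Pv]; first by rewrite /= !linear0; apply: subspace0.
  by rewrite !linearP; apply: subspaceP.
- by rewrite /= -[Vproj _ _]/(vsa_one V) sq_one.
move=> [[x n]|] u /= Pu; last first.
  by rewrite -/(genk C) Vproj_level linearZ; apply: subspaceZ.
rewrite -/(genx x n) -Vmode_proj -current_proj [x]basis_expand linear_sum vsa_Yl_sum.
apply: subspace_sum => // k _; rewrite linearZ vsa_YlZ; apply: subspaceZ => //.
exact: PX.
Qed.

Lemma current_ind_linear (f f' : {linear L -> L}) : f one = f' one ->
  (forall g n v, (g < 8)%N -> f v = f' v -> f (X g n v) = f' (X g n v)) ->
  forall v, f v = f' v.
Proof.
move=> f1 fX; apply: (current_ind (P := [set v | f v = f' v])) => //.
split=> [|c u v /= fu fv]; first by rewrite /= !linear0.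
by rewrite !linearP /= fu fv.
Qed.

(** ** The Sugawara vector *)

(** The invariant tensor dual to the form. *)
Definition casimir_coef (g g' : nat) : int :=
  match g, g' with
  | 0%N, 1%N | 1%N, 0%N | 2%N, 3%N | 3%N, 2%N | 6%N, 4%N | 7%N, 5%N => 1
  | 4%N, 6%N | 5%N, 7%N => - 1
  | _, _ => 0
  end.

Definition conformal : L := sq_proj L (sugawara kappa).

Lemma conformalE : conformal = (2 * (kappa + 1))^-1 *:
  \sum_(a < 8) \sum_(b < 8) (casimir_coef a b)%:~R *: X a (-1) (X b (-1) one).
Proof.
rewrite /conformal /sugawara linearZ; congr (_ *: _).
have bE x y : sq_proj L (Vmode x (-1) (Vmode y (-1) (Vvac kappa))) =
    vsa_Y (current x) (-1) (vsa_Y (current y) (-1) one).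
  by rewrite -current_proj -[Vvac kappa]/(vsa_one V) -sq_one -current_proj.
rewrite !linearD !linearN /= !bE.
rewrite !big_ord_recl !big_ord0 /= /basis /= !scale0r !scale1r.
rewrite !mulrN1z !scaleN1r !(addr0, add0r) -!addrA; do 5!congr (_ + _).
by rewrite addrCA.
Qed.

Lemma conformal_even : vsa_par false conformal.
Proof.
rewrite conformalE.
have sp : subspace (vsa_par (v := L) false) by case: (wm_superspace (vsa_adjoint L)).
apply: subspaceZ => //; apply: subspace_sum_ord => // a.
apply: subspace_sum_ord => // b.
case: (boolP (basis_odd a == basis_odd b)) => [/eqP ab|ab]; last first.
  suff -> : casimir_coef a b = 0 by rewrite scale0r; apply: subspace0.
  by case: a ab => [[|[|[|[|[|[|[|[|?]]]]]]]] ?] //;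
     case: b => [[|[|[|[|[|[|[|[|?]]]]]]]] ?].
apply: subspaceZ => //.
have := wm_parity (vsa_adjoint L) (-1) (basis_current_parity (ltn_ord a))
  (wm_parity (vsa_adjoint L) (-1) (basis_current_parity (ltn_ord b)) (vsa_one_even L)).
by rewrite addbF ab addbb.
Qed.

(** The positive part of the operator product of two currents. *)
Lemma current_current (g b n : nat) : (g < 8)%N -> (b < 8)%N ->
  X g n%:Z (X b (-1) one) =
  match n with
  | 0%N => \sum_(l < 8) (bracket_coef g b l)%:~R *: X l (-1) one
  | 1%N => ((form_coef g b)%:~R * kappa) *: one
  | _ => 0
  end.
Proof.
move=> g8 b8; rewrite current_bracket // current_vacuum // linear0 ?scaler0 add0r.
case: n => [|[|n]].
- by rewrite mul0r scale0r ?if_same addr0.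
- rewrite big1 ?add0r => [|l _]; last by rewrite current_vacuum ?scaler0.
  by rewrite mul1r scalerA.
rewrite big1 ?add0r => [|l _]; last by rewrite current_vacuum ?scaler0 //; lia.
by have -> : (n.+2%:Z + -1 == 0) = false by []; rewrite scale0r.
Qed.

Lemma current_quadratic (g a b n : nat) : (g < 8)%N -> (a < 8)%N -> (b < 8)%N ->
  X g n%:Z (X a (-1) (X b (-1) one)) =
  match n with
  | 0%N => \sum_(k < 8)
      ((-1) ^+ (basis_odd g && basis_odd a) * (bracket_coef g b k)%:~R)
         *: X a (-1) (X k (-1) one)
    + \sum_(k < 8) (bracket_coef g a k)%:~R *: X k (-1) (X b (-1) one)
  | 1%N => ((-1) ^+ (basis_odd g && basis_odd a) * (form_coef g b)%:~R * kappa) *: X a (-1) one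
    + \sum_(k < 8) \sum_(l < 8)
        ((bracket_coef g a k)%:~R * (bracket_coef k b l)%:~R) *: X l (-1) one
    + ((form_coef g a)%:~R * kappa) *: X b (-1) one
  | 2%N => \sum_(k < 8) ((bracket_coef g a k)%:~R * (form_coef k b)%:~R * kappa) *: one
  | _ => 0
  end.
Proof.
move=> g8 a8 b8; rewrite current_bracket // current_current //.
have idx k : k.+1%:Z + (-1) = k%:Z by lia.
case: n => [|[|[|n]]].
- rewrite scale0r addr0 linear_sum scaler_sumr; congr (_ + _).
  by apply: eq_bigr => k _; rewrite linearZ scalerA.
- rewrite idx eqxx mul1r !scalerA linearZ scalerA; congr (_ *: _ + _ + _).
    by rewrite mulrA.
  apply: eq_bigr => k _; rewrite current_current // scaler_sumr.
  by apply: eq_bigr => l _; rewrite scalerA.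
- rewrite idx scale0r addr0 linear0 scaler0 add0r.
  by apply: eq_bigr => k _; rewrite current_current // scalerA mulrA.
- rewrite idx scale0r addr0 linear0 scaler0 add0r.
  by rewrite big1 // => k _; rewrite current_current // scaler0.
Qed.

Hypothesis kappa1 : kappa + 1 != 0.

(** The invariance of the Casimir tensor. *)
Lemma conformal_mode0 g : (g < 8)%N -> X g 0 conformal = 0.
Proof.
move=> g8; pose T (a b : nat) := X a (-1) (X b (-1) one).
rewrite conformalE linearZ /= linear_sum -[RHS](scaler0 _ (2 * (kappa + 1))^-1).
congr (_ *: _).
rewrite (eq_bigr (fun a : 'I_8 => \sum_(b < 8) \sum_(k < 8)
   ((casimir_coef a b * ((-1) ^+ (basis_odd g && basis_odd a) * bracket_coef g b k))%:~R *: T a k)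
  + \sum_(b < 8) \sum_(k < 8) (casimir_coef a b * bracket_coef g a k)%:~R *: T k b)); last first.
  move=> a _; rewrite linear_sum -big_split; apply: eq_bigr => b _ /=.
  rewrite linearZ /= (@current_quadratic g a b 0) // scalerDr !scaler_sumr; congr (_ + _);
    apply: eq_bigr => k _; by rewrite scalerA !intrM ?rmorphXn ?mulrN1z.
rewrite big_split /=.
have -> : \sum_(a < 8) \sum_(b < 8) \sum_(k < 8)
    (casimir_coef a b * bracket_coef g a k)%:~R *: T k b =
  \sum_(a < 8) \sum_(b < 8) (\sum_(k < 8) (casimir_coef k b * bracket_coef g k a))%:~R *: T a b.
  rewrite [LHS](eq_bigr (fun a : 'I_8 => \sum_(k < 8) \sum_(b < 8)
    (casimir_coef a b * bracket_coef g a k)%:~R *: T k b)) => [|a _]; last exact: exchange_big.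
  rewrite exchange_big; apply: eq_bigr => k _; rewrite exchange_big; apply: eq_bigr => b _.
  by rewrite -scaler_suml rmorph_sum.
have -> : \sum_(a < 8) \sum_(b < 8) \sum_(k < 8) ((casimir_coef a b *
     ((-1) ^+ (basis_odd g && basis_odd a) * bracket_coef g b k))%:~R *: T a k) =
  \sum_(a < 8) \sum_(b < 8) (\sum_(k < 8) (casimir_coef a k *
     ((-1) ^+ (basis_odd g && basis_odd a) * bracket_coef g k b)))%:~R *: T a b.
  apply: eq_bigr => a _; rewrite exchange_big; apply: eq_bigr => b _.
  by rewrite -scaler_suml rmorph_sum.
rewrite -big_split big1 // => a _; rewrite -big_split big1 // => b _ /=.
rewrite -scalerDl -intrD.
rewrite (sum8E (fun k => casimir_coef a k * ((-1) ^+ (basis_odd g && basis_odd a) * bracket_coef g k b))).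
rewrite (sum8E (fun k => casimir_coef k b * bracket_coef g k a)).
have : all8 (fun g => all8 (fun a => all8 (fun b =>
  sum8 (fun k => casimir_coef a k * ((-1) ^+ (basis_odd g && basis_odd a) * bracket_coef g k b))
  + sum8 (fun k => casimir_coef k b * bracket_coef g k a) == 0))) by vm_compute.
by move=> /all8P-/(_ g g8)/all8P-/(_ a (ltn_ord a))/all8P-/(_ b (ltn_ord b))/eqP->; rewrite scale0r.
Qed.

(** Half the Casimir eigenvalue on the adjoint representation is the dual Coxeter
    number, which is 1. *)
Lemma conformal_mode1 g : (g < 8)%N -> X g 1 conformal = current (basis C g).
Proof.
move=> g8; rewrite conformalE linearZ /=.
pose T (a : nat) := X a (-1) one.
have -> : X g 1 (\sum_(a < 8) \sum_(b < 8) (casimir_coef a b)%:~R *: X a (-1) (X b (-1) one)) =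
  \sum_(l < 8) (kappa * (\sum_(a < 8) (casimir_coef l a *
        ((-1) ^+ (basis_odd g && basis_odd l) * form_coef g a)) +
      \sum_(a < 8) casimir_coef a l * form_coef g a)%:~R +
    (\sum_(a < 8) \sum_(b < 8) \sum_(k < 8)
       casimir_coef a b * (bracket_coef g a k * bracket_coef k b l))%:~R) *: T l.
  rewrite linear_sum.
  rewrite (eq_bigr (fun a : 'I_8 => \sum_(b < 8)
    ((kappa * (casimir_coef a b * ((-1) ^+ (basis_odd g && basis_odd a) * form_coef g b))%:~R) *: T a
    + \sum_(l < 8) \sum_(k < 8)
       (casimir_coef a b * (bracket_coef g a k * bracket_coef k b l))%:~R *: T l
    + (kappa * (casimir_coef a b * form_coef g a)%:~R) *: T b))); last first.
    move=> a _; rewrite linear_sum; apply: eq_bigr => b _ /=.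
    rewrite linearZ /= (@current_quadratic g a b 1) // !scalerDr; congr (_ + _ + _).
    - rewrite scalerA !intrM rmorphXn /= mulrN1z; congr (_ *: _); ring.
    - rewrite exchange_big scaler_sumr; apply: eq_bigr => l _.
      by rewrite scaler_sumr; apply: eq_bigr => k _; rewrite scalerA !intrM.
    - by rewrite scalerA intrM; congr (_ *: _); ring.
  rewrite (eq_bigr (fun a : 'I_8 =>
     \sum_(b < 8) (kappa * (casimir_coef a b * ((-1) ^+ (basis_odd g && basis_odd a) * form_coef g b))%:~R) *: T a
     + \sum_(b < 8) \sum_(l < 8) \sum_(k < 8)
       (casimir_coef a b * (bracket_coef g a k * bracket_coef k b l))%:~R *: T l
     + \sum_(b < 8) (kappa * (casimir_coef a b * form_coef g a)%:~R) *: T b)); last first.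
    by move=> a _; rewrite !big_split.
  rewrite !big_split /= [Z in _ + Z]exchange_big /=.
  rewrite [Z in _ + Z + _](eq_bigr (fun a : 'I_8 => \sum_(l < 8) \sum_(b < 8) \sum_(k < 8)
       (casimir_coef a b * (bracket_coef g a k * bracket_coef k b l))%:~R *: T l));
    last by move=> a _; rewrite exchange_big.
  rewrite [Z in _ + Z + _]exchange_big /= -!big_split; apply: eq_bigr => l _ /=.
  rewrite intrD mulrDr scalerDl scalerDl addrAC; congr (_ + _ + _).
  - by rewrite -scaler_suml -mulr_sumr rmorph_sum.
  - by rewrite -scaler_suml -mulr_sumr rmorph_sum.
  - rewrite !rmorph_sum scaler_suml; apply: eq_bigr => a _.
    rewrite !rmorph_sum scaler_suml; apply: eq_bigr => b _.
    by rewrite !rmorph_sum scaler_suml.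
have form_part (l : nat) : (l < 8)%N ->
    \sum_(a < 8) (casimir_coef l a * ((-1) ^+ (basis_odd g && basis_odd l) * form_coef g a)) +
    \sum_(a < 8) casimir_coef a l * form_coef g a = if l == g then 2 else 0.
  move=> l8; rewrite (sum8E (fun a => casimir_coef l a *
    ((-1) ^+ (basis_odd g && basis_odd l) * form_coef g a))).
  rewrite (sum8E (fun a => casimir_coef a l * form_coef g a)).
  have : all8 (fun g => all8 (fun l => sum8 (fun a => casimir_coef l a *
    ((-1) ^+ (basis_odd g && basis_odd l) * form_coef g a))
    + sum8 (fun a => casimir_coef a l * form_coef g a) == if l == g then 2 else 0))
    by vm_compute.
  by move=> /all8P-/(_ g g8)/all8P-/(_ l l8)/eqP.
have bracket_part (l : nat) : (l < 8)%N ->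
    \sum_(a < 8) \sum_(b < 8) \sum_(k < 8)
       casimir_coef a b * (bracket_coef g a k * bracket_coef k b l) = if l == g then 2 else 0.
  move=> l8; pose S a b := sum8 (fun k => casimir_coef a b * (bracket_coef g a k * bracket_coef k b l)).
  rewrite (eq_bigr (fun a : 'I_8 => sum8 (S a))) => [|a _]; last first.
    rewrite -sum8E; apply: eq_bigr => b _.
    exact: (sum8E (fun k => casimir_coef a b * (bracket_coef g a k * bracket_coef k b l))).
  rewrite (sum8E (fun a => sum8 (S a))) /S.
  have : all8 (fun g => all8 (fun l => sum8 (fun a => sum8 (fun b => sum8 (fun k =>
    casimir_coef a b * (bracket_coef g a k * bracket_coef k b l))))
    == if l == g then 2 else 0)) by vm_compute.
  by move=> /all8P-/(_ g g8)/all8P-/(_ l l8)/eqP.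
rewrite (bigD1 (Ordinal g8)) // [Z in _ *: (_ + Z)]big1 ?addr0 => [|l /andP[_ lg]].
  rewrite -[nat_of_ord (Ordinal _)]/g form_part // bracket_part // eqxx /T current_create scalerA.
  have k2 : (2 * (kappa + 1) : C) != 0 by rewrite mulf_neq0 // pnatr_eq0.
  by rewrite (_ : kappa * 2 + 2 = 2 * (kappa + 1)) ?mulVf ?scale1r //; ring.
have {}lg : (l == g :> nat) = false by apply/negbTE; apply: contra lg => /eqP lg; apply/eqP/val_inj.
by rewrite form_part // bracket_part // lg mulr0 addr0 scale0r.
Qed.

Lemma conformal_mode_ge2 g (n : nat) : (g < 8)%N -> X g n.+2%:Z conformal = 0.
Proof.
move=> g8; rewrite conformalE linearZ /= linear_sum -[RHS](scaler0 _ (2 * (kappa + 1))^-1).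
congr (_ *: _).
case: n => [|n]; last first.
  rewrite big1 // => a _; rewrite linear_sum big1 // => b _.
  by rewrite linearZ /= (@current_quadratic g a b n.+3) // scaler0.
rewrite (eq_bigr (fun a : 'I_8 => \sum_(b < 8) \sum_(k < 8)
   ((casimir_coef a b * (bracket_coef g a k * form_coef k b))%:~R * kappa) *: one)); last first.
  move=> a _; rewrite linear_sum; apply: eq_bigr => b _.
  rewrite linearZ /= (@current_quadratic g a b 2) // scaler_sumr; apply: eq_bigr => k _.
  by rewrite scalerA !intrM mulrA.
pose S a b := sum8 (fun k => casimir_coef a b * (bracket_coef g a k * form_coef k b)).
rewrite (eq_bigr (fun a : 'I_8 => ((sum8 (S a))%:~R * kappa) *: one)) => [|a _]; last first.
  rewrite -sum8E rmorph_sum mulr_suml scaler_suml; apply: eq_bigr => b _.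
  rewrite /S -(sum8E (fun k => casimir_coef a b * (bracket_coef g a k * form_coef k b))).
  by rewrite rmorph_sum mulr_suml scaler_suml.
rewrite -scaler_suml -mulr_suml -rmorph_sum (sum8E (fun a => sum8 (S a))) /S.
have : all8 (fun g => sum8 (fun a => sum8 (fun b => sum8 (fun k =>
    casimir_coef a b * (bracket_coef g a k * form_coef k b)))) == 0) by vm_compute.
by move=> /all8P-/(_ g g8)/eqP->; rewrite mul0r scale0r.
Qed.

Lemma current_conformal_commutator g m n v : (g < 8)%N ->
  X g m (vsa_Y conformal n v) =
  vsa_Y conformal n (X g m v) + m%:~R *: X g (m + n - 1) v.
Proof.
move=> g8.
rewrite (@vsa_commutator _ _ _ _ _ _ _ _ _ 2 (basis_current_parity g8) conformal_even
  (andbF _)); last first.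
  by case=> [//|[//|i]] _; rewrite conformal_mode_ge2 ?scaler0.
rewrite !big_ord_recl big_ord0 addr0; congr (_ + _) => /=.
rewrite conformal_mode0 // vsa_Yl0 scaler0 add0r conformal_mode1 //.
by have := binzS C m 0; rewrite binz0 mul1r mulr1 subr0 => ->; rewrite addr0.
Qed.

Lemma L0_current g n v : (g < 8)%N ->
  vsa_Y conformal 1 (X g n v) = X g n (vsa_Y conformal 1 v) - n%:~R *: X g n v.
Proof. by move=> g8; rewrite current_conformal_commutator // addrK addrK. Qed.

Lemma L0_vacuum : vsa_Y conformal 1 one = 0.
Proof. by case: (vsa_creation conformal) => _ ->. Qed.

(** Both operators kill the vacuum and have the same commutators with the currents. *)
Lemma conformal_translation v : vsa_Y conformal 0 v = vsa_Y v (-2) one.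
Proof.
pose T v : L := vsa_Y v (-2) one.
have lT : linear T by move=> c a b; rewrite /T vsa_YlP.
pose lTf : {linear L -> L} := HB.pack T (GRing.isLinear.Build C _ _ _ T lT).
apply: (current_ind_linear (f := vsa_Y conformal 0) (f' := lTf)).
  rewrite /= /T; case: (vsa_creation conformal) => _ -> //.
  by rewrite (wm_vacuum (vsa_adjoint L)).
move=> g n w g8 /= wE; rewrite /T (translation_mode _ _ (basis_current_parity g8)).
rewrite -/(T w) -wE current_conformal_commutator // addr0.
by rewrite addrK.
Qed.

Lemma L0_mode (b v : L) n : vsa_Y conformal 1 (vsa_Y b n v) =
  vsa_Y b n (vsa_Y conformal 1 v) + vsa_Y (vsa_Y conformal 1 b) n v
  - (n + 1)%:~R *: vsa_Y b n v.
Proof.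
rewrite (vsa_commutator_even _ _ 1 _ conformal_even).
rewrite !big_ord_recl big_ord0 addr0 /= binz0 scale1r (binz_nat C 1 1) binn scale1r.
rewrite conformal_translation vsa_translation -[RHS]addrA; congr (_ + _).
rewrite addr0 addrC scaleNr.
by congr (- (_%:~R *: vsa_Y _ _ _) + vsa_Y _ _ _); rewrite ?/bump /=; lia.
Qed.

End Currents.

(** * The grading by degree and Cartan weights *)

(** The degree, the charge under u = diag (1, 1, 2) and the weight under h_+. *)
Definition degree3 : choiceType := (int * int * int)%type.

Definition add3 (i j : degree3) : degree3 := (i.1.1 + j.1.1, i.1.2 + j.1.2, i.2 + j.2).

Definition parity (i : degree3) : bool := odd (absz i.1.2).

Lemma parity_add i j : parity (add3 i j) = parity i (+) parity j.
Proof.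
rewrite /parity /=; set a := i.1.2; set b := j.1.2; rewrite -oddD.
have : exists k : int, a + b = (absz a + absz b)%N%:Z + 2 * k.
  case: (ltrP a 0); case: (ltrP b 0) => b0 a0;
    [exists (a + b) | exists a | exists b | exists 0]; lia.
by move=> [k ->]; lia.
Qed.

(** The degree of a vector of degree [i] in the [s]-th spectral flow, with respect to
   the conformal vector deformed by xi, and up to an additive constant. *)
Definition flow_degree (xi : rat) (s : nat) (i : degree3) : rat :=
  i.1.1%:~R + s%:R * i.1.2%:~R - xi / 2 * i.2%:~R.

Lemma flow_degree_add xi s i j :
  flow_degree xi s (add3 i j) = flow_degree xi s i + flow_degree xi s j.
Proof. by rewrite /flow_degree /= !intrD; ring. Qed.

Section Gradings.
Variables (C : numFieldType) (kappa : C) (V : affine_vsa kappa) (L : simple_quotient V).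
Hypothesis kappa1 : kappa + 1 != 0.

Notation cur g := (current L (basis C g)).
Notation X g := (vsa_Y (cur g)).
Notation one := (vsa_one L).
Notation L0 := (vsa_Y (conformal L) 1).

Definition cartan_weight (i g : nat) : int := bracket_coef i g g.

Lemma cartan_bracket_coef i g k : (i < 2)%N -> (g < 8)%N -> (k < 8)%N ->
  bracket_coef i g k = if k == g then cartan_weight i g else 0.
Proof.
move=> i2 g8 k8; apply/eqP.
have : all (fun i => all8 (fun g => all8 (fun k =>
  bracket_coef i g k == if k == g then cartan_weight i g else 0))) (iota 0 2) by vm_compute.
move=> /allP-/(_ i); rewrite mem_iota => /(_ i2).
by move=> /all8P-/(_ g g8)/all8P-/(_ k k8).
Qed.

Lemma cartan_weight_additive i g g' k : (i < 2)%N -> (g < 8)%N -> (g' < 8)%N ->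
  (k < 8)%N -> bracket_coef g g' k != 0 ->
  cartan_weight i k = cartan_weight i g + cartan_weight i g'.
Proof.
move=> i2 g8 g'8 k8 N0; apply/eqP; move: N0; apply/implyP.
have : all (fun i => all8 (fun g => all8 (fun g' => all8 (fun k =>
  (bracket_coef g g' k != 0) ==>
  (cartan_weight i k == cartan_weight i g + cartan_weight i g'))))) (iota 0 2)
  by vm_compute.
move=> /allP-/(_ i); rewrite mem_iota => /(_ i2).
by move=> /all8P-/(_ g g8)/all8P-/(_ g' g'8)/all8P-/(_ k k8).
Qed.

Definition charge (g : nat) : int := cartan_weight 0 g - cartan_weight 1 g.
Definition hweight (g : nat) : int := cartan_weight 0 g + cartan_weight 1 g.

Lemma odd_charge g : (g < 8)%N -> odd (absz (charge g)) = basis_odd g.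
Proof.
have /all8P H : all8 (fun g => odd (absz (charge g)) == basis_odd g) by vm_compute.
by move=> /H/eqP.
Qed.

Lemma cartan_zero_mode i g n v : (i < 2)%N -> (g < 8)%N ->
  X i 0 (X g n v) = X g n (X i 0 v) + (cartan_weight i g)%:~R *: X g n v.
Proof.
move=> i2 g8; have i8 : (i < 8)%N by case: i i2 => [|[|i]].
rewrite current_bracket // mul0r if_same scale0r addr0.
have -> : basis_odd i = false by case: i i2 {i8} => [|[|i]].
rewrite scale1r add0r; congr (_ + _).
rewrite (bigD1 (Ordinal g8)) //= cartan_bracket_coef // eqxx big1 ?addr0 // => k kg.
rewrite cartan_bracket_coef //.
have -> : (k == g :> nat) = false.
  by apply/negbTE; apply: contra kg => /eqP kg; apply/eqP/val_inj.
by rewrite scale0r.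
Qed.

(** These are the matrices diag (1, 1, 2) and h_+, which are orthogonal for the form. *)
Definition uvec : L := cur 0 - cur 1.
Definition hvec : L := cur 0 + cur 1.

Lemma hvecE : hvec = current L (hplus C).
Proof. by rewrite /hvec /hplus linearD. Qed.

Lemma vsa_YlB (a b v : L) n : vsa_Y (a - b) n v = vsa_Y a n v - vsa_Y b n v.
Proof. by rewrite -scaleN1r addrC vsa_YlP scaleN1r addrC. Qed.

Lemma uvec_even : vsa_par false uvec.
Proof.
have sp : subspace (vsa_par (v := L) false) by case: (wm_superspace (vsa_adjoint L)).
by apply: subspaceB => //; [exact: (@basis_current_parity _ _ _ L 0)
  | exact: (@basis_current_parity _ _ _ L 1)].
Qed.

Lemma hvec_even : vsa_par false hvec.
Proof.
have sp : subspace (vsa_par (v := L) false) by case: (wm_superspace (vsa_adjoint L)).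
by apply: subspaceD => //; [exact: (@basis_current_parity _ _ _ L 0)
  | exact: (@basis_current_parity _ _ _ L 1)].
Qed.

Lemma u0_current g n v : (g < 8)%N ->
  vsa_Y uvec 0 (X g n v) = X g n (vsa_Y uvec 0 v) + (charge g)%:~R *: X g n v.
Proof.
move=> g8; rewrite !vsa_YlB !cartan_zero_mode // linearB intrB scalerBl /=.
by rewrite opprD addrACA.
Qed.

Lemma h0_current g n v : (g < 8)%N ->
  vsa_Y hvec 0 (X g n v) = X g n (vsa_Y hvec 0 v) + (hweight g)%:~R *: X g n v.
Proof.
move=> g8; rewrite !vsa_YlD !cartan_zero_mode // linearD intrD scalerDl /=.
by rewrite addrACA.
Qed.

Lemma u0_uvec k v : vsa_Y uvec 0 (vsa_Y uvec k v) = vsa_Y uvec k (vsa_Y uvec 0 v).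
Proof.
have E w : vsa_Y uvec k w = X 0 k w - X 1 k w by exact: vsa_YlB.
rewrite !E linearB /= !u0_current //.
by rewrite (_ : charge 0 = 0) // (_ : charge 1 = 0) // !scale0r !addr0.
Qed.

Lemma uvec_vacuum n : 0 <= n -> vsa_Y uvec n one = 0.
Proof. by case: (vsa_creation uvec) => _; apply. Qed.

Lemma hvec_vacuum n : 0 <= n -> vsa_Y hvec n one = 0.
Proof. by case: (vsa_creation hvec) => _; apply. Qed.

(** The form takes the value -2 on the pair (u, u). *)
Lemma uvec_uvec (n : nat) : vsa_Y uvec n%:Z uvec =
  if n == 1%N then (-2 * kappa) *: one else 0.
Proof.
have E g : (g < 2)%N -> vsa_Y uvec n%:Z (cur g) =
    if n == 1%N then ((-1) ^+ g.+1 * kappa) *: one else 0.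
  move=> g2; have g8 : (g < 8)%N by apply: leq_trans g2 _.
  rewrite -[cur g]current_create vsa_YlB !current_current //.
  case: n => [|[|n]] /=; last by rewrite subrr.
    rewrite -sumrB big1 // => k _; rewrite -scalerBl -intrB.
    rewrite [_ - _](_ : _ = 0) ?scale0r //.
    by case: g g2 {g8} => [|[|]] // _; case: k => [[|[|[|[|[|[|[|[|]]]]]]]] ?].
  rewrite -scalerBl -mulrBl -intrB; congr (_ * _ *: _).
  by case: g g2 {g8} => [|[|]] // _; rewrite ?expr1 ?sqrrN ?expr1n ?mulrN1z.
rewrite {2}/uvec linearB /= !E //; case: ifP; rewrite ?subrr // => _.
by rewrite -scalerBl; congr (_ *: _); ring.
Qed.

(** ** Monomials *)

(* The letter (g, k) stands for the mode -(k + 1) of the basis element g. *)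
Notation letter := (nat * nat)%type.
Implicit Types (x y : letter).

Definition monomial (s : seq letter) : L := foldr (fun x v => X x.1 (- x.2.+1%:Z) v) one s.

Definition letters (s : seq letter) : bool := all (fun x => x.1 < 8)%N s.

Definition letter_degree x : degree3 := (x.2.+1%:Z, charge x.1, hweight x.1).

Definition seq_degree (s : seq letter) : degree3 :=
  foldr (fun x i => add3 (letter_degree x) i) (0, 0, 0) s.

Definition homogeneous (i : degree3) : set L := [set v |
  [/\ L0 v = i.1.1%:~R *: v, vsa_Y uvec 0 v = i.1.2%:~R *: v
    & vsa_Y hvec 0 v = i.2%:~R *: v]].

Lemma homogeneous_subspace i : subspace (homogeneous i).
Proof.
split=> [|c u v [/= u1 u2 u3] [v1 v2 v3]]; first by split; rewrite linear0 scaler0.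
by split; rewrite linearP /= ?u1 ?u2 ?u3 ?v1 ?v2 ?v3 scalerDr !scalerA mulrC.
Qed.

Lemma homogeneous_vacuum : homogeneous (0, 0, 0) one.
Proof. by split; rewrite ?L0_vacuum ?uvec_vacuum ?hvec_vacuum ?scale0r. Qed.

Lemma homogeneous_current i g n v : (g < 8)%N -> homogeneous i v ->
  homogeneous (add3 (- n, charge g, hweight g) i) (X g n v).
Proof.
move=> g8 [v1 v2 v3]; split=> /=; rewrite ?L0_current ?u0_current ?h0_current //
  ?v1 ?v2 ?v3 linearZ /= intrD scalerDl addrC //.
by rewrite rmorphN scaleNr.
Qed.

Lemma homogeneous_monomial s : letters s -> homogeneous (seq_degree s) (monomial s).
Proof.
elim: s => [_|x s IH /= /andP[x8 /IH s8]]; first exact: homogeneous_vacuum.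
by have := homogeneous_current (- x.2.+1%:Z) x8 s8; rewrite opprK.
Qed.

Lemma monomial_swap x y s : (x.1 < 8)%N -> (y.1 < 8)%N ->
  monomial [:: x, y & s] =
  (-1) ^+ (basis_odd x.1 && basis_odd y.1) *: monomial [:: y, x & s] +
  \sum_(k < 8) (bracket_coef x.1 y.1 k)%:~R *: monomial ((k : nat, (x.2 + y.2).+1) :: s).
Proof.
move=> x8 y8; rewrite /= current_bracket //.
rewrite (_ : (_ == 0 :> int) = false) ?scale0r ?addr0; last by apply/negbTE; lia.
by congr (_ + _); apply: eq_bigr => k _; congr (_ *: vsa_Y _ _ _) => /=; lia.
Qed.

Lemma monomials_span v : span [set u | exists2 s, letters s & u = monomial s] v.
Proof.
set S := [set u | _]; have sS := span_subspace S.
have inS s : letters s -> span S (monomial s).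
  by move=> s8; apply: (@sub_span _ _ S); exists s.
have negative g (k : nat) u : (g < 8)%N -> span S u -> span S (X g (- k.+1%:Z) u).
  move=> g8; move: u; apply: span_ind; first exact: preimage_subspace.
  by move=> _ [s s8 ->] /=; apply: (inS ((g, k) :: s)); rewrite /= g8.
have modes s : letters s -> forall g n, (g < 8)%N -> span S (X g n (monomial s)).
  elim: s => [_|x s IH /= /andP[x8 s8]] g [n|n] g8.
  - by rewrite current_vacuum //; apply: (subspace0 sS).
  - by rewrite NegzE; apply: negative => //; apply: (inS [::]).
  - rewrite current_bracket //; apply: (subspaceD sS); last first.
      by do 2!apply: (subspaceZ _ sS); apply: inS.
    apply: (subspaceD sS).
      by apply: (subspaceZ _ sS); apply: negative => //; apply: IH.
    by apply: (subspace_sum_ord sS) => k; apply: (subspaceZ _ sS); apply: IH.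
  - by rewrite NegzE; apply: negative => //; apply: (inS (x :: s)); rewrite /= x8.
move: v; apply: current_ind => // [|g n v g8]; first exact: (inS [::]).
move: v; apply: span_ind; first exact: preimage_subspace.
by move=> _ [s s8 ->]; apply: modes.
Qed.

(** ** Odd letters occur at most once *)

Lemma duplicate_split (T : eqType) (p : pred T) (s : seq T) : ~~ uniq (filter p s) ->
  exists (x : T) (a b c : seq T), p x /\ s = a ++ x :: b ++ x :: c.
Proof.
elim: s => [//|z s IH] /=; case: ifP => [pz|_]; last first.
  by move=> /IH[x [a [b [c [px ->]]]]]; exists x, (z :: a), b, c.
rewrite /= negb_and negbK mem_filter => /orP[/andP[_]|/IH].
  by move=> /splitPr[b c]; exists z, [::], b, c.
by move=> [x [a [b [c [px ->]]]]]; exists x, (z :: a), b, c.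
Qed.

Definition shorter s : set L := span [set u | exists t,
  [/\ letters t, (size t < size s)%N, seq_degree t = seq_degree s & u = monomial t]].

Lemma shorter_monomial s t : letters t -> (size t < size s)%N ->
  seq_degree t = seq_degree s -> shorter s (monomial t).
Proof. by move=> t8 ts dt; apply: (@sub_span _ _ [set u | _]); exists t. Qed.

Lemma shorter_subspace s : subspace (shorter s).
Proof. exact: span_subspace. Qed.

Lemma shorter_cons x s v : (x.1 < 8)%N -> shorter s v ->
  shorter (x :: s) (X x.1 (- x.2.+1%:Z) v).
Proof.
move=> x8; move: v; apply: span_ind.
  exact/preimage_subspace/shorter_subspace.
move=> _ [t [t8 ts dt ->]].
by apply: (shorter_monomial (t := x :: t)); rewrite /= ?x8 ?dt.
Qed.

Lemma shorter_bracket x y s : (x.1 < 8)%N -> (y.1 < 8)%N -> letters s ->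
  shorter [:: x, y & s] (\sum_(k < 8) (bracket_coef x.1 y.1 k)%:~R *:
    monomial ((k : nat, (x.2 + y.2).+1) :: s)).
Proof.
move=> x8 y8 s8; have sS := shorter_subspace [:: x, y & s].
apply: subspace_sum_ord => // k.
have [->|N0] := eqVneq (bracket_coef x.1 y.1 k) 0.
  by rewrite scale0r; exact: (subspace0 sS).
apply: (subspaceZ _ sS); apply: (shorter_monomial (t := (k : nat, (x.2 + y.2).+1) :: s)) => //=.
  by rewrite ltn_ord.
rewrite /add3 /= /charge /hweight !(cartan_weight_additive _ x8 y8 _ N0) //.
by congr (_, _, _); lia.
Qed.

(** Exchanging two neighbours costs their bracket, which is a combination of shorter
    monomials; once the two odd letters are neighbours, their product is half of a
    bracket. *)
Lemma repeated_odd_letter a b c x : basis_odd x.1 -> letters (a ++ x :: b ++ x :: c) ->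
  shorter (a ++ x :: b ++ x :: c) (monomial (a ++ x :: b ++ x :: c)).
Proof.
move=> xo; elim: a => [|y a IH] /=; last first.
  by move=> /andP[y8 /IH]; apply: shorter_cons.
move=> /andP[x8]; elim: b => [|y b IH] /=.
  move=> /andP[_ c8]; have sS := shorter_subspace [:: x, x & c].
  have E := monomial_swap c x8 x8; rewrite xo expr1 scaleN1r in E.
  have E2 : 2%:R *: monomial [:: x, x & c] = \sum_(k < 8)
      (bracket_coef x.1 x.1 k)%:~R *: monomial ((k : nat, (x.2 + x.2).+1) :: c).
    by rewrite scaler_nat mulr2n {2}E addrA subrr add0r.
  rewrite -[X x.1 _ _]/(monomial [:: x, x & c]) -[monomial _]scale1r.
  have n2 : (2%:R : C) != 0 by rewrite pnatr_eq0.
  rewrite -(mulVf n2) -scalerA E2; apply: (subspaceZ _ sS); exact: shorter_bracket.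
move=> /andP[y8 bc8]; set s := b ++ x :: c in bc8 IH *.
have sS := shorter_subspace [:: x, y & s].
rewrite -[X x.1 _ _]/(monomial [:: x, y & s]) monomial_swap //.
apply: (subspaceD sS); last exact: shorter_bracket.
apply: (subspaceZ _ sS).
have : shorter (y :: x :: s) (monomial (y :: x :: s)).
  by apply: shorter_cons => //; apply: IH; rewrite bc8.
apply: span_sub => u [t [t8 ts dt ->]]; exists t; split=> //.
rewrite dt /= /add3 /=; congr (_, _, _); lia.
Qed.

Lemma reduced_span s : letters s -> span [set u | exists t,
  [/\ letters t, uniq (filter (fun x => basis_odd x.1) t), seq_degree t = seq_degree s
    & u = monomial t]] (monomial s).
Proof.
have [n] := ubnP (size s); elim: n s => [//|n IH] s; rewrite ltnS => sn s8.
have [us|] := boolP (uniq (filter (fun x => basis_odd x.1) s)).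
  by apply: (@sub_span _ _ [set u | _]); exists s.
move=> /duplicate_split[x [a [b [c [xo sE]]]]].
have : shorter s (monomial s) by rewrite sE in s8 *; apply: repeated_odd_letter.
apply: span_ind; first exact: span_subspace.
move=> _ [t [t8 ts dt ->]]; rewrite -dt; apply: IH => //; exact: leq_trans ts sn.
Qed.

Lemma homogeneous_span (A : set degree3) :
  (forall s, letters s -> uniq (filter (fun x => basis_odd x.1) s) -> A (seq_degree s)) ->
  forall v, span [set u | exists2 i, A i & homogeneous i u] v.
Proof.
move=> HA v; move: v (monomials_span v); apply: span_ind; first exact: span_subspace.
move=> _ [s s8 ->]; have := reduced_span s8; apply: span_sub => u [t [t8 ut _ ->]].
by exists (seq_degree t); [apply: HA | apply: homogeneous_monomial].
Qed.

Lemma homogeneous_direct_sum : direct_sum homogeneous.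
Proof.
apply: direct_sum_intro => [|v|]; first exact: homogeneous_subspace.
  have := @homogeneous_span setT (fun _ _ _ => I) v; apply: span_sub => u [i _ iu].
  by exists i.
pose vec (t : option bool) : L :=
  if t is Some b then if b then hvec else uvec else conformal L.
pose md (t : option bool) : int := if t is Some _ then 0 else 1.
pose ev (i : degree3) (t : option bool) : C :=
  (if t is Some b then if b then i.2 else i.1.2 else i.1.1)%:~R.
have sep (i j : degree3) : i != j -> exists z, ev i z != ev j z.
  case: i j => [[d c] w] [[d' c'] w']; rewrite !xpair_eqE !negb_and -orbA /ev /=.
  by case/or3P=> ne; [exists None | exists (Some false) | exists (Some true)];
    rewrite /= eqr_int.
pose D (t : option bool) : {linear L -> L} := vsa_Y (vec t) (md t).
move=> s f us Hf; apply: (@eigen_independent _ _ _ _ D ev sep s f us).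
by move=> i [[]|]; have [] := Hf i.
Qed.

Notation comp := (component homogeneous_direct_sum).

Lemma comp_support (A : set degree3) :
  (forall s, letters s -> uniq (filter (fun x => basis_odd x.1) s) -> A (seq_degree s)) ->
  forall i v, homogeneous i v -> v <> 0 -> A i.
Proof.
move=> HA i v iv v0; apply: contrapT => nAi; apply: v0.
exact: (support_vanish homogeneous_direct_sum (homogeneous_span HA) iv nAi).
Qed.

Lemma degree_nonneg i v : homogeneous i v -> v <> 0 -> 0 <= i.1.1.
Proof.
apply: (comp_support (A := [set i : degree3 | 0 <= i.1.1])) => s _ _ /=.
by elim: s => //= x s IH; rewrite addr_ge0.
Qed.

Lemma degree_neg i v : homogeneous i v -> i.1.1 < 0 -> v = 0.
Proof.
move=> iv; rewrite ltNge => /negP i0; apply: contrapT => v0; apply: i0.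
exact: degree_nonneg iv v0.
Qed.

Lemma one_neq0 : one <> 0.
Proof.
move=> one0; have [[v v0] _] := sq_simple L; apply: v0.
by case: (vsa_creation v) => <- _; rewrite one0 linear0.
Qed.

(** ** Parity *)

Lemma par_subspace p : subspace (vsa_par (v := L) p).
Proof. by case: (wm_superspace (vsa_adjoint L)). Qed.

Lemma par_disjoint (p q : bool) (v : L) : p != q -> vsa_par p v -> vsa_par q v -> v = 0.
Proof.
move=> pq pv qv; have d := wm_superspace (vsa_adjoint L).
have := component_homogeneous d q pv; rewrite (component_homogeneous d q qv) eqxx.
by rewrite eq_sym (negbTE pq).
Qed.

Lemma monomial_parity s : letters s -> vsa_par (parity (seq_degree s)) (monomial s).
Proof.
elim: s => [_|x s IH /= /andP[x8 /IH s8]]; first exact: vsa_one_even.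
rewrite parity_add {1}/parity /= odd_charge //.
exact: (wm_parity (vsa_adjoint L) _ (basis_current_parity L x8) s8).
Qed.

(** The odd elements of the basis are those of odd charge. *)
Lemma homogeneous_parity i v : homogeneous i v -> vsa_par (parity i) v.
Proof.
move=> iv; have -> : v = comp v i.
  by rewrite (component_homogeneous homogeneous_direct_sum i iv) eqxx.
move: v {iv} (monomials_span v); apply: span_ind => [|_ [s s8 ->]].
  split=> [|c u w /= pu pw]; first by rewrite /= component0; apply: subspace0 (par_subspace _).
  by rewrite /= componentP; apply: (subspaceP _ (par_subspace _)).
rewrite /= (component_homogeneous _ i (homogeneous_monomial s8)).
case: eqP => [->|_]; first exact: monomial_parity.
exact: subspace0 (par_subspace _).
Qed.

Lemma parityP p v : vsa_par p v <-> forall i, parity i != p -> comp v i = 0.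
Proof.
split=> [pv i ip|v0]; last first.
  rewrite [v](csupport_sum homogeneous_direct_sum).
  apply: (subspace_sum (par_subspace p)) => i _.
  have [<-|ip] := eqVneq (parity i) p.
    by apply: homogeneous_parity; exact: componentN.
  by rewrite v0 //; apply: subspace0 (par_subspace p).
pose s := csupport homogeneous_direct_sum v.
pose w q := \sum_(i <- s | parity i == q) comp v i.
have wq q : vsa_par q (w q).
  rewrite /w -big_filter; apply: (subspace_sum (par_subspace q)) => j.
  by rewrite mem_filter => /andP[/eqP <- _]; apply: homogeneous_parity; exact: componentN.
have vE : v = w p + w (~~ p).
  rewrite {1}[v](csupport_sum homogeneous_direct_sum) (bigID (fun i => parity i == p)) /=.
  by congr (_ + _); apply: eq_bigl => j; case: (parity j) (p) => [] [].
have w0 : w (~~ p) = 0.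
  apply: (@par_disjoint (~~ p) p) => //; first by case: (p).
  rewrite -[w _](addKr (w p)) -vE addrC.
  exact: (subspaceB (par_subspace p)).
case si: (i \in s); last by rewrite csupport_out ?si.
have [_ _] := homogeneous_direct_sum.
move=> /(_ (filter (fun i => parity i == ~~ p) s) (comp v)); apply.
- exact/filter_uniq/csupport_uniq.
- exact: componentN.
- by rewrite big_filter.
- by rewrite mem_filter si andbT; case: (parity i) (p) ip => [] [].
Qed.

(** ** Modes of homogeneous vectors *)

Lemma zero_mode (a b v : L) n : vsa_par false a ->
  vsa_Y a 0 (vsa_Y b n v) = vsa_Y b n (vsa_Y a 0 v) + vsa_Y (vsa_Y a 0 b) n v.
Proof.
move=> ea; rewrite (vsa_commutator_even b v 0 n ea) big_ord1 binz0 scale1r.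
by rewrite add0r subr0.
Qed.

Lemma homogeneous_mode i j n a v : homogeneous i a -> homogeneous j v ->
  homogeneous (add3 (- n - 1, 0, 0) (add3 i j)) (vsa_Y a n v).
Proof.
move=> [a1 a2 a3] [v1 v2 v3]; split=> /=.
- rewrite L0_mode // a1 v1 linearZ /= vsa_YlZ -scalerDl -scalerBl.
  by congr (_ *: _); rewrite !intrD !rmorphN /=; ring.
- rewrite (zero_mode _ _ _ uvec_even) a2 v2 linearZ /= vsa_YlZ -scalerDl.
  by congr (_ *: _); rewrite add0r intrD addrC.
- rewrite (zero_mode _ _ _ hvec_even) a3 v3 linearZ /= vsa_YlZ -scalerDl.
  by congr (_ *: _); rewrite add0r intrD addrC.
Qed.

Lemma homogeneous_uvec : homogeneous (1, 0, 0) uvec.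
Proof.
have H g : (g < 2)%N -> homogeneous (1, 0, 0) (cur g).
  move=> g2; have g8 : (g < 8)%N by apply: leq_trans g2 _.
  rewrite -[cur g]current_create.
  have := homogeneous_current (-1) g8 homogeneous_vacuum.
  by case: g g2 {g8} => [|[|]].
by apply: (subspaceB (homogeneous_subspace _)); apply: H.
Qed.

Lemma homogeneous_basis g : (g < 8)%N ->
  homogeneous (1, charge g, hweight g) (cur g).
Proof.
move=> g8; rewrite -[cur g]current_create.
have := homogeneous_current (-1) g8 homogeneous_vacuum.
by rewrite /add3 /= !addr0.
Qed.

Lemma L0_conformal : L0 (conformal L) = 2%:R *: conformal L.
Proof.
rewrite {2 3}conformalE linearZ /= [RHS]scalerA [2 * _^-1]mulrC.
rewrite -[RHS]scalerA; congr (_ *: _); rewrite linear_sum scaler_sumr; apply: eq_bigr => a _.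
rewrite linear_sum scaler_sumr; apply: eq_bigr => b _.
rewrite linearZ /= scalerA [2 * _]mulrC -scalerA; congr (_ *: _).
rewrite !L0_current // L0_vacuum linear0 sub0r (_ : (-1)%:~R = -1 :> C) //.
by rewrite !scaleN1r !opprK scaler_nat mulr2n.
Qed.

Lemma homogeneous_conformal : homogeneous (2, 0, 0) (conformal L).
Proof.
have cartan i : (i < 2)%N -> X i 0 (conformal L) = 0.
  by move=> i2; apply: conformal_mode0 => //; apply: leq_trans i2 _.
split=> /=; first by rewrite L0_conformal.
  by rewrite vsa_YlB !cartan // subrr scale0r.
by rewrite vsa_YlD !cartan // addr0 scale0r.
Qed.

Lemma charge_table g : (g < 8)%N ->
  charge g = nth 0 [:: 0; 0; 0; 0; -1; 1; 1; -1] g.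
Proof.
have /all8P H : all8 (fun g => charge g == nth 0 [:: 0; 0; 0; 0; -1; 1; 1; -1] g)
  by vm_compute.
by move=> /H/eqP.
Qed.

Lemma hweight_table g : (g < 8)%N ->
  hweight g = nth 0 [:: 0; 0; 2; -2; 1; 1; -1; -1] g.
Proof.
have /all8P H : all8 (fun g => hweight g == nth 0 [:: 0; 0; 2; -2; 1; 1; -1; -1] g)
  by vm_compute.
by move=> /H/eqP.
Qed.

(** ** A lower bound for the gradings of the spectral flows *)

Section Bound.
Variable xi : rat.
Hypothesis xi01 : 0 < xi < 1.

Lemma flow_degree_letter s (x : letter) : (x.1 < 8)%N ->
  (if basis_odd x.1 && (x.2 < s)%N then - s%:R else 0) <=
  flow_degree xi s (letter_degree x).
Proof.
case: x => g k /= g8; have [x0 x1] := andP xi01.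
rewrite /flow_degree /=.
have k1 : (1 : rat) <= (k.+1%:Z)%:~R by rewrite -[1]/(1%:~R) ler_int.
have s0 : (0 : rat) <= s%:R by rewrite ler0n.
have kE : (k.+1%:Z)%:~R = k%:R + 1 :> rat by rewrite natr1.
have ks : if (k < s)%N then true else s%:R <= k%:R :> rat.
  by case: ltnP => // sk; rewrite ler_nat.
have k0 : (0 : rat) <= k%:R by rewrite ler0n.
rewrite kE charge_table // hweight_table //.
case: g g8 => [|[|[|[|[|[|[|[|g]]]]]]]] // _ /=; move: ks;
  case: (k < s)%N => /= ks; rewrite ?rmorphN /=; lra.
Qed.

Lemma flow_degree_letters s (t : seq letter) : letters t ->
  - (s%:R * (count (fun x => basis_odd x.1 && (x.2 < s)%N) t)%:R) <=
  flow_degree xi s (seq_degree t).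
Proof.
elim: t => [_|x t IH /= /andP[x8 /IH t8]].
  by rewrite /flow_degree /= mulr0 oppr0 !mulr0 subr0 addr0.
rewrite flow_degree_add natrD mulrDr opprD; apply: lerD => //.
apply: le_trans (flow_degree_letter s x8); case: (basis_odd x.1 && (x.2 < s)%N).
  by rewrite mulr1.
by rewrite mulr0 oppr0.
Qed.

(** Each of the finitely many letters of negative degree occurs at most once. *)
Lemma flow_degree_bound s i v : homogeneous i v -> v <> 0 ->
  - (s * (8 * s))%:R <= flow_degree xi s i.
Proof.
pose A := [set i : degree3 | - (s * (8 * s))%:R <= flow_degree xi s i].
apply: (comp_support (A := A)) => t t8 ut.
apply: le_trans (flow_degree_letters s t8); rewrite lerN2 natrM ler_wpM2l ?ler0n //.
rewrite ler_nat -size_filter.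
pose box := [seq (g, k) | g <- iota 0 8, k <- iota 0 s].
apply: (@leq_trans (size box)); last by rewrite size_allpairs !size_iota.
apply: uniq_leq_size => [|x].
  rewrite (eq_filter (a2 := predI (fun x => (x.2 < s)%N) (fun x => basis_odd x.1))).
    by rewrite filter_predI; apply: filter_uniq.
  by move=> x /=; rewrite andbC.
rewrite mem_filter => /andP[/andP[_ xs] /(allP t8) x8].
by case: x xs x8 => g k /= ks g8; apply: allpairs_f; rewrite mem_iota.
Qed.

(** The flow degrees of L are bounded below and lie in a lattice. *)
Lemma flow_degree_min s : exists i v, [/\ homogeneous i v, v <> 0 &
  forall j w, homogeneous j w -> w <> 0 -> flow_degree xi s i <= flow_degree xi s j].
Proof.
(* [lat i] is the numerator of the flow degree, shifted to be nonnegative. *)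
pose q := denq (xi / 2); pose p := numq (xi / 2).
pose lat (i : degree3) : int := q * i.1.1 + q * s%:Z * i.1.2 - p * i.2 + q * (s * (8 * s))%:Z.
have q0 : 0 < q by exact: denq_gt0.
have q0' : (0 : rat) < q%:~R by rewrite ltr0z.
have latE i : (lat i)%:~R = q%:~R * (flow_degree xi s i + (s * (8 * s))%:R).
  rewrite /flow_degree -[xi / 2 in RHS]divq_num_den -/p -/q /lat.
  rewrite !(intrD, intrM, rmorphN) /=; field.
  by rewrite gt_eqF.
have lat_ge0 i v : homogeneous i v -> v <> 0 -> 0 <= lat i.
  move=> iv v0; rewrite -(ler0z rat) latE; apply: mulr_ge0; first exact: ltW.
  by have := flow_degree_bound s iv v0; rewrite -subr_ge0 opprK.
pose P n := exists i v, [/\ homogeneous i v, v <> 0 & absz (lat i) = n].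
have exP : exists n, `[< P n >].
  exists (absz (lat (0, 0, 0))); apply/asboolP; exists (0, 0, 0), one.
  by split => //; [exact: homogeneous_vacuum | exact: one_neq0].
case: (ex_minnP exP) => n /asboolP[i [v [iv v0 ni]]] nmin.
exists i, v; split=> // j w jw w0.
have ij : lat i <= lat j.
  have := nmin (absz (lat j)); have := lat_ge0 i v iv v0; have := lat_ge0 j w jw w0.
  have Pj : `[< P (absz (lat j)) >] by apply/asboolP; exists j, w.
  by move=> li lj /(_ Pj); rewrite -ni; lia.
by move: ij; rewrite -(ler_int rat) !latE ler_pM2l // lerD2r.
Qed.

End Bound.

(** ** The deformed conformal vector *)

Lemma omega_xiE xi : sq_proj L (omega_xi V xi) =
  conformal L + ratr (xi / 2) *: vsa_Y hvec (-2) one.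
Proof.
rewrite /omega_xi linearD; congr (_ + _); rewrite [LHS]linearZ /=; congr (_ *: _).
rewrite -[av_Y _ _ _ _]/(vsa_Y (sugawara kappa : V) 0 _) sq_Y.
by rewrite -[sq_proj L (Vmode _ _ _)]/(current L (hplus C)) -hvecE conformal_translation.
Qed.

Lemma has_weight_omega xi w (a : L) :
  has_weight (sq_proj L (omega_xi V xi)) w a <->
  L0 a - ratr (xi / 2) *: vsa_Y hvec 0 a = ratr w *: a.
Proof.
rewrite /has_weight omega_xiE vsa_YlD vsa_YlZ vsa_translation subrr.
by rewrite scaleNr (_ : 1%:~R = 1 :> C) // scale1r scalerN.
Qed.

Lemma component_weight xi w (a : L) i :
  has_weight (sq_proj L (omega_xi V xi)) w a -> comp a i != 0 -> flow_degree xi 0 i = w.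
Proof.
move=> /has_weight_omega aw ai; pose dH := homogeneous_direct_sum.
pose D (a : L) := L0 a - ratr (xi / 2) *: vsa_Y hvec 0 a.
have key (b : L) : comp (D b) i = ratr (flow_degree xi 0 i) *: comp b i.
  move: b; apply: (homogeneous_ind dH) => [|j b jb].
    split=> [|c u v /= uE vE]; first by rewrite /= /D !(linear0, subr0, component0, scaler0).
    have -> : D (c *: u + v) = c *: D u + D v.
      by rewrite /D !linearP /= ?scalerBr ?opprD addrACA !scalerN.
    by rewrite !componentP uE vE scalerDr !scalerA mulrC.
  have Db : D b = ratr (flow_degree xi 0 j) *: b.
    case: jb => b1 _ b3; rewrite /D b1 b3 scalerA -scalerBl; congr (_ *: _).
    rewrite /flow_degree mul0r addr0 [RHS]rmorphB /= ratr_int; congr (_ - _).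
    by rewrite [RHS]rmorphM /= ratr_int.
  rewrite Db !(component_homogeneous homogeneous_direct_sum i jb).
  rewrite (component_homogeneous homogeneous_direct_sum i (subspaceZ _ (homogeneous_subspace j) jb)).
  by case: eqP => [->|_] //; rewrite scaler0.
have := key a; rewrite /D aw -[ratr w *: a]addr0 componentP component0 addr0 => /eqP.
rewrite -subr_eq0 -scalerBl scaler_eq0 (negbTE ai) orbF subr_eq0 => /eqP/fmorph_inj.
by move->.
Qed.

End Gradings.

(** * Spectral flows of the adjoint module *)

Section Flow.
Variables (C : numFieldType) (kappa : C) (V : affine_vsa kappa) (L : simple_quotient V).
Hypothesis kappa1 : kappa + 1 != 0.

Local Notation dsum := (homogeneous_direct_sum L kappa1).
Local Notation comp := (component dsum).
Local Notation one := (vsa_one L).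
Implicit Types (s : nat) (n : int) (a b u v : L) (i j : degree3).

Definition flow_vec s : L := s%:R *: uvec L.

Local Notation E s := (li (flow_vec s)).

Lemma flow_vec_even s : vsa_par false (flow_vec s).
Proof. exact/(subspaceZ _ (par_subspace L false))/uvec_even. Qed.

Lemma flow_vec_comm s (k : nat) v :
  vsa_Y (flow_vec s) 0 (vsa_Y (flow_vec s) k.+1%:Z v) =
  vsa_Y (flow_vec s) k.+1%:Z (vsa_Y (flow_vec s) 0 v).
Proof. by rewrite !vsa_YlZ !linearZ /= u0_uvec. Qed.

Lemma flow_vec_charge s i v : homogeneous i v ->
  vsa_Y (flow_vec s) 0 v = (s%:Z * i.1.2)%:~R *: v.
Proof. by case=> _ uv _; rewrite vsa_YlZ uv scalerA intrM. Qed.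

Lemma li_homogeneous s r i v : homogeneous i v ->
  homogeneous (i.1.1 - r%:Z, i.1.2, i.2) (E s r v).
Proof.
move=> iv; pose N (d : nat) := homogeneous (L := L) (i.1.1 - d%:Z, i.1.2, i.2).
suff : N (0 + r)%N (E s r v) by [].
apply: li_stable => [d|d k w Nw|].
- exact: homogeneous_subspace.
- rewrite /N /= vsa_YlZ; apply: subspaceZ; first exact: homogeneous_subspace.
  have := homogeneous_mode kappa1 k.+1%:Z (homogeneous_uvec L kappa1) Nw.
  rewrite /add3 /= !add0r.
  by have -> : - k.+1%:Z - 1 + (1 + (i.1.1 - d%:Z)) = i.1.1 - (d + k.+1)%:Z by lia.
by rewrite /N subr0; case: (i) iv => [[]].
Qed.

Lemma li_vanish s r i v : homogeneous i v -> (absz i.1.1 < r)%N -> E s r v = 0.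
Proof.
case: i => [[d c] w] iv ir; apply: (degree_neg kappa1 (li_homogeneous s r iv)).
by move: ir => /=; lia.
Qed.

(** The modes of Y (Delta (s u, z) a, z), extended linearly from homogeneous a. *)
Definition flow_mode s a (n : int) u : L :=
  linear_glue dsum (fun i a' =>
    twisted_mode (flow_vec s) (M := adjoint L) (s%:Z * i.1.2) (absz i.1.1).+1 a' n u) a.

Let twisted_linear s i (n : int) u : linear (fun a' => twisted_mode (flow_vec s)
   (M := adjoint L) (s%:Z * i.1.2) (absz i.1.1).+1 a' n u).
Proof.
move=> c a b; rewrite /twisted_mode scaler_sumr -big_split; apply: eq_bigr => k _ /=.
by rewrite linearP vsa_YlP.
Qed.

Lemma flow_mode_linear_l s n u : linear (fun a => flow_mode s a n u).
Proof. by apply: linear_glue_linear => i; apply: twisted_linear. Qed.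

Lemma flow_mode0l s n u : flow_mode s 0 n u = 0.
Proof.
have := @flow_mode_linear_l s n u 1 0 0; rewrite !scale1r addr0.
by move=> /(congr1 (fun x => x - flow_mode s 0 n u)); rewrite subrr addrK.
Qed.

Lemma flow_mode_sum s a n u : flow_mode s a n u =
  \sum_(i <- csupport dsum a) flow_mode s (comp a i) n u.
Proof.
apply: eq_bigr => i _; apply/esym.
exact: (linear_glue_homogeneous dsum (fun j => @twisted_linear s j n u)
  (componentN dsum a i)).
Qed.

Lemma flow_modeE s i a n u (J : nat) : homogeneous i a -> (absz i.1.1 < J)%N ->
  flow_mode s a n u =
  twisted_mode (flow_vec s) (M := adjoint L) (s%:Z * i.1.2) J a n u.
Proof.
move=> ia iJ.
rewrite /flow_mode (linear_glue_homogeneous dsum (fun j => @twisted_linear s j n u) ia).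
by rewrite (twisted_mode_stable (M := adjoint L) _ _ _ iJ) // => k; apply: li_vanish ia.
Qed.

Lemma flow_mode_linear_r s a n : linear (flow_mode s a n).
Proof.
move=> c u v; rewrite /flow_mode /linear_glue scaler_sumr -big_split.
apply: eq_bigr => i _; rewrite /= /twisted_mode scaler_sumr -big_split.
by apply: eq_bigr => k _; rewrite linearP.
Qed.
HB.instance Definition _ s a n :=
  GRing.isLinear.Build C L L *:%R (flow_mode s a n) (flow_mode_linear_r s a n).

Definition flow_index s i j n : degree3 :=
  (i.1.1 + j.1.1 - n - s%:Z * i.1.2 - 1, i.1.2 + j.1.2, i.2 + j.2).

Lemma flow_mode_homogeneous s i j a n u : homogeneous i a -> homogeneous j u ->
  homogeneous (flow_index s i j n) (flow_mode s a n u).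
Proof.
move=> ia ju; rewrite (flow_modeE _ _ _ ia (leqnn _)) /twisted_mode.
apply: (subspace_sum_ord (homogeneous_subspace L _)) => k.
have := homogeneous_mode kappa1 (n + s%:Z * i.1.2 - k%:Z) (li_homogeneous s k ia) ju.
rewrite /flow_index /add3 /= !add0r.
by have -> : - (n + s%:Z * i.1.2 - k%:Z) - 1 + (i.1.1 - k%:Z + j.1.1) =
  i.1.1 + j.1.1 - n - s%:Z * i.1.2 - 1 by lia.
Qed.

Lemma flow_index_degree xi s i j n :
  flow_degree xi s (flow_index s i j n) =
  flow_degree xi 0 i + flow_degree xi s j - n%:~R - 1.
Proof.
by rewrite /flow_degree /= !(intrD, rmorphN, intrM) /= mul0r; ring.
Qed.

Lemma flow_index_parity s i j n : parity (flow_index s i j n) = parity i (+) parity j.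
Proof. by rewrite -parity_add. Qed.

Lemma flow_mode_vacuum s n u : flow_mode s one n u = if n == -1 then u else 0.
Proof.
rewrite (@flow_modeE _ (0, 0, 0) _ _ _ 1) //; last exact: homogeneous_vacuum.
rewrite /twisted_mode big_ord1 mulr0 addr0 subr0.
exact: (wm_vacuum (vsa_adjoint L)).
Qed.

Lemma flow_jacobi s p q a b u (l m n : int) : vsa_par p a -> vsa_par q b ->
  exists K0 : nat, forall K : nat, (K0 <= K)%N ->
  \sum_(i < K) binz C m i *: flow_mode s (vsa_Y a (l + i%:Z) b) (m + n - i%:Z) u =
  \sum_(i < K) ((-1) ^+ i * binz C l i) *:
    (flow_mode s a (m + l - i%:Z) (flow_mode s b (n + i%:Z) u)
     - ((-1) ^+ absz l * (-1) ^+ (p && q)) *: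
       flow_mode s b (n + l - i%:Z) (flow_mode s a (m + i%:Z) u)).
Proof.
pose J a b := exists K0 : nat, forall K : nat, (K0 <= K)%N ->
  \sum_(i < K) binz C m i *: flow_mode s (vsa_Y a (l + i%:Z) b) (m + n - i%:Z) u =
  \sum_(i < K) ((-1) ^+ i * binz C l i) *:
    (flow_mode s a (m + l - i%:Z) (flow_mode s b (n + i%:Z) u)
     - ((-1) ^+ absz l * (-1) ^+ (p && q)) *:
       flow_mode s b (n + l - i%:Z) (flow_mode s a (m + i%:Z) u)).
have Fl k w : linear (fun c => flow_mode s c k w) by exact: flow_mode_linear_l.
have F0 k w : flow_mode s 0 k w = 0 by exact: flow_mode0l.
have Jl b' : subspace [set a' | J a' b'].
  split=> [|c a1 a2 /= [K1 H1] [K2 H2]].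
    exists 0%N => K _; rewrite !big1 // => i _.
      by rewrite !F0 !linear0 ?subr0 ?addr0 ?scaler0.
    by rewrite vsa_Yl0 F0 scaler0.
  exists (maxn K1 K2) => K; rewrite geq_max => /andP[/H1 {}H1 /H2 {}H2].
  transitivity (c *: (\sum_(i < K) binz C m i *: flow_mode s (vsa_Y a1 (l + i%:Z) b') (m + n - i%:Z) u)
     + \sum_(i < K) binz C m i *: flow_mode s (vsa_Y a2 (l + i%:Z) b') (m + n - i%:Z) u).
    rewrite scaler_sumr -big_split; apply: eq_bigr => i _ /=.
    by rewrite vsa_YlP Fl scalerDr !scalerA mulrC.
  rewrite H1 H2 scaler_sumr -big_split; apply: eq_bigr => i _ /=.
  move: ((-1) ^+ i * _) ((-1) ^+ absz l * _) => x ep.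
  rewrite scalerA [c * x]mulrC -scalerA -scalerDr; congr (x *: _).
  by rewrite !Fl [flow_mode s _ _ (_ + _)]linearP /= scalerBr scalerDr opprD
    [RHS]addrACA !scalerA [c * ep]mulrC.
have Jr a' : subspace [set b' | J a' b'].
  split=> [|c a1 a2 /= [K1 H1] [K2 H2]].
    exists 0%N => K _; rewrite !big1 // => i _.
      by rewrite !F0 !linear0 ?subr0 ?addr0 ?scaler0.
    by rewrite linear0 F0 scaler0.
  exists (maxn K1 K2) => K; rewrite geq_max => /andP[/H1 {}H1 /H2 {}H2].
  transitivity (c *: (\sum_(i < K) binz C m i *: flow_mode s (vsa_Y a' (l + i%:Z) a1) (m + n - i%:Z) u)
     + \sum_(i < K) binz C m i *: flow_mode s (vsa_Y a' (l + i%:Z) a2) (m + n - i%:Z) u).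
    rewrite scaler_sumr -big_split; apply: eq_bigr => i _ /=.
    by rewrite linearP Fl scalerDr !scalerA mulrC.
  rewrite H1 H2 scaler_sumr -big_split; apply: eq_bigr => i _ /=.
  move: ((-1) ^+ i * _) ((-1) ^+ absz l * _) => x ep.
  rewrite scalerA [c * x]mulrC -scalerA -scalerDr; congr (x *: _).
  by rewrite !Fl [flow_mode s _ _ (_ + _)]linearP /= scalerBr scalerDr opprD
    [RHS]addrACA !scalerA [c * ep]mulrC.
move=> pa qb; rewrite -/(J a b).
rewrite [a](csupport_sum dsum); apply: (subspace_sum (Jl b)) => i _ /=.
rewrite [b](csupport_sum dsum); apply: (subspace_sum (Jr _)) => j _ /=.
have [a0|ai0] := eqVneq (comp a i) 0; first by rewrite a0; apply: subspace0 (Jl _).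
have [b0|bj0] := eqVneq (comp b j) 0; first by rewrite b0; apply: subspace0 (Jr _).
have ip : parity i = p.
  by apply/eqP; apply: contraT => ip; rewrite (proj1 (parityP kappa1 p a) pa i ip) eqxx in ai0.
have jq : parity j = q.
  by apply/eqP; apply: contraT => jq; rewrite (proj1 (parityP kappa1 q b) qb j jq) eqxx in bj0.
have ia := componentN dsum a i; have jb := componentN dsum b j.
move: (comp a i) (comp b j) ia jb => {ai0 bj0 pa qb}a1 b1 ia jb {a b}.
have pa := homogeneous_parity kappa1 ia; have qb := homogeneous_parity kappa1 jb.
rewrite ip in pa; rewrite jq in qb.
case: i j ip jq ia jb => [[d c] w] [[d' c'] w'] ip jq ia jb.
pose Jn := (absz d + absz d' + absz l + 2)%N.
have aJ k : (Jn <= k)%N -> li (flow_vec s) k a1 = 0.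
  by move=> Jk; apply: (li_vanish s ia); rewrite /Jn in Jk; move=> /=; lia.
have bJ k : (Jn <= k)%N -> li (flow_vec s) k b1 = 0.
  by move=> Jk; apply: (li_vanish s jb); rewrite /Jn in Jk; move=> /=; lia.
have abJ (k r : nat) : (Jn <= r)%N -> li (flow_vec s) r (vsa_Y a1 (l + k%:Z) b1) = 0.
  move=> Jr'; have kab := homogeneous_mode kappa1 (l + k%:Z) ia jb.
  apply: (degree_neg kappa1 (li_homogeneous s r kab)); rewrite /Jn in Jr'.
  by move=> /=; lia.
have [K0 H] := @twisted_jacobi C L (flow_vec s) (adjoint L) (flow_vec_even s)
  (flow_vec_comm s) p q a1 b1 (s%:Z * c) (s%:Z * c') l Jn Jn pa qb
  (flow_vec_charge s ia) aJ bJ abJ m n u.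
exists K0 => K /H {}H.
have aE k z : flow_mode s a1 k z = twisted_mode (flow_vec s) (M := adjoint L) (s%:Z * c) Jn a1 k z.
  by apply: (flow_modeE _ _ _ ia); rewrite /Jn /=; lia.
have bE k z : flow_mode s b1 k z = twisted_mode (flow_vec s) (M := adjoint L) (s%:Z * c') Jn b1 k z.
  by apply: (flow_modeE _ _ _ jb); rewrite /Jn /=; lia.
have abE (k : nat) r z : flow_mode s (vsa_Y a1 (l + k%:Z) b1) r z =
    twisted_mode (flow_vec s) (M := adjoint L) (s%:Z * c + s%:Z * c') Jn
      (vsa_Y a1 (l + k%:Z) b1) r z.
  have kab := homogeneous_mode kappa1 (l + k%:Z) ia jb.
  have [k0|k0] := ltrP (- (l + k%:Z) - 1 + (d + d')) 0.
    rewrite (degree_neg kappa1 kab k0) F0 /twisted_mode big1 // => t _.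
    by rewrite linear0 wm_Yl0.
  rewrite (flow_modeE _ _ _ kab (J := Jn)); first by rewrite /= add0r mulrDr.
  by rewrite /Jn /=; lia.
under eq_bigr do rewrite abE.
rewrite H; apply: eq_bigr => k _; by rewrite !aE !bE.
Qed.

End Flow.

(** * The graded product of the spectral flows *)

Lemma seq_bound (l : seq rat) : exists N : nat, forall x, x \in l -> x < N%:R.
Proof.
elim: l => [|x l [N NP]]; first by exists 0%N.
exists (Num.bound `|x| + N)%N => y; rewrite inE natrD => /orP[/eqP->|/NP yN].
  apply: le_lt_trans (ler_norm x) _.
  by apply: lt_le_trans (archi_boundP (normr_ge0 x)) _; rewrite lerDl ler0n.
by apply: lt_le_trans yN _; rewrite lerDr ler0n.
Qed.

Section Product.
Variables (C : numFieldType) (kappa : C) (V : affine_vsa kappa) (L : simple_quotient V).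
Hypothesis kappa1 : kappa + 1 != 0.
Variable xi : rat.
Hypothesis xi01 : 0 < xi < 1.

Local Notation dsum := (homogeneous_direct_sum L kappa1).
Local Notation comp := (component dsum).
Local Notation one := (vsa_one L).
Local Notation omega := (sq_proj L (omega_xi V xi)).
Implicit Types (s : nat) (n m : int) (a b u v : L) (i k : degree3).

Lemma comp_ext u v : (forall k, comp u k = comp v k) -> u = v.
Proof.
move=> uv; apply/eqP; rewrite -subr_eq0; apply/eqP.
rewrite [u - v](csupport_sum dsum) big1 // => k _.
by rewrite addrC -scaleN1r componentP uv scaleN1r addNr.
Qed.

Lemma comp_sum (J : Type) (l : seq J) (F : J -> L) k :
  comp (\sum_(j <- l) F j) k = \sum_(j <- l) comp (F j) k.
Proof.
elim: l => [|j l IH]; first by rewrite !big_nil component0.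
by rewrite !big_cons -[in LHS](scale1r (F j)) componentP scale1r IH.
Qed.

Definition lowest_index s : degree3 := projT1 (cid (flow_degree_min L kappa1 xi01 s)).

Lemma lowest_index_min s i v : homogeneous i v -> v <> 0 ->
  flow_degree xi s (lowest_index s) <= flow_degree xi s i.
Proof.
by move=> iv v0; have [w [_ _]] := projT2 (cid (flow_degree_min L kappa1 xi01 s)); apply; [exact: iv|].
Qed.

Definition lowest_vector s : L :=
  projT1 (cid (projT2 (cid (flow_degree_min L kappa1 xi01 s)))).

Lemma lowest_vectorP s :
  homogeneous (lowest_index s) (lowest_vector s) /\ lowest_vector s <> 0.
Proof.
by have [? ? _] := projT2 (cid (projT2 (cid (flow_degree_min L kappa1 xi01 s)))).
Qed.

(** The shift gives every flow the lowest degree 0, so that there are sequences which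
    are homogeneous of degree 0 with all entries nonzero. *)
Definition grade s i : rat := flow_degree xi s i - flow_degree xi s (lowest_index s).

Lemma grade_ge0 s v i : comp v i <> 0 -> 0 <= grade s i.
Proof.
by move=> vi; rewrite subr_ge0; apply: lowest_index_min vi; apply: componentN.
Qed.

Lemma flow_mode_comp s a n u k : comp (flow_mode kappa1 s a n u) k <> 0 ->
  exists i j, [/\ comp a i <> 0, comp u j <> 0 & k = flow_index s i j n].
Proof.
move=> ck; apply: contrapT => none; apply: ck.
rewrite flow_mode_sum comp_sum big1 // => i _.
rewrite [u in flow_mode _ _ _ _ u](csupport_sum dsum) linear_sum /= comp_sum big1 // => j _.
have [->|/eqP ai] := eqVneq (comp a i) 0; first by rewrite flow_mode0l component0.
have [->|/eqP uj] := eqVneq (comp u j) 0; first by rewrite linear0 component0.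
rewrite (component_homogeneous dsum k
  (flow_mode_homogeneous kappa1 s n (componentN dsum a i) (componentN dsum u j))).
by case: eqP => // kE; case: none; exists i, j.
Qed.

Definition graded_bounded (f : nat -> L) : Prop :=
  exists S : seq rat, forall s i, grade s i \notin S -> comp (f s) i = 0.

Definition graded_bounded_pred : {pred nat -> L} := fun f => `[< graded_bounded f >].

Fact graded_bounded_submod : submod_closed graded_bounded_pred.
Proof.
split=> [|c f g /asboolP[S fS] /asboolP[T gT]]; apply/asboolP.
  by exists [::] => s i _; rewrite component0.
exists (S ++ T) => s i; rewrite mem_cat negb_or => /andP[iS iT].
by rewrite componentP fS // gT // scaler0 addr0.
Qed.
HB.instance Definition _ :=
  GRing.isSubmodClosed.Build C (nat -> L) graded_bounded_pred graded_bounded_submod.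

Record flow_product : predArgType :=
  FlowProduct { flow_fun :> nat -> L; _ : flow_fun \in graded_bounded_pred }.
HB.instance Definition _ := [isSub for flow_fun].
HB.instance Definition _ := [Choice of flow_product by <:].
HB.instance Definition _ := [SubChoice_isSubLmodule of flow_product by <:].

Implicit Types (f g : flow_product).

Lemma flow_product_eq f g : (forall s, f s = g s) -> f = g.
Proof. by move=> fg; apply/val_inj/funext. Qed.

Lemma flow_product_bounded f : graded_bounded f.
Proof. by apply/asboolP; apply: valP f. Qed.

Lemma flow_product_sum (J : Type) (l : seq J) (F : J -> flow_product) s :
  (\sum_(j <- l) F j) s = \sum_(j <- l) F j s.
Proof.
elim: l => [|j l IH]; first by rewrite !big_nil.
by rewrite !big_cons -IH.
Qed.

Definition make_flow (f : nat -> L) (bf : graded_bounded f) : flow_product :=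
  FlowProduct (introT (asboolP (graded_bounded f)) bf : f \in graded_bounded_pred).

Fact product_mode_bounded a n f :
  graded_bounded (fun s => flow_mode kappa1 s a n (f s)).
Proof.
have [S fS] := flow_product_bounded f.
exists [seq flow_degree xi 0 i + r - n%:~R - 1 | i <- csupport dsum a, r <- S] => s k kS.
apply: contrapT => /flow_mode_comp[i [j [ai fj kE]]]; move/negP: kS; apply.
apply/allpairsP; exists (i, grade s j); split=> /=.
- by apply: contraT => /csupport_out.
- by apply: contraT => /fS.
- by rewrite kE /grade flow_index_degree; ring.
Qed.

Definition product_mode a n f : flow_product := make_flow (product_mode_bounded a n f).

Section Fibers.
Variables (J : choiceType) (phi : nat -> degree3 -> J).

(** The parity decomposition and the grading of the product are the two instances,
    for phi the parity and the grade. *)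
Definition fiber (j : J) : set flow_product :=
  [set f | forall s i, phi s i != j -> comp (f s) i = 0].

Lemma fiber_subspace j : subspace (fiber j).
Proof.
split=> [s i _|c f g fj gj s i ij]; first by rewrite component0.
by rewrite /= componentP fj // gj // scaler0 addr0.
Qed.

Definition fiber_fun j f s : L := \sum_(i <- csupport dsum (f s) | phi s i == j) comp (f s) i.

Lemma comp_fiber_fun j f s k :
  comp (fiber_fun j f s) k = if phi s k == j then comp (f s) k else 0.
Proof.
rewrite /fiber_fun -big_filter comp_sum.
under eq_bigr => i _ do rewrite (component_homogeneous dsum k (componentN dsum _ i)).
case kj: (phi s k == j); last first.
  rewrite big_seq big1 // => i; rewrite mem_filter => /andP[ij _].
  by case: eqP => // ki; rewrite ki ij in kj.
have [ks|ks] := boolP (k \in csupport dsum (f s)); last first.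
  rewrite (csupport_out ks) big1_seq // => i; rewrite mem_filter /= => /andP[_ si].
  by case: eqP => // ki; rewrite ki si in ks.
have kf : k \in [seq i <- csupport dsum (f s) | phi s i == j] by rewrite mem_filter kj.
rewrite (bigD1_seq k kf) /=; last exact/filter_uniq/csupport_uniq.
by rewrite eqxx big1 ?addr0 // => i /negbTE; rewrite eq_sym => ->.
Qed.

Fact fiber_fun_bounded j f : graded_bounded (fiber_fun j f).
Proof.
have [S fS] := flow_product_bounded f.
by exists S => s i iS; rewrite comp_fiber_fun fS // if_same.
Qed.

Definition fiber_part j f : flow_product := make_flow (fiber_fun_bounded j f).

Lemma fiber_partP j f : fiber j (fiber_part j f).
Proof. by move=> s i ij; rewrite comp_fiber_fun (negbTE ij). Qed.

Lemma fiber_part_sum (l : seq J) f : uniq l ->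
  (forall s i, phi s i \notin l -> comp (f s) i = 0) -> f = \sum_(j <- l) fiber_part j f.
Proof.
move=> ul fl; apply: flow_product_eq => s; apply: comp_ext => k.
rewrite flow_product_sum comp_sum.
under eq_bigr => j _ do rewrite comp_fiber_fun.
have [kl|kl] := boolP (phi s k \in l); last first.
  by rewrite fl // big1 // => j _; rewrite if_same.
rewrite (bigD1_seq _ kl) //= eqxx big1 ?addr0 // => j /negbTE.
by rewrite eq_sym => ->.
Qed.

Lemma fiber_sum_comp (l : seq J) (F : J -> flow_product) j s k :
  uniq l -> (forall j, fiber j (F j)) -> j \in l -> phi s k = j ->
  comp (F j s) k = comp ((\sum_(j <- l) F j) s) k.
Proof.
move=> ul Fj jl kj; rewrite flow_product_sum comp_sum (bigD1_seq _ jl) //=.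
rewrite big1 ?addr0 // => j' jj'; apply: Fj; by rewrite kj eq_sym.
Qed.

Lemma fiber_direct_sum :
  (forall f, exists l : seq J, forall s i, phi s i \notin l -> comp (f s) i = 0) ->
  direct_sum fiber.
Proof.
move=> fin; split=> [|f|l F ul Fj F0 j jl]; first exact: fiber_subspace.
  have [l fl] := fin f; exists (undup l), (fun j => fiber_part j f).
  split; [exact: undup_uniq | by move=> j; apply: fiber_partP |].
  apply: fiber_part_sum; first exact: undup_uniq.
  by move=> s i; rewrite mem_undup; apply: fl.
apply: flow_product_eq => s; apply: comp_ext => k; rewrite component0.
have [kj|kj] := eqVneq (phi s k) j; last exact: Fj.
by rewrite (fiber_sum_comp ul Fj jl kj) F0 component0.
Qed.

End Fibers.

Lemma fiber_homogeneous (J J' : choiceType) (phi : nat -> degree3 -> J)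
    (psi : nat -> degree3 -> J') (j' : J') :
  homogeneous_subset (fiber phi) (fiber psi j').
Proof.
move=> l F ul Fj Fpsi j jl s k kj'.
have [kj|kj] := eqVneq (phi s k) j; last exact: Fj.
by rewrite (fiber_sum_comp ul Fj jl kj); apply: Fpsi.
Qed.

Definition product_par : bool -> set flow_product := fiber (fun _ i => parity i).
Definition product_grading : rat -> set flow_product := fiber grade.

Lemma product_mode_linear_l n f : linear (fun a => product_mode a n f).
Proof.
by move=> c a b; apply: flow_product_eq => s; rewrite /= flow_mode_linear_l.
Qed.

Lemma product_mode_linear_r a n : linear (product_mode a n).
Proof. by move=> c f g; apply: flow_product_eq => s; apply: flow_mode_linear_r. Qed.

Lemma product_mode_parity p q a n f : vsa_par p a -> product_par q f ->
  product_par (p (+) q) (product_mode a n f).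
Proof.
move=> pa qf s k kpq; apply: contrapT => /flow_mode_comp[i [j [ai fj kE]]].
move/negP: kpq; apply; rewrite kE flow_index_parity; apply/eqP; congr (_ (+) _).
  by apply/eqP; apply: contraT => ip; case: ai; apply: (proj1 (parityP kappa1 p a) pa).
by apply/eqP; apply: contraT => jq; case: fj; apply: qf.
Qed.

Lemma product_mode_truncated a f :
  exists N : int, forall n, N <= n -> product_mode a n f = 0.
Proof.
have [S fS] := flow_product_bounded f.
have [N NP] := seq_bound [seq flow_degree xi 0 i + r | i <- csupport dsum a, r <- S].
exists N%:Z => n Nn; apply: flow_product_eq => s; apply: comp_ext => k.
rewrite component0; apply: contrapT => ck; have := grade_ge0 s ck.
move: ck => /flow_mode_comp[i [j [ai fj kE]]]; rewrite leNgt => /negP; apply.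
have ir : flow_degree xi 0 i + grade s j < N%:R.
  apply: NP; apply/allpairsP; exists (i, grade s j); split=> //=.
    by apply: contraT => /csupport_out.
  by apply: contraT => /fS.
have Nn' : (N%:R : rat) <= n%:~R by rewrite -[N%:R]/(N%:Z%:~R) ler_int.
rewrite kE /grade flow_index_degree; move: ir; rewrite /grade; lra.
Qed.

Lemma product_jacobi :
  jacobi_identity (@vsa_par C L) (@vsa_Y C L) product_mode.
Proof.
move=> p q a b f l m n pa qb.
have [N1 H1] := wm_truncated (vsa_adjoint L) a b.
have [N2 H2] := product_mode_truncated b f.
have [N3 H3] := product_mode_truncated a f.
(* Beyond K0 all terms vanish in every flow, so that K0 does not depend on s. *)
pose K0 := (absz N1 + absz N2 + absz N3 + absz l + absz m + absz n)%N.
exists K0 => K K0K; apply: flow_product_eq => s; rewrite !flow_product_sum.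
have [Ks HK] := flow_jacobi kappa1 s (f s) l m n pa qb.
pose F (i : nat) : L := binz C m i *: flow_mode kappa1 s (vsa_Y a (l + i%:Z) b) (m + n - i%:Z) (f s).
pose G (i : nat) : L := ((-1) ^+ i * binz C l i) *:
    (flow_mode kappa1 s a (m + l - i%:Z) (flow_mode kappa1 s b (n + i%:Z) (f s))
     - ((-1) ^+ absz l * (-1) ^+ (p && q)) *:
       flow_mode kappa1 s b (n + l - i%:Z) (flow_mode kappa1 s a (m + i%:Z) (f s))).
have F0 (i : nat) : (K <= i)%N -> F i = 0.
  move=> Ki; rewrite /F H1; last by rewrite /K0 in K0K; lia.
  by rewrite flow_mode0l scaler0.
have G0 (i : nat) : (K <= i)%N -> G i = 0.
  move=> Ki; rewrite /G.
  have -> : flow_mode kappa1 s b (n + i%:Z) (f s) = 0.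
    by rewrite -[LHS]/(product_mode b (n + i%:Z) f s) H2 //; rewrite /K0 in K0K; lia.
  have -> : flow_mode kappa1 s a (m + i%:Z) (f s) = 0.
    by rewrite -[LHS]/(product_mode a (m + i%:Z) f s) H3 //; rewrite /K0 in K0K; lia.
  by rewrite !linear0 ?scaler0 ?subr0 ?addr0 ?scaler0.
have := HK (maxn K Ks) (leq_maxr _ _).
by rewrite (@sum_ord_stable _ F K _ (leq_maxl _ _) F0) (@sum_ord_stable _ G K _ (leq_maxl _ _) G0).
Qed.

Lemma product_is_weak_module :
  is_weak_module (@vsa_par C L) one (@vsa_Y C L) product_par product_mode.
Proof.
split.
- by apply: fiber_direct_sum => f; exists [:: true; false] => s i; case: (parity i).
- exact: product_mode_linear_l.
- exact: product_mode_linear_r.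
- exact: product_mode_parity.
- exact: product_mode_truncated.
- move=> n f; apply: flow_product_eq => s; rewrite /= flow_mode_vacuum.
  by case: ifP.
- exact: product_jacobi.
Qed.

Definition product_module : weak_module L := WeakModule product_is_weak_module.

Lemma product_Qplus_grading :
  @Qplus_grading C L omega product_module product_grading.
Proof.
split.
- by apply: fiber_direct_sum => f; apply: flow_product_bounded.
- move=> r r0 f fr; apply: flow_product_eq => s; apply: comp_ext => i.
  rewrite component0; apply: contrapT => ci; have := grade_ge0 s ci.
  suff -> : grade s i = r by rewrite leNgt r0.
  by apply/eqP; apply: contraT => ir; case: ci; apply: fr.
- by move=> r; apply: fiber_homogeneous.
move=> w a m r f wa fr s k kr; apply: contrapT => /flow_mode_comp[i [j [ai fj kE]]].
move/negP: kr; apply; rewrite kE /grade flow_index_degree.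
have -> : flow_degree xi 0 i = w by apply: (component_weight wa); apply/eqP; exact: ai.
have <- : grade s j = r by apply/eqP; apply: contraT => jr; case: fj; apply: fr.
by rewrite /grade; apply/eqP; ring.
Qed.

End Product.

(** * Irreducible submodules of the product of the flows *)

Section Irreducible.
Variables (C : numFieldType) (kappa : C) (V : affine_vsa kappa) (L : simple_quotient V).
Hypothesis kappa1 : kappa + 1 != 0.
Hypothesis kappa_gt0 : 0 < kappa.
Variable xi : rat.
Hypothesis xi01 : 0 < xi < 1.

Local Notation dsum := (homogeneous_direct_sum L kappa1).
Local Notation comp := (component dsum).
Local Notation one := (vsa_one L).
Local Notation M := (product_module L kappa1 xi01).
Local Notation flow := (flow_mode kappa1).
Implicit Types (s : nat) (n m : int) (a b u v : L) (i k : degree3) (f g : M).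

Lemma flow_uvec s u :
  flow s (uvec L) 0 u = vsa_Y (uvec L) 0 u - (2 * s%:R * kappa) *: u.
Proof.
rewrite (flow_modeE kappa1 _ _ _ (homogeneous_uvec L kappa1) (leqnn 2)).
rewrite /twisted_mode 2!big_ord_recl big_ord0 /= mulr0 !addr0 li0; congr (_ + _).
have E1 : li (flow_vec L s) 1 (uvec L) = (- (2 * s%:R * kappa)) *: one.
  have := liS (flow_vec L s) 0 (uvec L).
  rewrite big_ord1 !scale1r => ->; rewrite /flow_vec vsa_YlZ subn0 li0 (uvec_uvec L 1) /=.
  by rewrite scalerA; congr (_ *: _); ring.
by rewrite E1 vsa_YlZ (wm_vacuum (vsa_adjoint L)) scaleNr.
Qed.

Lemma flow_conformal s u : flow s (conformal L) 1 u =
  vsa_Y (conformal L) 1 u + s%:R *: vsa_Y (uvec L) 0 u - (s%:R ^+ 2 * kappa) *: u.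
Proof.
rewrite (flow_modeE kappa1 _ _ _ (homogeneous_conformal L kappa1) (leqnn 3)).
rewrite /twisted_mode 3!big_ord_recl big_ord0 /= mulr0 !addr0 li0.
have uomega (n : nat) : vsa_Y (uvec L) n.+1%:Z (conformal L) = if n == 0%N then uvec L else 0.
  rewrite vsa_YlB; case: n => [|n]; last by rewrite !conformal_mode_ge2 // subrr.
  by rewrite !conformal_mode1.
have E1 : li (flow_vec L s) 1 (conformal L) = s%:R *: uvec L.
  have := liS (flow_vec L s) 0 (conformal L).
  by rewrite big_ord1 !scale1r => ->; rewrite subn0 li0 vsa_YlZ (uomega 0%N).
have E2 : li (flow_vec L s) 2 (conformal L) = (- (s%:R ^+ 2 * kappa)) *: one.
  apply: (scalerI (a := 2%:R)); first by rewrite pnatr_eq0.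
  rewrite liS 2!big_ord_recl big_ord0 addr0 /= E1 li0 scale1r linearZ /= !vsa_YlZ.
  rewrite (uomega 1%N) /= !scaler0 addr0 (uvec_uvec L 1) /= !scalerA.
  by congr (_ *: _); ring.
rewrite E1 E2 !vsa_YlZ (wm_vacuum (vsa_adjoint L)) /= scaleNr addrA.
by congr (_ + _ *: vsa_Y _ _ _ - _).
Qed.

(** The Laurent polynomial field Y (Delta(h, z) a, z) starts with the field of [a], the
    other terms coming from vectors of lower degree, so a subspace stable under the
    twisted modes is stable under the original ones. *)
Lemma flow_stable s (I : set L) : subspace I ->
  (forall a n v, I v -> I (flow s a n v)) -> forall a n v, I v -> I (vsa_Y a n v).
Proof.
move=> sI fI.
have hom (d : nat) i a : homogeneous i a -> i.1.1 < d%:Z ->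
    forall n v, I v -> I (vsa_Y a n v).
  elim: d i a => [|d IH] i a ia id n v Iv.
    by rewrite (degree_neg kappa1 ia id) vsa_Yl0; apply: subspace0.
  have := fI a (n - s%:Z * i.1.2) v Iv.
  rewrite (flow_modeE kappa1 _ _ _ ia (leqnn _)) /twisted_mode big_ord_recl /= li0 subrK subr0.
  set rest := \sum_(j < _) _ => Iar.
  have Ir : I rest.
    apply: (subspace_sum_ord sI) => j; apply: (IH _ _ (li_homogeneous kappa1 s _ ia)) => //.
    by rewrite /bump /=; move: id; set x := i.1.1; lia.
  by rewrite -[vsa_Y a n v](addrK rest); apply: subspaceB.
move=> a n v Iv; move: a; apply: (homogeneous_ind dsum) => [|i a ia].
  split=> [|c a b /= Ia Ib]; first by rewrite /= vsa_Yl0; apply: subspace0.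
  by rewrite vsa_YlP; apply: subspaceP.
apply: (hom (absz i.1.1).+1 i) => //; by set x := i.1.1; lia.
Qed.

Local Notation at_ f s := (flow_fun (f : flow_product L kappa1 xi01) s).
Implicit Type N : set M.

Variable sub : set M -> Prop.
Hypothesis sub_weak : forall N, sub N -> weak_submodule N.
Hypothesis sub_kernel : forall N s, sub N -> sub [set f | N f /\ at_ f s = 0].

Lemma projection_ideal N s : weak_submodule N -> ideal [set v | exists2 f : M, N f & at_ f s = v].
Proof.
move=> [sN hN aN]; set I := [set v | _].
have sI : subspace I.
  split=> [|c u v [f Nf <-] [g Ng <-]]; first by exists 0 => //; apply: subspace0.
  by exists (c *: f + g) => //; apply: subspaceP.
have stable a n v : I v -> I (vsa_Y a n v).
  apply: flow_stable sI _ a n v => a n v [f Nf <-].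
  by exists (wm_Y a n f) => //; apply: aN.
apply: left_ideal_ideal => // [l F ul Fp [f Nf fE] p pl|c Ic]; last first.
  by rewrite -(conformal_translation kappa1); apply: stable.
have fS : f = \sum_(q <- [:: true; false]) fiber_part (fun _ i => parity i) q f.
  by apply: fiber_part_sum => // t i; case: (parity i).
exists (fiber_part (fun _ i => parity i) p f).
  apply: (hN [:: true; false] (fun q => fiber_part (fun _ i => parity i) q f)) => //.
  - by move=> q; apply: fiber_partP.
  - by rewrite -fS.
  - by case: (p).
apply: (comp_ext (kappa1 := kappa1)) => k; rewrite comp_fiber_fun fE comp_sum.
case: eqP => [kp|/eqP kp]; last by rewrite (proj1 (parityP kappa1 p _) (Fp p)).
rewrite (bigD1_seq p pl ul) /= big1 ?addr0 // => q qp.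
by apply: (proj1 (parityP kappa1 q _) (Fp q)); rewrite kp eq_sym.
Qed.

(** An irreducible submodule embeds into at most one spectral flow: its projections to
    two of them would be isomorphisms, and the vacuum of the first would correspond to
    a vector of L of negative degree. *)
Lemma irreducible_support N f s t : irreducible_among sub N -> N f ->
  at_ f s <> 0 -> at_ f t <> 0 -> s = t.
Proof.
move=> [subN _ minN] Nf fs ft; apply: contrapT => st.
have inj r g : at_ f r <> 0 -> N g -> at_ g r = 0 -> g = 0.
  move=> fr Ng gr; have [|K0|NK] := minN _ (sub_kernel r subN); first by move=> g' [].
    by apply: K0.
  by case: fr; case: (NK f Nf).
have [I0|I1] := proj2 (sq_simple L) _ (projection_ideal s (sub_weak subN)).
  by apply: fs; apply: I0; exists f.
(* The entry of y in the flow s is the vacuum; w is its entry in the flow t. *)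
have [y Ny ys] := I1 one.
have yw : at_ y t <> 0 by move=> /(inj t y ft Ny) y0; apply: (@one_neq0 _ _ _ L); rewrite -ys y0.
have [[N0 NP] _ aN] := sub_weak subN.
have transport a n (c : C) : flow s a n one = c *: one -> flow t a n (at_ y t) = c *: at_ y t.
  move=> ac; apply/eqP; rewrite -subr_eq0; apply/eqP.
  have Nz : N (wm_Y a n y - c *: y) by rewrite addrC -scaleNr; apply: NP => //; apply: aN.
  rewrite -[LHS]/(at_ (wm_Y a n y - c *: y) t) (inj s _ fs Nz) //.
  by rewrite -[LHS]/(flow s a n (at_ y s) - c *: at_ y s) ys ac subrr.
set w := at_ y t in yw.
have uw : vsa_Y (uvec L) 0 w = (2 * (t%:R - s%:R) * kappa) *: w.
  have := @transport (uvec L) 0 (- (2 * s%:R * kappa)).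
  rewrite !flow_uvec uvec_vacuum // sub0r scaleNr => /(_ erefl)/(canRL (subrK _)) ->.
  by rewrite -scalerDl; congr (_ *: _); ring.
have Lw : vsa_Y (conformal L) 1 w = (- (kappa * (t%:R - s%:R) ^+ 2)) *: w.
  have := @transport (conformal L) 1 (- (s%:R ^+ 2 * kappa)).
  rewrite !flow_conformal L0_vacuum uvec_vacuum // scaler0 addr0 sub0r scaleNr.
  move=> /(_ erefl)/(canRL (subrK _))/(canRL (addrK _)) ->.
  by rewrite uw scalerA -scalerDl -scalerBl; congr (_ *: _); ring.
have [k wk] : exists k, comp w k <> 0.
  apply: contrapT => none; apply: yw; apply: (comp_ext (kappa1 := kappa1)) => k.
  by rewrite component0; apply: contrapT => wk; apply: none; exists k.
have L0k : comp (vsa_Y (conformal L) 1 w) k = k.1.1%:~R *: comp w k.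
  move: w {yw uw Lw wk}; apply: (homogeneous_ind dsum) => [|i v iv].
    split=> [|c u v /= uE vE]; first by rewrite /= linear0 !component0 scaler0.
    by rewrite linearP /= !componentP uE vE scalerDr !scalerA mulrC.
  have [vE _ _] := iv; rewrite /= vE !(component_homogeneous dsum k iv).
  rewrite (component_homogeneous dsum k (subspaceZ _ (homogeneous_subspace L i) iv)).
  by case: eqP => [->|_] //; rewrite scaler0.
have k0 := degree_nonneg kappa1 (componentN dsum w k) wk.
move: L0k; rewrite Lw -[_ *: w]addr0 componentP component0 addr0 => /eqP.
rewrite -subr_eq0 -scalerBl scaler_eq0 => /orP[|/eqP//]; rewrite subr_eq0 => /eqP kE.
have : (0 : C) <= k.1.1%:~R by rewrite ler0z.
have -> : k.1.1%:~R = - (kappa * ((t%:Z - s%:Z) ^+ 2)%:~R) :> C.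
  by rewrite -kE rmorphXn /= intrB.
have d0 : (0 : C) < kappa * ((t%:Z - s%:Z) ^+ 2)%:~R.
  rewrite mulr_gt0 // ltr0z lt_def sqr_ge0 sqrf_eq0 subr_eq0 andbT.
  by apply/eqP => -[ts]; apply: st.
by rewrite oppr_ge0 => /(lt_le_trans d0); rewrite ltxx.
Qed.

Fact lowest_vectors_bounded : graded_bounded kappa1 xi01 (lowest_vector L kappa1 xi01).
Proof.
exists [:: 0] => s i; rewrite inE => i0.
have [hv _] := lowest_vectorP L kappa1 xi01 s.
rewrite (component_homogeneous dsum i hv); case: eqP => // iE; move: i0.
by rewrite iE /grade subrr eqxx.
Qed.

(** A vector with nonzero projections to infinitely many spectral flows lies in no
    finite sum of irreducible submodules. *)
Lemma not_completely_reducible : ~ completely_reducible sub.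
Proof.
move=> [I [N [dN irrN]]].
pose v : M := make_flow lowest_vectors_bounded.
have [_ /(_ v)[l [F [ul NF vE]]] _] := dN.
have ex s : exists j : I, j \in l /\ at_ (F j) s <> 0.
  apply: contrapT => none; have [_] := lowest_vectorP L kappa1 xi01 s; apply.
  rewrite -[LHS]/(at_ v s) vE.
  rewrite (flow_product_sum l F) big1_seq // => j /andP[_ jl].
  by apply: contrapT => Fj; apply: none; exists j.
pose c s := projT1 (cid (ex s)).
have cl s : c s \in l by have [] := projT2 (cid (ex s)).
have cF s : at_ (F (c s)) s <> 0 by have [] := projT2 (cid (ex s)).
have c_inj : injective c.
  move=> s t st; apply: (irreducible_support (irrN (c s)) (NF _) (cF s)).
  by rewrite st; exact: cF.
have := uniq_leq_size (s1 := [seq c s | s <- iota 0 (size l).+1]) (s2 := l).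
rewrite (map_inj_uniq c_inj) iota_uniq size_map size_iota ltnn => /(_ isT) H.
by suff : false by []; apply: H => _ /mapP[s _ ->].
Qed.

End Irreducible.

(** * Local nilpotency of the positive part *)

Section Nilpotency.
Variables (C : numFieldType) (kappa : C) (V : affine_vsa kappa) (L : simple_quotient V).
Hypothesis kappa1 : kappa + 1 != 0.
Variable xi : rat.
Hypothesis xi01 : 0 < xi < 1.
Variables (M : weak_module L) (gr : rat -> set M).
Hypothesis grM : Qplus_grading (sq_proj L (omega_xi V xi)) gr.

Definition graded_below (t : rat) : set M := span [set u | exists2 n, n <= t & gr n u].

(** x(n) with n > 0 lowers the degree by at least 1 - xi, and x(0) with x in n_+ by at
    least xi / 2. *)
Definition lowering : rat := Num.min (xi / 2) (1 - xi).

Lemma lowering_gt0 : 0 < lowering.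
Proof.
by have [x0 x1] := andP xi01; rewrite lt_min divr_gt0 ?ltr0n //= subr_gt0.
Qed.

Lemma basis_weight g : (g < 8)%N ->
  has_weight (sq_proj L (omega_xi V xi)) (1 - xi / 2 * (hweight g)%:~R)
    (current L (basis C g)).
Proof.
move=> g8; apply/has_weight_omega => //.
have [-> _ ->] := homogeneous_basis L kappa1 g8.
rewrite scalerA -scalerBl; congr (_ *: _).
rewrite [RHS]rmorphB /=; congr (_ - _); first by rewrite !rmorph1.
by rewrite [RHS]rmorphM /= ratr_int.
Qed.

Lemma graded_below_subspace t : subspace (graded_below t).
Proof. exact: span_subspace. Qed.

Lemma current_lowers g (n : nat) t u : (g < 8)%N ->
  (0 < n)%N || (0 < hweight g) -> graded_below t u ->
  graded_below (t - lowering) (wm_Y (current L (basis C g)) n%:Z u).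
Proof.
move=> g8 ng; move: u; apply: span_ind.
  exact/preimage_subspace/graded_below_subspace.
move=> u [r rt ru]; apply: (@sub_span _ _ [set u | _]).
have [_ _ _ act] := grM; have := act _ _ n%:Z _ _ (basis_weight g8) ru.
move=> gu; eexists; last exact: gu.
have [x0 x1] := andP xi01.
have l1 : lowering <= xi / 2 by rewrite ge_min lexx.
have l2 : lowering <= 1 - xi by rewrite ge_min lexx orbT.
have n0 : (0 : rat) <= n%:R by rewrite ler0n.
have n1 : if (0 < n)%N then 1 <= n%:R :> rat else true by case: ifP => //; rewrite ler1n.
move: ng n1; rewrite hweight_table //; rewrite -[n%:~R]/(n%:R).
case: g g8 {gu} => [|[|[|[|[|[|[|[|g]]]]]]]] // _ /=; case: (0 < n)%N => //= _ n1;
  rewrite ?rmorphN /=; lra.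
Qed.

Lemma Nplus_lowers (N : nat) (y : nat -> sl21 C) t u : nplus (y 0%N) ->
  graded_below t u -> graded_below (t - lowering) (Nplus_act (L := L) N y u).
Proof.
move=> y0 tu; have sB := graded_below_subspace (t - lowering).
apply: (subspace_sum_ord sB) => n; rewrite /current_mode.
rewrite -[sq_proj L _]/(current L (y n)).
case: n => [[|n] nN] /=.
  have [a [b [c ->]]] := y0.
  rewrite !linearD !linearZ /= !wm_YlD !wm_YlZ.
  do 2?apply: (subspaceD sB); apply: (subspaceZ _ sB).
  - exact: (@current_lowers 4 0).
  - exact: (@current_lowers 5 0).
  - exact: (@current_lowers 2 0).
rewrite [y _]basis_expand linear_sum wm_Yl_sum; apply: (subspace_sum_ord sB) => k.
by rewrite linearZ wm_YlZ; apply: (subspaceZ _ sB); apply: current_lowers.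
Qed.

Lemma graded_below_neg t u : t < 0 -> graded_below t u -> u = 0.
Proof.
move=> t0; move: u; apply: span_ind => [|u [n nt nu]].
  by split=> [//|c u v /= -> ->]; rewrite scaler0 addr0.
have [_ neg _ _] := grM; exact: neg n (le_lt_trans nt t0) u nu.
Qed.

Lemma graded_in_category : in_category M.
Proof.
move=> N y y0 u; have [[_ dec _] _ _ _] := grM.
have [l [f [ul gf ->]]] := dec u; have [B BP] := seq_bound l.
have low : graded_below B%:R (\sum_(i <- l) f i).
  apply: (subspace_sum (graded_below_subspace _)) => i il.
  by apply: (@sub_span _ _ [set u | _]); exists i => //; apply/ltW/BP.
have iterP k v t : graded_below t v ->
    graded_below (t - lowering *+ k) (iter k (Nplus_act (L := L) N y) v).
  move=> tv; elim: k => [|k IH]; first by rewrite mulr0n subr0.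
  by rewrite mulrS opprD addrA addrAC; apply: Nplus_lowers.
have [k kP] : exists k : nat, B%:R < lowering *+ k.
  exists (Num.bound (B%:R / lowering)).
  rewrite -[lowering *+ _]mulr_natl -ltr_pdivrMr ?lowering_gt0 //.
  by apply: archi_boundP; rewrite divr_ge0 ?ler0n // ltW ?lowering_gt0.
by exists k; apply: graded_below_neg (iterP k _ _ low); rewrite subr_lt0.
Qed.

End Nilpotency.

(** * Failure of semisimplicity *)

Section Kernels.
Variables (C : numFieldType) (kappa : C) (V : affine_vsa kappa) (L : simple_quotient V).
Hypothesis kappa1 : kappa + 1 != 0.
Variable xi : rat.
Hypothesis xi01 : 0 < xi < 1.

Local Notation M := (product_module L kappa1 xi01).
Local Notation at_ f s := (flow_fun (f : flow_product L kappa1 xi01) s).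

Lemma fiber_sum_vanish (J : choiceType) (phi : nat -> degree3 -> J)
    (N : set M) s : homogeneous_subset (fiber phi) N ->
  homogeneous_subset (fiber (kappa1 := kappa1) (xi01 := xi01) phi) [set f : M | N f /\ at_ f s = 0].
Proof.
move=> hN l F ul Fj [/= NF F0] j jl; split; first exact: hN NF j jl.
apply: (comp_ext (kappa1 := kappa1)) => k; rewrite component0.
have [kj|kj] := eqVneq (phi s k) j; last exact: Fj.
rewrite (fiber_sum_comp ul Fj jl kj).
by rewrite -[flow_fun _ s]/(at_ (\sum_(j <- l) F j : M) s) F0 component0.
Qed.

Lemma weak_submodule_kernel (N : set M) s : weak_submodule N ->
  weak_submodule [set f : M | N f /\ at_ f s = 0].
Proof.
move=> [sN hN aN]; split; last 1 first.
- move=> a n f [Nf f0]; split; first exact: aN.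
  by rewrite -[LHS]/(flow_mode kappa1 s a n (at_ f s)) f0 linear0.
- split=> [|c f g [Nf f0] [Ng g0]]; first by split=> //; apply: subspace0.
  split; first exact: subspaceP.
  by rewrite -[LHS]/(c *: at_ f s + at_ g s) f0 g0 scaler0 addr0.
exact: fiber_sum_vanish.
Qed.

Lemma graded_submodule_kernel (N : set M) s :
  @graded_submodule C L M (product_grading (L := L) (kappa1 := kappa1) (xi01 := xi01)) N ->
  @graded_submodule C L M (product_grading (L := L) (kappa1 := kappa1) (xi01 := xi01))
    [set f : M | N f /\ at_ f s = 0].
Proof.
move=> [wN hN]; split; first exact: weak_submodule_kernel.
exact: fiber_sum_vanish.
Qed.

End Kernels.

(** The level enters through its sign: the vector of L which would correspond to the
    vacuum of another flow has degree - kappa d^2, where d is a nonzero integer. *)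
Theorem affine_not_rational (C : numFieldType) (kappa : C) (xi : rat)
    (V : affine_vsa kappa) (L : simple_quotient V) : 0 < kappa -> 0 < xi < 1 ->
  ~ rational_vosa (sq_proj L (omega_xi V xi)) /\ ~ semisimple_category L.
Proof.
move=> k0 xi01.
have kappa1 : kappa + 1 != 0 by rewrite gt_eqF // addr_gt0.
have grM := product_Qplus_grading L kappa1 xi01; split=> [rat_L|ss_L].
  apply: (not_completely_reducible k0 _ (graded_submodule_kernel (kappa1 := kappa1)
    (xi01 := xi01)) (rat_L _ _ grM)).
  by move=> N [].
apply: (not_completely_reducible k0 _ (weak_submodule_kernel (kappa1 := kappa1)
  (xi01 := xi01)) (ss_L _ (graded_in_category kappa1 xi01 grM))).
by [].
Qed.

Theorem theorem5p3 (R : realType) (xi : rat)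
    (V : affine_vsa (2^-1 : R[i])) (L : simple_quotient V) :
  0 < xi < 1 ->
  ~ rational_vosa (sq_proj L (omega_xi V xi)) /\ ~ semisimple_category L.
Proof. by apply: affine_not_rational; rewrite invr_gt0 ltr0n. Qed.
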